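(* Let $n\ge1$, let $(V,\eta)$ be a Minkowski space of dimension $n+2$, and let $G\subset SO(V)$ be a connected Lie subgroup (not necessarily closed) that acts transitively on the Lobachevskian space $L^{n+1}$. Then either $G=SO^0(V)$, or $G$ preserves an isotropic line $l\subset V$ and there exists an adapted basis $p,e_1,\dots,e_n,q$ of $V$ such that $l=\mathbb{R}p$ and, with respect to the subgroups $A,K,N$ determined by this basis, $G$ is one of the following groups: (1) $(A\times H)\ltimes N$, where $H\subset K$ is a subgroup; (2) $(A^\Phi\times H)\ltimes N$, where $H\subset K$ is a subgroup, $\Phi:A\to K$ is a non-trivial homomorphism of Lie groups and $A^\Phi=\{\Phi(a)\cdot a:a\in A\}\subset K\times A$. Moreover, the groups of the form $A\ltimes N$ and $A^\Phi\ltimes N$ (for adapted bases of $V$ and homomorphisms $\Phi$ as in (2)) exhaust all connected Lie subgroups of $SO(V)$ that act simply transitively on $L^{n+1}$.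
   Context: $(V,\eta)$ is a real vector space of dimension $n+2$ with a nondegenerate symmetric bilinear form of signature $(1,n+1)$ (one minus sign, $n+1$ plus signs). $SO(V)$ is the Lie group of $\eta$-preserving linear automorphisms of $V$ of determinant $1$, and $SO^0(V)$ its identity component. A basis $p,e_1,\dots,e_n,q$ of $V$ is called adapted if $\eta(p,p)=\eta(q,q)=0$, $\eta(p,q)=1$, $\eta(e_i,e_j)=\delta_{ij}$, $\eta(p,e_i)=\eta(q,e_i)=0$. For an adapted basis put $E=\mathrm{span}\{e_1,\dots,e_n\}$ (Euclidean with inner product $\eta|_E$). The Lobachevskian space is $L^{n+1}=\{x\in V:\eta(x,x)=-1,\ x_0>0\}$, i.e. one of the two sheets of the hyperboloid $\eta(x,x)=-1$, where $x_0$ is the coordinate along $e_0=\frac{\sqrt2}{2}(p-q)$ in the basis $e_0,e_1,\dots,e_n,e_{n+1}=\frac{\sqrt2}{2}(p+q)$ coming from one fixed adapted basis. Connected subgroups of $SO(V)$ preserve $L^{n+1}$ and act on it by isometries. For an adapted basis the subgroups $A,K,N\subset SO(V)$ are given, in matrices with respect to $p,e_1,\dots,e_n,q$, by $$A=\left\{\begin{pmatrix}a&0&0\\0&\mathrm{id}&0\\0&0&\frac1a\end{pmatrix}:a>0\right\},\quad K=\left\{\begin{pmatrix}1&0&0\\0&f&0\\0&0&1\end{pmatrix}:f\in SO(E)\right\},\quad N=\left\{\begin{pmatrix}1&-X^t&-\frac12X^tX\\0&\mathrm{id}&X\\0&0&1\end{pmatrix}:X\in E\right\}.$$ The identity component of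 the stabilizer of the line $\mathbb{R}p$ in $SO(V)$ is $(A\times K)\ltimes N$. In all semidirect products the factor on the right of $\ltimes$ is the normal subgroup. *)

(* Defs.v *)
From HB Require Import structures.
From mathcomp Require Import all_boot all_order all_algebra.
From mathcomp Require Import sesquilinear.
From mathcomp Require Import all_classical all_reals all_analysis.

Set Implicit Arguments.
Unset Strict Implicit.
Unset Printing Implicit Defensive.

Import Order.TTheory GRing.Theory Num.Theory.
Import numFieldNormedType.Exports.

Local Open Scope classical_set_scope.
Local Open Scope ring_scope.

Section Endomorphisms.
Context {R : realType} {V : vectType R}.
Implicit Types (X Y f g : 'End(V)) (G S T : set 'End(V)).

(* Column convention: the j-th column holds the coordinates of f b_j.  (The
   matrices of the vector library act on row vectors instead.) *)
Definition mx_in m (b : m.-tuple V) f : 'M[R]_m :=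
  \matrix_(i, j) coord b i (f b`_j).

Definition end_in m (b : m.-tuple V) (M : 'M[R]_m) : 'End(V) :=
  linfun (fun v => \sum_i (\sum_j M i j * coord b j v) *: b`_i).

(* The determinant, topology and exponential of End(V) are read off in the
   library's basis of V; none of them depends on that choice. *)
Definition end_mx f : 'M[R]_(\dim {:V}) := mx_in (vbasis {:V}) f.

Definition end_det f : R := \det (end_mx f).

Definition expmx m (M : 'M[R]_m) : 'M[R]_m :=
  limn (series (fun k => k`!%:R^-1 *: M ^+ k)).

Definition end_exp X : 'End(V) := end_in (vbasis {:V}) (expmx (end_mx X)).

(* Elements of S are meant to be invertible, so that f^-1 is the inverse. *)
Definition is_subgroup S : Prop :=
  [/\ S \1%VF,
      forall f g, S f -> S g -> S (f \o g)%VF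
    & forall f, S f -> S (f^-1)%VF].

Definition direct_product G S T : Prop :=
  [/\ is_subgroup S, is_subgroup T,
      forall f g, S f -> T g -> (f \o g = g \o f)%VF,
      S `&` T = [set \1%VF]
    & G = [set (f \o g)%VF | f in S & g in T]].

(* S |x T with the factor T normal. *)
Definition semidirect_product G S T : Prop :=
  [/\ is_subgroup S, is_subgroup T,
      forall f g, G f -> T g -> T (f \o g \o f^-1)%VF,
      S `&` T = [set \1%VF]
    & G = [set (f \o g)%VF | f in S & g in T]].

Definition lie_algebra G : set 'End(V) :=
  [set X | forall t : R, G (end_exp (t *: X))].

Definition is_lie_subalgebra (h : set 'End(V)) : Prop :=
  [/\ h 0,
      forall X Y, h X -> h Y -> h (X + Y),
      forall (t : R) X, h X -> h (t *: X)
    & forall X Y, h X -> h Y -> h ((X \o Y)%VF - (Y \o X)%VF)].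

(* Connected Lie subgroups, not necessarily closed, of a linear group S, as
   defined in B. C. Hall, Lie Groups, Lie Algebras, and Representations (2nd
   ed.), Definition 5.19. *)
Definition connected_lie_subgroup S G : Prop :=
  [/\ G `<=` S,
      is_subgroup G,
      is_lie_subalgebra (lie_algebra G)
    & forall f, G f -> exists s : seq 'End(V),
        (forall X, X \in s -> lie_algebra G X) /\
        f = foldr (fun X g => (end_exp X \o g)%VF) \1%VF s].

Definition acts_on G (L : set V) : Prop :=
  forall f x, G f -> L x -> L (f x).

Definition acts_transitively G (L : set V) : Prop :=
  acts_on G L /\
  forall x y, L x -> L y -> exists f, G f /\ f x = y.

Definition acts_simply_transitively G (L : set V) : Prop :=
  acts_on G L /\
  forall x y, L x -> L y -> exists! f, G f /\ f x = y.

Definition preserves G (l : {vspace V}) : Prop :=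
  forall f, G f -> (f @: l)%VS = l.

End Endomorphisms.

Section Minkowski.
Context {R : realType} {V : vectType R}.
Variable eta : {symmetric V}.

(* r minus signs and s plus signs. *)
Definition has_signature (r s : nat) : Prop :=
  exists b : (r + s).-tuple V, basis_of {:V} b /\
    forall i j : 'I_(r + s),
      eta b`_i b`_j = if i == j then (if (i < r)%N then -1 else 1) else 0.

Definition is_minkowski (n : nat) : Prop :=
  [/\ \dim {:V} = (n + 2)%N, nondegenerate eta & has_signature 1 (n + 1)].

Definition SO : set 'End(V) :=
  [set f : 'End(V) | (forall x y, eta (f x) (f y) = eta x y) /\ end_det f = 1].

Definition SO0 : set 'End(V) :=
  [set f | connected_component (end_mx @` SO) (end_mx \1%VF) (end_mx f)].

Definition isotropic_line (l : {vspace V}) : Prop :=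
  \dim l = 1%N /\ forall x, x \in l -> eta x x = 0.

End Minkowski.

Record frame (R : realType) (V : vectType R) (n : nat) := Frame {
  fr_p : V;
  fr_e : n.-tuple V;
  fr_q : V }.

Section Frames.
Context {R : realType} {V : vectType R} {n : nat}.
Implicit Types (F : frame V n) (Phi : 'End(V) -> 'End(V)).

(* The size is 1 + (n + 1), so that matrices in this basis are block matrices
   of the shape 1, n, 1. *)
Definition fr_basis F : (1 + (n + 1)).-tuple V :=
  cons_tuple (fr_p F) (cat_tuple (fr_e F) [tuple fr_q F]).

Definition adapted (eta : {symmetric V}) F : Prop :=
  [/\ basis_of {:V} (fr_basis F),
      [/\ eta (fr_p F) (fr_p F) = 0, eta (fr_q F) (fr_q F) = 0
        & eta (fr_p F) (fr_q F) = 1],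
      forall i j : 'I_n, eta (fr_e F)`_i (fr_e F)`_j = (i == j)%:R
    & forall i : 'I_n, eta (fr_p F) (fr_e F)`_i = 0
                    /\ eta (fr_q F) (fr_e F)`_i = 0].

(* The basis e_0, e_1, ..., e_n, e_(n+1). *)
Definition lorentz_basis F : (1 + (n + 1)).-tuple V :=
  cons_tuple ((Num.sqrt 2 / 2) *: (fr_p F - fr_q F))
    (cat_tuple (fr_e F) [tuple (Num.sqrt 2 / 2) *: (fr_p F + fr_q F)]).

Definition lobachevskian (eta : {symmetric V}) F : set V :=
  [set x | eta x x = -1 /\ 0 < coord (lorentz_basis F) ord0 x].

Definition A_elt F (a : R) : 'End(V) :=
  end_in (fr_basis F)
    (block_mx a%:M 0
              0    (block_mx 1%:M 0
                             0    (a^-1)%:M)).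

Definition K_elt F (f : 'M[R]_n) : 'End(V) :=
  end_in (fr_basis F)
    (block_mx 1%:M 0
              0    (block_mx f 0
                             0 1%:M)).

Definition N_elt F (X : 'cV[R]_n) : 'End(V) :=
  end_in (fr_basis F)
    (block_mx 1%:M (row_mx (- X^T) (- (2^-1 *: (X^T *m X))))
              0    (block_mx 1%:M X
                             0    1%:M)).

Definition A_group F : set 'End(V) := [set A_elt F a | a in [set a | 0 < a]].

Definition K_group F : set 'End(V) :=
  [set K_elt F f | f in [set f | f^T *m f = 1%:M /\ \det f = 1]].

Definition N_group F : set 'End(V) := [set N_elt F X | X in setT].

(* Only the restriction of Phi to A matters; smoothness is that of the matrix
   entries as functions of the global coordinate a > 0 on A. *)
Definition lie_group_hom F Phi : Prop :=
  [/\ forall f, A_group F f -> K_group F (Phi f),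
      forall f g, A_group F f -> A_group F g ->
        Phi (f \o g)%VF = (Phi f \o Phi g)%VF
    & forall i j k (a : R), 0 < a ->
        derivable
          (derive1n k (fun t => mx_in (fr_basis F) (Phi (A_elt F t)) i j)) a 1].

Definition nontrivial_hom F Phi : Prop :=
  exists f, A_group F f /\ Phi f <> \1%VF.

Definition twisted_A F Phi : set 'End(V) :=
  [set (Phi f \o f)%VF | f in A_group F].

End Frames.

(* Main.v *)
(** Let g be the Lie algebra of G, and let a /\ b denote the skew endomorphism
    v |-> eta(a,v) b - eta(b,v) a.

    By transitivity G contains A(t) c_t for every t > 0, where A(t) is in the
    group A of a given adapted basis and c_t fixes p - q.  The isometries c_t
    range over a compact set; let c be a limit point for t -> oo.  For X in g,
    conjugating X by A(t) c_t and dividing by t gives in the limit the part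
    p /\ x of c X c^-1, and this lies in g since g is finite-dimensional.
    Either all these parts vanish, and then the isotropic line of c^-1 q is
    invariant under G, or g contains some p /\ u with u <> 0 orthogonal to p
    and q.  In the latter case, if Rp is not invariant either, conjugating by an
    element of G which moves Rp yields q /\ v in g for a second isotropic q;
    brackets then show that W = {w : p /\ w in g} is g-invariant and contains p
    and q.  An invariant subspace containing p and q is all of V, because a
    proper one would meet the hyperboloid in a proper nonempty G-invariant
    subset.  Hence g contains every wedge, so G contains enough rotations to be
    SO^0(V).

    If Rp is invariant, transitivity gives X in g with X p = p.  Since X also has
    the eigenvalue -1, q can be chosen with X q = -q, so exp(tX) = A(e^t) c_t with
    c_t fixing p and q.  The same limit argument gives the inclusion of p /\ E
    in g.  Removing from the rotational part of X its projection to the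
    subalgebra h of g killing p and q, one gets q /\ p + B in g with B commuting
    with h.  Then H is generated by exp h, and Phi(a) = exp(ln(a) B).  If G is
    simply transitive, then H is trivial, since it fixes the point of the
    hyperboloid on the line of p - q.

    Conversely, a homomorphism Phi : A -> K is of the form exp(ln(a) B), the Lie
    algebra of A^Phi |x N is R (q /\ p + B) + p /\ E, and simple transitivity is
    a computation in horospherical coordinates. *)
Require Import Defs.
From HB Require Import structures.
From mathcomp Require Import all_boot all_order all_algebra.
From mathcomp Require Import sesquilinear.
From mathcomp Require Import all_classical all_reals all_analysis.
From mathcomp Require Import ring lra.

Set Implicit Arguments.
Unset Strict Implicit.
Unset Printing Implicit Defensive.

Import Order.TTheory GRing.Theory Num.Theory.
Import numFieldNormedType.Exports.

Local Open Scope classical_set_scope.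
Local Open Scope ring_scope.

(** * Exponentials of matrices and of endomorphisms *)

(** The main obstacle is that [G] need not be closed, so a limit of elements of [G] is not known to
    lie in [G]. Limits are taken only inside the Lie algebra, of rescaled conjugates of a fixed
    element; neither the compact factors of the conjugating isometries nor their limit [c0] need
    belong to [G]. When [Rp] is invariant, the limit therefore gives only [p /\ c0 x] instead of
    [p /\ x], and a dimension count has to remove [c0]. No Baker-Campbell-Hausdorff formula is used.
    Identities between exponentials come from uniqueness for linear differential equations, and two
    isometries that scale [p] by the same factor are compared through their action on [p^perp / p]:
    if these agree, they differ by an element of [N]. Statements about [G] are reduced to its Lie
    algebra by induction on words in exponentials, as the definition of a connected Lie subgroup
    allows. *)

Lemma cvg_mx_entries (R : realType) (m n : nat) (T : Type) (F : set_system T)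
    (FF : Filter F) (u : T -> 'M[R]_(m, n)) (l : 'M[R]_(m, n)) :
  (forall i j, u k i j @[k --> F] --> l i j) -> u @ F --> l.
Proof.
move=> ul; apply/cvgrPdist_le => e e0.
have H : \forall k \near F, forall i : 'I_m * 'I_n,
    `|l i.1 i.2 - u k i.1 i.2| <= e.
  apply: (@filter_forall _ _ (fun i k => `|l i.1 i.2 - u k i.1 i.2| <= e)) => i.
  by have /cvgrPdist_le/(_ e e0) := ul i.1 i.2.
near=> k.
rewrite /Num.Def.normr/= mx_normrE (bigmax_le _ (ltW e0))//= => i _.
by rewrite !mxE/=; move: i; near: k.
Unshelve. all: by end_near. Qed.

Lemma cvg_entry (R : realType) (m n : nat) (u : nat -> 'M[R]_(m, n))
    (l : 'M[R]_(m, n)) i j :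
  u @ \oo --> l -> u k i j @[k --> \oo] --> l i j.
Proof.
move=> ul; exact: (cvg_comp u (fun M : 'M[R]_(m, n) => M i j) ul
  (@coord_continuous _ m n i j l)).
Qed.

Lemma cvg_sumr (R : realType) m (f : 'I_m -> nat -> R) (a : 'I_m -> R) :
  (forall l, f l k @[k --> \oo] --> a l) ->
  \sum_l f l k @[k --> \oo] --> \sum_l a l.
Proof.
move=> fa; apply: cvg_big => [|l _]; [exact: add_continuous | exact: fa].
Qed.

Section MatrixExp.
Context {R : realType}.

(** The sum of the absolute values of all entries dominates every row sum, so it behaves like a
    submultiplicative norm; this crude bound compares the series with that of the real
    exponential. *)
Lemma powmx_bound m (M : 'M[R]_m) k i j :
  `|(M ^+ k) i j| <= (\sum_i \sum_j `|M i j|) ^+ k.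
Proof.
set c := \sum_i _.
have c0 : 0 <= c by apply: sumr_ge0 => a _; apply: sumr_ge0.
elim: k i j => [|k IH] i j.
  by rewrite !expr0 mxE; case: (i == j); rewrite ?normr1 ?normr0.
rewrite exprS mxE exprS.
apply: le_trans (ler_norm_sum _ _ _) _.
apply: (@le_trans _ _ (\sum_l `|M i l| * c ^+ k)).
  by apply: ler_sum => l _; rewrite normrM ler_wpM2l.
rewrite -mulr_suml ler_wpM2r ?exprn_ge0//.
rewrite /c [leRHS](bigD1 i)//= lerDl; apply: sumr_ge0 => a _; exact: sumr_ge0.
Qed.

(** Coefficients of the power series in [t] of the entry [(i, j)] of [exp(t M)]. Working with scalar
    power series gives access to termwise differentiation. *)
Definition exp_entry_coef m (M : 'M[R]_m) i j : nat -> R :=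
  fun k => k`!%:R^-1 * (M ^+ k) i j.

Lemma cvg_exp_entry m (M : 'M[R]_m) i j x :
  cvgn (pseries (exp_entry_coef M i j) x).
Proof.
set c := \sum_i \sum_j `|M i j|.
have c0 : 0 <= c by apply: sumr_ge0 => a _; apply: sumr_ge0.
apply: normed_cvg.
apply: (@series_le_cvg _ _ (exp_coeff (c * `|x|))).
- by move=> k; exact: normr_ge0.
- by move=> k; rewrite /exp_coeff /= divr_ge0// exprn_ge0// mulr_ge0.
- move=> k; rewrite /exp_entry_coef /exp_coeff /= !normrM normfV normr_nat normrX.
  rewrite exprMn [leRHS]mulrC mulrA ler_wpM2r ?exprn_ge0//.
  by rewrite ler_wpM2l ?invr_ge0//; exact: powmx_bound.
- exact: is_cvg_series_exp_coeff.
Qed.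

Lemma cvg_expmx m (M : 'M[R]_m) :
  series (fun k => k`!%:R^-1 *: M ^+ k) @ \oo --> expmx M.
Proof.
suff H : cvgn (series (fun k => k`!%:R^-1 *: M ^+ k)) by exact: H.
apply/cvg_ex; exists (\matrix_(i, j) limn (pseries (exp_entry_coef M i j) 1)).
apply: cvg_mx_entries => i j; rewrite mxE.
suff -> : (fun k => series (fun k => k`!%:R^-1 *: M ^+ k) k i j) =
    pseries (exp_entry_coef M i j) 1 by exact: cvg_exp_entry.
apply/funext => k.
rewrite /pseries /series /= summxE; apply: eq_bigr => l _.
by rewrite mxE expr1n mulr1.
Qed.

Lemma powmxZ m (M : 'M[R]_m) t k : (t *: M) ^+ k = t ^+ k *: M ^+ k.
Proof.
elim: k => [|k IH]; first by rewrite !expr0 scale1r.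
rewrite !exprS IH.
by rewrite -[LHS]/(_ *m _) -scalemxAl -scalemxAr scalerA.
Qed.

Lemma expmxE m (M : 'M[R]_m) t i j :
  expmx (t *: M) i j = limn (pseries (exp_entry_coef M i j) t).
Proof.
have /(@cvg_entry _ _ _ _ _ i j)/cvg_lim <- // := @cvg_expmx _ (t *: M).
congr (limn _); apply/funext => k.
rewrite /series /= summxE; apply: eq_bigr => l _.
by rewrite mxE /exp_entry_coef powmxZ mxE mulrA mulrAC.
Qed.

Definition mx_derive m n (g : R -> 'M[R]_(m, n)) (t : R) (D : 'M[R]_(m, n)) :=
  forall i j, is_derive t (1 : R) (fun s => g s i j) (D i j).

Lemma pseries_diffs_entry m (M : 'M[R]_m) i j :
  pseries_diffs (exp_entry_coef M i j) =
  fun k => \sum_l M i l * exp_entry_coef M l j k.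
Proof.
apply/funext => k; rewrite /pseries_diffs /exp_entry_coef exprS mxE.
rewrite factS natrM invfM !mulrA mulfV ?pnatr_eq0// mul1r mulr_sumr.
by apply: eq_bigr => l _; rewrite mulrCA.
Qed.

Lemma cvg_pseries_sum m (c : 'I_m -> nat -> R) (a : 'I_m -> R) x :
  (forall l, cvgn (pseries (c l) x)) ->
  pseries (fun k => \sum_l a l * c l k) x @ \oo -->
  \sum_l a l * limn (pseries (c l) x).
Proof.
move=> cc.
have -> : pseries (fun k => \sum_l a l * c l k) x =
    fun k => \sum_l (a l * pseries (c l) x k).
  apply/funext => k; rewrite /pseries /series /=.
  under [RHS]eq_bigr do rewrite mulr_sumr.
  rewrite exchange_big /=; apply: eq_bigr => i _.
  by rewrite mulr_suml; apply: eq_bigr => l _; rewrite mulrA.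
apply: cvg_sumr => l; apply: cvgMl_tmp; exact: cc.
Qed.

Lemma expmx_derive m (M : 'M[R]_m) t :
  mx_derive (fun s => expmx (s *: M)) t (M *m expmx (t *: M)).
Proof.
move=> i j.
have -> : (fun s => expmx (s *: M) i j) =
    (fun s => limn (pseries (exp_entry_coef M i j) s)).
  by apply/funext => s; exact: expmxE.
have cvg1 a b y : cvgn (pseries (pseries_diffs (exp_entry_coef M a b)) y).
  rewrite pseries_diffs_entry; apply/cvg_ex; eexists; apply: cvg_pseries_sum.
  by move=> l; exact: cvg_exp_entry.
have -> : (M *m expmx (t *: M)) i j =
    limn (pseries (pseries_diffs (exp_entry_coef M i j)) t).
  rewrite pseries_diffs_entry mxE; symmetry; apply/cvg_lim => //.
  rewrite (eq_bigr (fun l => M i l * limn (pseries (exp_entry_coef M l j) t))).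
    by apply: cvg_pseries_sum => l; exact: cvg_exp_entry.
  by move=> l _; rewrite expmxE.
(* Termwise differentiation at [t] asks for convergence of the series and of its first two formal
   derivatives at some point of larger modulus; [|t| + 1] is such a point. *)
apply: (@pseries_snd_diffs _ _ (`|t| + 1)).
- exact: cvg_exp_entry.
- exact: cvg1.
- rewrite [pseries_diffs (exp_entry_coef M i j)]pseries_diffs_entry.
  have -> : pseries_diffs (fun k => \sum_l M i l * exp_entry_coef M l j k) =
      fun k => \sum_l M i l * pseries_diffs (exp_entry_coef M l j) k.
    apply/funext => k; rewrite /pseries_diffs mulr_sumr.
    by apply: eq_bigr => l _; rewrite mulrCA.
  apply/cvg_ex; eexists; apply: cvg_pseries_sum => l; exact: cvg1.
- by rewrite [ltRHS]ger0_norm ?addr_ge0// ltrDl.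
Qed.

Lemma mx_derive_cst m n (C : 'M[R]_(m, n)) t : mx_derive (fun=> C) t 0.
Proof. by move=> i j; rewrite mxE; exact: is_derive_cst. Qed.

Lemma mx_derive_mul m n p (f : R -> 'M[R]_(m, n)) (g : R -> 'M[R]_(n, p)) t D E :
  mx_derive f t D -> mx_derive g t E ->
  mx_derive (fun s => f s *m g s) t (D *m g t + f t *m E).
Proof.
move=> fD gE i j.
have -> : (fun s => (f s *m g s) i j) =
    \sum_l ((fun s => f s i l) * (fun s => g s l j)).
  by apply/funext => s; rewrite mxE fct_sumE.
have -> : (D *m g t + f t *m E) i j =
    \sum_l (f t i l *: E l j + g t l j *: D i l).
  rewrite !mxE -big_split /=; apply: eq_bigr => l _.
  by rewrite addrC [D i l * _]mulrC.
apply: is_derive_sum => l; exact: is_deriveM.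
Qed.

Lemma mx_derive0_cst m n (f : R -> 'M[R]_(m, n)) s t :
  (forall t, mx_derive f t 0) -> f s = f t.
Proof.
move=> f0; apply/matrixP => i j.
apply: (@is_derive_0_is_cst _ (fun s => f s i j)) => x.
by have := f0 x i j; rewrite mxE.
Qed.

Lemma powmx_intertwine m n (A : 'M[R]_(m, n)) (M : 'M[R]_n) (N : 'M[R]_m) k :
  A *m M = N *m A -> A *m (M ^+ k) = (N ^+ k) *m A.
Proof.
move=> AM; elim: k => [|k IH]; first by rewrite !expr0 mulmx1 mul1mx.
by rewrite exprSr exprS -[M ^+ k * M]/(_ *m _) -[N * _]/(_ *m _) mulmxA IH -!mulmxA AM
   !mulmxA -[in RHS]/(N * _) -exprS exprSr.
Qed.

(** The relation holds for all partial sums and passes to the limit. Since [A] may be rectangular or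
    singular, this covers changes of basis, commuting matrices, projections, eigenvectors ([A] a
    column) and Gram matrices. *)
Lemma expmx_intertwine m n (A : 'M[R]_(m, n)) (M : 'M[R]_n) (N : 'M[R]_m) :
  A *m M = N *m A -> A *m expmx M = expmx N *m A.
Proof.
move=> AM; apply/matrixP => i j.
have cM l : series (fun k => k`!%:R^-1 *: M ^+ k) k l j @[k --> \oo]
    --> expmx M l j by apply: cvg_entry; exact: cvg_expmx.
have cN l : series (fun k => k`!%:R^-1 *: N ^+ k) k i l @[k --> \oo]
    --> expmx N i l by apply: cvg_entry; exact: cvg_expmx.
have c1 : (A *m series (fun k => k`!%:R^-1 *: M ^+ k) k) i j @[k --> \oo]
    --> (A *m expmx M) i j.
  rewrite mxE; under eq_cvg do rewrite mxE.
  by apply: cvg_sumr => l; apply: cvgMl_tmp.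
have c2 : (series (fun k => k`!%:R^-1 *: N ^+ k) k *m A) i j @[k --> \oo]
    --> (expmx N *m A) i j.
  rewrite mxE; under eq_cvg do rewrite mxE.
  by apply: cvg_sumr => l; apply: cvgMr_tmp.
have E k : A *m series (fun k => k`!%:R^-1 *: M ^+ k) k =
    series (fun k => k`!%:R^-1 *: N ^+ k) k *m A.
  rewrite /series /= mulmx_sumr mulmx_suml; apply: eq_bigr => l _.
  by rewrite -scalemxAr -scalemxAl (powmx_intertwine _ AM).
have {}c2 : (A *m series (fun k => k`!%:R^-1 *: M ^+ k) k) i j @[k --> \oo]
    --> (expmx N *m A) i j.
  by rewrite (_ : (fun k => _) =
    (fun k => (series (fun k => k`!%:R^-1 *: N ^+ k) k *m A) i j)) //;
    apply/funext => k; rewrite E.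
exact: (cvg_unique _ c1 c2).
Qed.

Lemma expmx0 m : expmx (0 : 'M[R]_m) = 1%:M.
Proof.
apply/matrixP => i j.
have c1 : series (fun k => k`!%:R^-1 *: (0 : 'M[R]_m) ^+ k) k i j @[k --> \oo]
    --> expmx 0 i j by apply: cvg_entry; exact: cvg_expmx.
have c2 : series (fun k => k`!%:R^-1 *: (0 : 'M[R]_m) ^+ k) k i j @[k --> \oo]
    --> (1%:M : 'M[R]_m) i j.
  rewrite -(cvg_shiftS
    (fun k => series (fun k => k`!%:R^-1 *: (0 : 'M[R]_m) ^+ k) k i j)).
  rewrite (_ : (fun k => _) = fun=> (1%:M : 'M[R]_m) i j); first exact: cvg_cst.
  apply/funext => k.
  rewrite /series /= big_nat_recl//= big1 => [|l _].
    by rewrite addr0 fact0 invr1 scale1r expr0.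
  by rewrite exprS -[0 * _]/(_ *m _) mul0mx scaler0.
exact: (cvg_unique _ c1 c2).
Qed.

Lemma expmx_comm m (M N : 'M[R]_m) : M *m N = N *m M ->
  M *m expmx N = expmx N *m M.
Proof. exact: expmx_intertwine. Qed.

Lemma expmxN m (M : 'M[R]_m) : expmx M *m expmx (- M) = 1%:M.
Proof.
pose f (t : R) := expmx (t *: M) *m expmx (t *: (- M)).
have -> : expmx M *m expmx (- M) = f 1 by rewrite /f !scale1r.
have -> : 1%:M = f 0 by rewrite /f !scale0r expmx0 mulmx1.
apply: mx_derive0_cst => t.
have := mx_derive_mul (expmx_derive M t) (expmx_derive (- M) t).
congr (mx_derive _ _ _).
rewrite (@expmx_comm _ M (t *: M)); last by rewrite -scalemxAl -scalemxAr.
by rewrite -!mulmxA -mulmxDr mulNmx subrr mulmx0.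
Qed.

Lemma expmxNl m (M : 'M[R]_m) : expmx (- M) *m expmx M = 1%:M.
Proof. by have := expmxN (- M); rewrite opprK. Qed.

(** The product [exp(t(M + N)) exp(-tM) exp(-tN)] has zero derivative, hence stays equal to 1; this
    avoids multiplying series. *)
Lemma expmxD m (M N : 'M[R]_m) : M *m N = N *m M ->
  expmx (M + N) = expmx M *m expmx N.
Proof.
move=> MN.
pose f (t : R) := expmx (t *: (M + N)) *m (expmx (t *: - M) *m expmx (t *: - N)).
have f1 : f 1 = 1%:M.
  have -> : 1%:M = f 0 by rewrite /f !scale0r expmx0 !mulmx1.
  apply: mx_derive0_cst => t.
  have := mx_derive_mul (expmx_derive (M + N) t)
    (mx_derive_mul (expmx_derive (- M) t) (expmx_derive (- N) t)).
  congr (mx_derive _ _ _).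
  rewrite (@expmx_comm _ (M + N) (t *: (M + N))); last by rewrite -scalemxAl -scalemxAr.
  rewrite -mulmxA -mulmxDr.
  have -> : expmx (t *: - M) *m (- N *m expmx (t *: - N)) =
            - N *m (expmx (t *: - M) *m expmx (t *: - N)).
    rewrite !mulmxA; congr (_ *m _); rewrite -expmx_comm//.
    by rewrite -scalemxAl -scalemxAr !mulNmx !mulmxN MN.
  by rewrite -!mulmxA -!mulmxDl -opprD subrr mul0mx mulmx0.
move: f1; rewrite /f !scale1r => f1.
have H : expmx (- M) *m expmx (- N) *m (expmx N *m expmx M) = 1%:M.
  by rewrite -mulmxA [expmx (- N) *m _]mulmxA expmxNl mul1mx expmxNl.
have -> : expmx M *m expmx N = expmx N *m expmx M.
  apply: expmx_comm; apply/esym; exact: expmx_comm.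
by rewrite -[RHS]mul1mx -f1 -!mulmxA [_ *m (expmx (- N) *m _)]mulmxA H mulmx1.
Qed.

(** The product [exp(-tM) f(t)] is constant. Closed formulas for exponentials are all verified
    through this equation. *)
Lemma expmx_unique m (M : 'M[R]_m) (f : R -> 'M[R]_m) :
  f 0 = 1%:M -> (forall t, mx_derive f t (M *m f t)) ->
  forall t, f t = expmx (t *: M).
Proof.
move=> f0 fM t.
have H : expmx (t *: - M) *m f t = 1%:M.
  have -> : 1%:M = expmx (0 *: - M) *m f 0 by rewrite scale0r expmx0 f0 mulmx1.
  apply: (@mx_derive0_cst _ _ (fun t => expmx (t *: - M) *m f t)) => s.
  have := mx_derive_mul (expmx_derive (- M) s) (fM s).
  congr (mx_derive _ _ _).
  rewrite (@expmx_comm _ (- M) (s *: - M)); last by rewrite -scalemxAl -scalemxAr.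
  by rewrite mulmxN mulNmx mulmxA addNr.
by rewrite -[LHS]mul1mx -(expmxN (t *: M)) -mulmxA -scalerN H mulmx1.
Qed.

Lemma expmx_tr m (M : 'M[R]_m) : expmx M^T = (expmx M)^T.
Proof.
suff -> : (expmx M)^T = expmx (1 *: M^T) by rewrite scale1r.
rewrite -(@expmx_unique _ _ (fun t => (expmx (t *: M))^T)) ?scale1r//.
  by rewrite scale0r expmx0 trmx1.
move=> t; rewrite -trmx_mul -expmx_comm; last by rewrite -scalemxAl -scalemxAr.
move=> i j; rewrite mxE.
under eq_fun do rewrite mxE.
exact: expmx_derive.
Qed.

Lemma expmx_nilp3 m (M : 'M[R]_m) : M *m (M *m M) = 0 ->
  expmx M = 1%:M + M + 2^-1 *: (M *m M).
Proof.
move=> M3; rewrite -[M in LHS]scale1r.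
rewrite -(@expmx_unique _ _
  (fun t => 1%:M + t *: M + (t ^+ 2 / 2) *: (M *m M))).
- by rewrite scale1r expr1n mul1r.
- by rewrite scale0r expr0n mul0r scale0r !addr0.
- move=> t i j.
  rewrite !mulmxDr mulmx1 -!scalemxAr M3 scaler0 addr0.
  move: (M *m M) => N.
  under eq_fun do rewrite !mxE.
  rewrite [X in is_derive _ _ _ X]mxE [X in _ + X]mxE.
  apply: is_derive_eq.
  by rewrite /GRing.scale /=; field.
Qed.

End MatrixExp.

(** * Transfer between endomorphisms and their matrices in a basis *)

Section EndMatrix.
Context {R : realType} {V : vectType R}.
Implicit Types (f g X Y : 'End(V)) (v w : V).

Lemma lfunD f v w : f (v + w) = f v + f w.
Proof. exact: raddfD. Qed.
Lemma lfunZ f a v : f (a *: v) = a *: f v.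
Proof. exact: linearZ. Qed.
Lemma lfunN f v : f (- v) = - f v.
Proof. exact: raddfN. Qed.
Lemma lfun0 f : f 0 = 0.
Proof. exact: raddf0. Qed.
Lemma lfun_sum f I (r : seq I) (F : I -> V) :
  f (\sum_(i <- r) F i) = \sum_(i <- r) f (F i).
Proof. exact: raddf_sum. Qed.
Definition lfun_lin := (lfunD, lfunZ, lfunN, lfun0).

Definition coordv m (b : m.-tuple V) v : 'cV[R]_m := \col_i coord b i v.

Lemma coordvK m (b : m.-tuple V) : basis_of {:V} b ->
  forall v, \sum_i coordv b v i 0 *: b`_i = v.
Proof.
move=> hb v; rewrite [RHS](coord_basis hb (memvf v)).
by apply: eq_bigr => i _; rewrite mxE.
Qed.

Lemma coordv_inj m (b : m.-tuple V) : basis_of {:V} b -> injective (coordv b).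
Proof. by move=> hb v w vw; rewrite -[v](coordvK hb) vw coordvK. Qed.

Lemma coordv_is_linear m (b : m.-tuple V) : linear (coordv b).
Proof. by move=> a v w; apply/colP => i; rewrite !mxE linearP. Qed.
HB.instance Definition _ m (b : m.-tuple V) :=
  GRing.isLinear.Build R V 'cV[R]_m _ (coordv b) (@coordv_is_linear m b).

Lemma coordv_basis m (b : m.-tuple V) (i : 'I_m) : basis_of {:V} b ->
  coordv b b`_i = delta_mx i 0.
Proof.
move=> hb; apply/colP => j; rewrite !mxE coord_free ?(basis_free hb)//.
by rewrite eqxx andbT eq_sym.
Qed.

Lemma coordv_sum m (b : m.-tuple V) (c : 'cV[R]_m) : basis_of {:V} b ->
  coordv b (\sum_i c i 0 *: b`_i) = c.
Proof.
move=> hb; rewrite linear_sum /= [RHS]matrix_sum_delta.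
by apply: eq_bigr => i _; rewrite linearZ /= coordv_basis// big_ord1.
Qed.

Lemma mx_in_coordv m (b : m.-tuple V) f v : basis_of {:V} b ->
  coordv b (f v) = mx_in b f *m coordv b v.
Proof.
move=> hb; rewrite -{1}[v](coordvK hb) !linear_sum /=.
apply/colP => i; rewrite mxE summxE; apply: eq_bigr => j _.
by rewrite !linearZ /= !mxE mulrC.
Qed.

Lemma mx_in_col m (b : m.-tuple V) f (j : 'I_m) : coordv b (f b`_j) = col j (mx_in b f).
Proof. by apply/colP => i; rewrite !mxE. Qed.

Lemma mx_in_inj m (b : m.-tuple V) : basis_of {:V} b -> injective (mx_in b).
Proof.
move=> hb f g fg; apply/lfunP => v; apply: (coordv_inj hb).
by rewrite !mx_in_coordv// fg.
Qed.

Lemma end_in_is_linear m (b : m.-tuple V) (M : 'M[R]_m) :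
  linear (fun v => \sum_i (\sum_j M i j * coord b j v) *: b`_i).
Proof.
move=> a v w; rewrite scaler_sumr -big_split /=; apply: eq_bigr => i _.
rewrite scalerA -scalerDl; congr (_ *: _).
rewrite mulr_sumr -big_split /=; apply: eq_bigr => j _.
by rewrite linearP /= mulrDr mulrCA.
Qed.

Lemma coordv_end_in m (b : m.-tuple V) (M : 'M[R]_m) v : basis_of {:V} b ->
  coordv b (end_in b M v) = M *m coordv b v.
Proof.
move=> hb; pose L := GRing.isLinear.Build _ _ _ _ _ (@end_in_is_linear _ b M).
pose h : {linear V -> V} := HB.pack
  (fun v => \sum_i (\sum_j M i j * coord b j v) *: b`_i) L.
rewrite /end_in -/(h : V -> V) (lfunE h) /=.
rewrite -[RHS](coordv_sum _ hb); congr coordv; apply: eq_bigr => i _.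
by rewrite mxE; congr (_ *: _); apply: eq_bigr => j _; rewrite mxE.
Qed.

Lemma end_inK m (b : m.-tuple V) : basis_of {:V} b ->
  cancel (end_in b) (mx_in b).
Proof.
move=> hb M; apply/matrixP => i j.
have := coordv_end_in M b`_j hb; rewrite coordv_basis// -colE.
by move=> /colP/(_ i); rewrite !mxE.
Qed.

Lemma mx_inK m (b : m.-tuple V) : basis_of {:V} b ->
  cancel (mx_in b) (end_in b).
Proof. by move=> hb f; apply: (mx_in_inj hb); rewrite end_inK. Qed.

Lemma mx_in_comp m (b : m.-tuple V) f g : basis_of {:V} b ->
  mx_in b (f \o g)%VF = mx_in b f *m mx_in b g.
Proof.
move=> hb; apply/matrixP => i j.
have := mx_in_coordv f (g b`_j) hb.
rewrite mx_in_col => /colP/(_ i); rewrite !mxE comp_lfunE => ->.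
by apply: eq_bigr => k _; rewrite !mxE.
Qed.

Lemma mx_in1 m (b : m.-tuple V) : basis_of {:V} b -> mx_in b \1%VF = 1%:M.
Proof.
move=> hb; apply/matrixP => i j.
by rewrite !mxE id_lfunE coord_free ?(basis_free hb)// eq_sym.
Qed.

Lemma mx_in_is_linear m (b : m.-tuple V) : linear (mx_in b).
Proof.
by move=> a f g; apply/matrixP => i j; rewrite !mxE !lfun_simp linearP.
Qed.
HB.instance Definition _ m (b : m.-tuple V) :=
  GRing.isLinear.Build R 'End(V) 'M[R]_m _ (mx_in b) (@mx_in_is_linear m b).

Definition change_mx m m' (b : m.-tuple V) (b' : m'.-tuple V) : 'M[R]_(m, m') :=
  \matrix_(i, j) coord b i b'`_j.

Lemma change_mx_coordv m m' (b : m.-tuple V) (b' : m'.-tuple V) v :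
  basis_of {:V} b' -> coordv b v = change_mx b b' *m coordv b' v.
Proof.
move=> hb; rewrite -{1}[v](coordvK hb) !linear_sum /=.
apply/colP => i; rewrite mxE summxE; apply: eq_bigr => j _.
by rewrite !linearZ /= !mxE mulrC.
Qed.

Lemma change_mx_mx_in m m' (b : m.-tuple V) (b' : m'.-tuple V) f :
  basis_of {:V} b -> basis_of {:V} b' ->
  change_mx b b' *m mx_in b' f = mx_in b f *m change_mx b b'.
Proof.
move=> hb hb'; apply/matrixP => i j.
have := mx_in_coordv f b'`_j hb.
rewrite (change_mx_coordv _ _ hb') mx_in_col.
have -> : coordv b b'`_j = col j (change_mx b b') by apply/colP => k; rewrite !mxE.
by rewrite !colE !mulmxA -!colE => /colP/(_ i); rewrite !mxE.
Qed.

Lemma change_mxK m m' (b : m.-tuple V) (b' : m'.-tuple V) :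
  basis_of {:V} b -> basis_of {:V} b' ->
  change_mx b b' *m change_mx b' b = 1%:M.
Proof.
move=> hb hb'; apply/matrixP => i j.
have := change_mx_coordv b (b`_j) hb'; rewrite coordv_basis// => /colP/(_ i).
rewrite !mxE eqxx andbT => ->; apply: eq_bigr => k _; by rewrite !mxE.
Qed.

Lemma mx_in_change m m' (b : m.-tuple V) (b' : m'.-tuple V) f :
  basis_of {:V} b -> basis_of {:V} b' ->
  mx_in b f = change_mx b b' *m mx_in b' f *m change_mx b' b.
Proof. by move=> hb hb'; rewrite change_mx_mx_in// -mulmxA change_mxK// mulmx1. Qed.

Lemma end_det_mx_in m (b : m.-tuple V) f : basis_of {:V} b ->
  end_det f = \det (mx_in b f).
Proof.
move=> hb; rewrite /end_det /end_mx.
have : basis_of {:V} (vbasis {:V}) by exact: vbasisP.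
(* The basis is generalized first, so that its length can be rewritten to [m] and both determinants
   concern matrices of the same size. *)
move: (vbasis _); have -> : \dim {:V} = m by exact: (size_basis hb).
move=> b' hb'; rewrite (mx_in_change f hb' hb) !det_mulmx mulrAC -det_mulmx.
by rewrite change_mxK// det1 mul1r.
Qed.

Lemma end_det_comp f g : end_det (f \o g)%VF = end_det f * end_det g.
Proof. by rewrite /end_det /end_mx mx_in_comp ?vbasisP// det_mulmx. Qed.

Lemma end_det1 : end_det (\1%VF : 'End(V)) = 1.
Proof. by rewrite /end_det /end_mx mx_in1 ?vbasisP// det1. Qed.

Lemma mx_in_exp m (b : m.-tuple V) X : basis_of {:V} b ->
  mx_in b (end_exp X) = expmx (mx_in b X).
Proof.
move=> hb; have hv := vbasisP {:V}.
rewrite (mx_in_change _ hb hv) /end_exp end_inK// /end_mx.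
by rewrite (expmx_intertwine (change_mx_mx_in X hb hv)) -mulmxA change_mxK// mulmx1.
Qed.

Lemma end_exp_intertwine (f X Y : 'End(V)) : (f \o X = Y \o f)%VF ->
  (f \o end_exp X = end_exp Y \o f)%VF.
Proof.
have hv := vbasisP {:V}.
move=> fXY; apply: (mx_in_inj hv); rewrite !mx_in_comp// !mx_in_exp//.
by apply: expmx_intertwine; rewrite -!mx_in_comp// fXY.
Qed.

Lemma end_exp0 : end_exp (0 : 'End(V)) = \1%VF.
Proof.
have hv := vbasisP {:V}.
by apply: (mx_in_inj hv); rewrite mx_in_exp// linear0 expmx0 mx_in1.
Qed.

Lemma end_expN X : (end_exp X \o end_exp (- X) = \1)%VF.
Proof.
have hv := vbasisP {:V}; apply: (mx_in_inj hv).
by rewrite mx_in_comp// !mx_in_exp// linearN /= expmxN mx_in1.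
Qed.

Lemma end_expD X Y : (X \o Y = Y \o X)%VF ->
  end_exp (X + Y) = (end_exp X \o end_exp Y)%VF.
Proof.
have hv := vbasisP {:V}; move=> XY; apply: (mx_in_inj hv).
rewrite mx_in_comp// !mx_in_exp// linearD /=; apply: expmxD.
by rewrite -!mx_in_comp// XY.
Qed.

Lemma end_exp_nilp3 X : (X \o (X \o X) = 0)%VF ->
  end_exp X = \1%VF + X + 2^-1 *: (X \o X)%VF.
Proof.
have hv := vbasisP {:V}; move=> X3; apply: (mx_in_inj hv).
rewrite mx_in_exp// expmx_nilp3; last by rewrite -!mx_in_comp// X3 linear0.
by rewrite !linearD linearZ /= mx_in_comp// mx_in1.
Qed.

Lemma end_exp_unique X (c : R -> 'End(V)) : c 0 = \1%VF ->
  (forall t, mx_derive (fun s => end_mx (c s)) t (end_mx (X \o c t)%VF)) ->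
  forall t, c t = end_exp (t *: X).
Proof.
have hv := vbasisP {:V}; move=> c0 cX t; apply: (mx_in_inj hv).
rewrite mx_in_exp// linearZ /= -/(end_mx _).
rewrite -(@expmx_unique _ _ _ (fun t => end_mx (c t)))//.
  by rewrite c0 /end_mx mx_in1.
by move=> s; rewrite -mx_in_comp.
Qed.

(** A right inverse is injective, hence bijective in finite dimension, so [f] is the inverse of [g];
    this identifies the total operation [^-1] of the library with the true inverse. *)
Lemma compl_inv f g : (f \o g = \1)%VF -> (f^-1)%VF = g.
Proof.
move=> fg.
have g0 : lker g == 0%VS.
  apply/lker0P; apply: (can_inj (g := f)) => v.
  by rewrite -comp_lfunE fg id_lfunE.
have -> : f = (g^-1)%VF.
  by rewrite -[f]comp_lfun1r -(lker0_compfV g0) comp_lfunA fg comp_lfun1l.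
have g'0 : lker (g^-1)%VF == 0%VS.
  apply/lker0P; apply: (can_inj (g := g)) => v.
  by rewrite -comp_lfunE (lker0_compfV g0) id_lfunE.
by rewrite -[RHS]comp_lfun1l -(lker0_compVf g'0) -comp_lfunA (lker0_compVf g0) comp_lfun1r.
Qed.

Lemma end_exp_inv X : ((end_exp X)^-1)%VF = end_exp (- X).
Proof. by apply: compl_inv; exact: end_expN. Qed.

Lemma end_exp_lker X : lker (end_exp X) == 0%VS.
Proof.
apply/lker0P; apply: (can_inj (g := end_exp (- X))) => v.
by rewrite -comp_lfunE -[X in (_ \o end_exp X)%VF]opprK end_expN id_lfunE.
Qed.

Lemma scalar_mx_inE m (b : m.-tuple V) (phi : {scalar 'End(V)}) f :
  basis_of {:V} b ->
  phi f = \sum_i \sum_j phi (end_in b (delta_mx i j)) * mx_in b f i j.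
Proof.
move=> hb.
rewrite -{1}(mx_inK hb f) {1}(matrix_sum_delta (mx_in _ f)).
have -> : end_in b (\sum_i \sum_j mx_in b f i j *: delta_mx i j)
    = \sum_i \sum_j mx_in b f i j *: end_in b (delta_mx i j).
  apply: (mx_in_inj hb); rewrite end_inK// linear_sum; apply: eq_bigr => i _.
  rewrite linear_sum; apply: eq_bigr => j _.
  by rewrite linearZ /= end_inK.
rewrite linear_sum; apply: eq_bigr => i _.
by rewrite linear_sum; apply: eq_bigr => j _; rewrite linearZ /= mulrC.
Qed.

Lemma end_exp_scalar_derive X (phi : {scalar 'End(V)}) (t : R) :
  is_derive t (1 : R) (fun s => phi (end_exp (s *: X)))
    (phi (X \o end_exp (t *: X))%VF).
Proof.
have hv := vbasisP {:V}.
pose c i j : R := phi (end_in (vbasis {:V}) (delta_mx i j)).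
have phiE f : phi f = \sum_i \sum_j c i j * mx_in (vbasis {:V}) f i j.
  exact: scalar_mx_inE.
have -> : (fun s => phi (end_exp (s *: X))) =
   \sum_i \sum_j (c i j *: (fun s => expmx (s *: mx_in (vbasis {:V}) X) i j)).
  apply/funext => s; rewrite phiE fct_sumE; apply: eq_bigr => i _.
  rewrite fct_sumE; apply: eq_bigr => j _.
  by rewrite mx_in_exp// linearZ.
rewrite phiE; apply: is_derive_sum => i; apply: is_derive_sum => j.
apply: is_deriveZ.
by rewrite mx_in_comp// mx_in_exp// linearZ; exact: expmx_derive.
Qed.

(** The exponential is the square of the invertible endomorphism [exp(X / 2)]. Positivity later
    selects 1 among the two possible determinants of an isometry. *)
Lemma end_exp_det_gt0 X : 0 < end_det (end_exp X).
Proof.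
have -> : end_exp X = (end_exp (2^-1 *: X) \o end_exp (2^-1 *: X))%VF.
  rewrite -(end_expD (erefl _)) -scalerDl; congr end_exp.
  by rewrite (_ : 2^-1 + 2^-1 = 1) ?scale1r//; lra.
rewrite end_det_comp -expr2 lt_neqAle sqr_ge0 andbT eq_sym sqrf_eq0.
apply/eqP => d0; have := end_det1.
rewrite -(end_expN (2^-1 *: X)) end_det_comp d0 mul0r => /esym/eqP.
by rewrite oner_eq0.
Qed.

(** The coordinate column of [v] intertwines [X] with the 1 by 1 matrix [a], whose exponential is
    [expR a]. *)
Lemma end_exp_eigen X v (a : R) : X v = a *: v -> end_exp X v = expR a *: v.
Proof.
have hv := vbasisP {:V}; move=> Xv.
pose c := coordv (vbasis {:V}) v.
have Mv : c *m (a *: 1%:M : 'M[R]_1) = mx_in (vbasis {:V}) X *m c.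
  by rewrite -mx_in_coordv// Xv -scalemxAr mulmx1 [RHS]linearZ.
apply: (coordv_inj hv); rewrite mx_in_coordv// mx_in_exp// -/c.
rewrite -(expmx_intertwine Mv) [RHS]linearZ /= -/c.
rewrite -(@expmx_unique _ _ _ (fun t => (expR t)%:M)).
- by rewrite mul_mx_scalar.
- by rewrite expR0.
- move=> t i j; rewrite mul1mx !ord1.
  under eq_fun do rewrite mxE mulr1n.
  by rewrite mxE; exact: is_derive_expR.
Qed.

Lemma end_exp_invariant X (U : {vspace V}) : (forall v, v \in U -> X v \in U) ->
  forall v, v \in U -> end_exp X v \in U.
Proof.
have hv := vbasisP {:V}; move=> XU v vU.
(* [projv U] as an idempotent [P] with [P X P = X P]. *)
pose P := projv U.
have PU w : w \in U -> P w = w by exact: projv_id.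
have UP w : P w \in U by exact: memv_proj.
have E : (P \o X \o P = X \o P)%VF.
  by apply/lfunP => w; rewrite !comp_lfunE PU ?XU.
have := @end_exp_intertwine P (P \o X \o P)%VF X.
rewrite !comp_lfunA.
have -> : (P \o P = P)%VF by apply/lfunP => w; rewrite comp_lfunE PU.
move=> /(_ E)/lfunP/(_ v); rewrite !comp_lfunE [P v]PU// => <-.
exact: UP.
Qed.

End EndMatrix.

Lemma ord3_ind n (P : 'I_(1 + (n + 1)) -> Prop) :
  P (lshift _ ord0) -> (forall k, P (rshift 1 (lshift 1 k))) ->
  P (rshift 1 (rshift n ord0)) -> forall i, P i.
Proof.
move=> P0 P1 P2 i; case: (split_ordP i) => j ->.
  by rewrite ord1.
by case: (split_ordP j) => k ->; rewrite ?ord1.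
Qed.

Section Tuple3.
Context {V : nmodType} {n : nat}.
Implicit Types (a c : V) (e : n.-tuple V).

Definition tuple3 a e c : (1 + (n + 1)).-tuple V :=
  cons_tuple a (cat_tuple e [tuple c]).

Lemma tuple3_l a e c : (tuple3 a e c)`_(lshift (n + 1) (ord0 : 'I_1)) = a.
Proof. by []. Qed.

Lemma tuple3_m a e c (k : 'I_n) : (tuple3 a e c)`_(rshift 1 (lshift 1 k)) = e`_k.
Proof. by rewrite /= nth_cat size_tuple ltn_ord. Qed.

Lemma tuple3_r a e c : (tuple3 a e c)`_(rshift 1 (rshift n (ord0 : 'I_1))) = c.
Proof. by rewrite /= nth_cat size_tuple addn0 ltnn subnn. Qed.

Definition tuple3E := (tuple3_l, tuple3_m, tuple3_r).
End Tuple3.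

(** * The skew endomorphisms and the wedge *)

Section Form.
Context {R : realType} {V : vectType R} (eta : {symmetric V}).
Implicit Types (u v w : V) (f g X Y : 'End(V)).

Lemma etaC v w : eta v w = eta w v.
Proof. by rewrite hermC expr0 mul1r. Qed.
Lemma etaDl u v w : eta (u + v) w = eta u w + eta v w.
Proof. exact: linearDl. Qed.
Lemma etaDr u v w : eta u (v + w) = eta u v + eta u w.
Proof. exact: linearDr. Qed.
Lemma etaZl a v w : eta (a *: v) w = a * eta v w.
Proof. exact: linearZl_LR. Qed.
Lemma etaZr a v w : eta v (a *: w) = a * eta v w.
Proof. exact: linearZr_LR. Qed.
Lemma etaNl v w : eta (- v) w = - eta v w.
Proof. exact: linearNl. Qed.
Lemma etaNr v w : eta v (- w) = - eta v w.
Proof. exact: linearNr. Qed.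
Lemma eta0l v : eta 0 v = 0.
Proof. exact: linear0l. Qed.
Lemma eta0r v : eta v 0 = 0.
Proof. exact: linear0r. Qed.
Lemma eta_suml I (r : seq I) (F : I -> V) w :
  eta (\sum_(i <- r) F i) w = \sum_(i <- r) eta (F i) w.
Proof. exact: linear_sumlz. Qed.
Lemma eta_sumr I (r : seq I) (F : I -> V) w :
  eta w (\sum_(i <- r) F i) = \sum_(i <- r) eta w (F i).
Proof. exact: linear_sumr. Qed.

Definition eta_lin := (etaDl, etaDr, etaZl, etaZr, etaNl, etaNr, eta0l, eta0r).

Definition end_isometry f := forall v w, eta (f v) (f w) = eta v w.
Definition skew_end X := forall v w, eta (X v) w = - eta v (X w).

Lemma dual_basis m (b b' : m.-tuple V) : \dim {:V} = m ->
  (forall i j : 'I_m, eta b'`_i b`_j = (i == j)%:R) ->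
  basis_of {:V} b /\ forall i v, coord b i v = eta b'`_i v.
Proof.
move=> dm dual.
have fb : free b.
  apply/freeP => k k0 i; have := congr1 (eta b'`_i) k0.
  rewrite eta_sumr eta0r (bigD1 i)//= big1 ?addr0 => [|j ji].
    by rewrite etaZr dual eqxx mulr1.
  by rewrite etaZr dual eq_sym (negbTE ji) mulr0.
have hb : basis_of {:V} b by rewrite basisEfree fb subvf size_tuple dm leqnn.
split=> // i v; rewrite [in RHS](coord_basis hb (memvf v)) eta_sumr.
rewrite (bigD1 i)//= big1 ?addr0 => [|j ji].
  by rewrite etaZr dual eqxx mulr1.
by rewrite etaZr dual eq_sym (negbTE ji) mulr0.
Qed.

Definition wedge_fun u v w := eta u w *: v - eta v w *: u.
Lemma wedge_is_linear u v : linear (wedge_fun u v).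
Proof.
move=> a x y; rewrite /wedge_fun !eta_lin !scalerDl scalerBr !scalerA.
by rewrite opprD addrACA.
Qed.
HB.instance Definition _ u v := GRing.isLinear.Build R V V _ (wedge_fun u v)
  (wedge_is_linear u v).
Definition wedge u v : 'End(V) := linfun (wedge_fun u v).

Lemma wedgeE u v w : wedge u v w = eta u w *: v - eta v w *: u.
Proof. by rewrite lfunE. Qed.

Lemma wedgeC u v : wedge u v = - wedge v u.
Proof. by apply/lfunP => w; rewrite opp_lfunE !wedgeE opprB. Qed.
Lemma wedgeDr u v w : wedge u (v + w) = wedge u v + wedge u w.
Proof.
apply/lfunP => z; rewrite add_lfunE !wedgeE eta_lin scalerDr scalerDl.
by rewrite opprD addrACA.
Qed.
Lemma wedgeZr a u v : wedge u (a *: v) = a *: wedge u v.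
Proof.
apply/lfunP => z; rewrite scale_lfunE !wedgeE eta_lin scalerBr !scalerA.
by rewrite mulrC.
Qed.
Lemma wedgeNr u v : wedge u (- v) = - wedge u v.
Proof. by rewrite -scaleN1r wedgeZr scaleN1r. Qed.
Lemma wedgeDl u v w : wedge (u + v) w = wedge u w + wedge v w.
Proof. by rewrite !(wedgeC _ w) wedgeDr opprD. Qed.
Lemma wedgeZl a u v : wedge (a *: u) v = a *: wedge u v.
Proof. by rewrite !(wedgeC _ v) wedgeZr scalerN. Qed.
Lemma wedgeNl u v : wedge (- u) v = - wedge u v.
Proof. by rewrite -scaleN1r wedgeZl scaleN1r. Qed.
Lemma wedge_id u : wedge u u = 0.
Proof. by apply/lfunP => w; rewrite wedgeE subrr zero_lfunE. Qed.
Lemma wedge0r u : wedge u 0 = 0.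
Proof. by rewrite -[0](scale0r u) wedgeZr scale0r. Qed.

Lemma wedge_skew u v : skew_end (wedge u v).
Proof.
move=> x y; rewrite !wedgeE !eta_lin (etaC v y) (etaC u y) (etaC x v) (etaC x u).
by ring.
Qed.

(** Under the identification of skew endomorphisms with bivectors, the bracket with [X] is the
    derivation extending [X]. Every bracket below is computed by this rule. *)
Lemma wedge_bracket X u v : skew_end X ->
  (X \o wedge u v)%VF - (wedge u v \o X)%VF = wedge (X u) v + wedge u (X v).
Proof.
move=> sX; apply/lfunP => w; rewrite add_lfunE opp_lfunE !comp_lfunE add_lfunE.
rewrite !wedgeE [X (_ - _)]linearB /= !(linearZ_LR X) /= !sX.
rewrite !scaleNr opprB opprK addrACA [RHS]addrC; congr (_ + _).
by rewrite addrC.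
Qed.

Lemma wedge_conj f g u v : end_isometry f -> (f \o g = \1)%VF ->
  (f \o wedge u v \o g)%VF = wedge (f u) (f v).
Proof.
move=> fi fg; apply/lfunP => w; rewrite !comp_lfunE !wedgeE linearB !linearZ /=.
by rewrite -{3 4}[w]id_lfunE -fg comp_lfunE !fi.
Qed.

Lemma skew_add X Y : skew_end X -> skew_end Y -> skew_end (X + Y).
Proof. by move=> sX sY v w; rewrite !add_lfunE !eta_lin sX sY opprD. Qed.
Lemma skew_scale a X : skew_end X -> skew_end (a *: X).
Proof. by move=> sX v w; rewrite !scale_lfunE !eta_lin sX mulrN. Qed.
Lemma skew_self X v : skew_end X -> eta (X v) v = 0.
Proof. by move=> sX; have := sX v v; rewrite (etaC v); lra. Qed.

Lemma isometry_comp f g : end_isometry f -> end_isometry g ->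
  end_isometry (f \o g)%VF.
Proof. by move=> fi gi v w; rewrite !comp_lfunE fi gi. Qed.

Lemma isometry1 : end_isometry \1%VF.
Proof. by move=> v w; rewrite !id_lfunE. Qed.

(** A matrix coefficient, packaged as a linear functional so that [end_exp_scalar_derive] can
    differentiate it along one-parameter groups. *)
Definition eval_form v w (f : 'End(V)) : R := eta (f v) w.
Lemma eval_form_is_linear v w : scalar (eval_form v w).
Proof. by move=> a f g; rewrite /eval_form add_lfunE scale_lfunE !eta_lin. Qed.
HB.instance Definition _ v w := GRing.isLinear.Build R 'End(V) R _ (eval_form v w)
  (eval_form_is_linear v w).

End Form.

Lemma sum_ord3 (W : nmodType) n (f : 'I_(1 + (n + 1)) -> W) :
  \sum_i f i = f (lshift _ ord0) + \sum_(k < n) f (rshift 1 (lshift 1 k)) +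
    f (rshift 1 (rshift n ord0)).
Proof. by rewrite big_split_ord /= big_ord1 big_split_ord /= big_ord1 addrA. Qed.

(** * Adapted frames and the hyperboloid *)

Section AdaptedFrames.
Context {R : realType} {V : vectType R} {n : nat} (eta : {symmetric V}).
Hypothesis dimV : \dim {:V} = (n + 2)%N.
Implicit Types (F : frame V n) (u v w x y z : V).

Lemma tuple3_dual (a c a' c' : V) (e e' : n.-tuple V) :
  eta a' a = 1 -> eta a' c = 0 -> eta c' a = 0 -> eta c' c = 1 ->
  (forall i j : 'I_n, eta e'`_i e`_j = (i == j)%:R) ->
  (forall i : 'I_n, eta a' e`_i = 0 /\ eta c' e`_i = 0) ->
  (forall i : 'I_n, eta e'`_i a = 0 /\ eta e'`_i c = 0) ->
  basis_of {:V} (tuple3 a e c) /\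
  forall i v, coord (tuple3 a e c) i v = eta (tuple3 a' e' c')`_i v.
Proof.
move=> aa ac ca cc ee ae ea; apply: dual_basis; first by rewrite dimV addn1 addn2.
apply: ord3_ind => [|k|]; apply: ord3_ind => [|l|]; rewrite ?tuple3E //=.
- by have [] := ae l.
- by have [] := ea k.
- have [_ ->] := ea k; case: eqP => // /rshift_inj/eqP.
  by rewrite eq_lrshift.
- have [_ ->] := ae l; case: eqP => // /rshift_inj/eqP.
  by rewrite eq_rlshift.
- by rewrite cc eqxx.
Qed.

Lemma adapted_intro F :
  eta (fr_p F) (fr_p F) = 0 -> eta (fr_q F) (fr_q F) = 0 ->
  eta (fr_p F) (fr_q F) = 1 ->
  (forall i j : 'I_n, eta (fr_e F)`_i (fr_e F)`_j = (i == j)%:R) ->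
  (forall i : 'I_n, eta (fr_p F) (fr_e F)`_i = 0 /\ eta (fr_q F) (fr_e F)`_i = 0) ->
  adapted eta F.
Proof.
move=> pp qq pq ee pqe; split => //.
have qp : eta (fr_q F) (fr_p F) = 1 by rewrite etaC.
have qpe (i : 'I_n) : eta (fr_q F) (fr_e F)`_i = 0 /\ eta (fr_p F) (fr_e F)`_i = 0.
  by have [] := pqe i.
have epq (i : 'I_n) : eta (fr_e F)`_i (fr_p F) = 0 /\ eta (fr_e F)`_i (fr_q F) = 0.
  by rewrite !(etaC eta _`_i); have [] := pqe i.
by have [] := tuple3_dual qp qq pp pq ee qpe epq.
Qed.

Section OneFrame.
Variables (F : frame V n) (hF : adapted eta F).
Local Notation p := (fr_p F).
Local Notation q := (fr_q F).
Local Notation e := (fr_e F).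

Lemma fr_basisP : basis_of {:V} (fr_basis F). Proof. by case: hF. Qed.
Lemma eta_pp : eta p p = 0. Proof. by case: hF => _ []. Qed.
Lemma eta_qq : eta q q = 0. Proof. by case: hF => _ []. Qed.
Lemma eta_pq : eta p q = 1. Proof. by case: hF => _ []. Qed.
Lemma eta_qp : eta q p = 1. Proof. by rewrite etaC eta_pq. Qed.
Lemma eta_ee (i j : 'I_n) : eta e`_i e`_j = (i == j)%:R.
Proof. by case: hF. Qed.
Lemma eta_pe (i : 'I_n) : eta p e`_i = 0.
Proof. by case: hF => _ _ _ /(_ i)[]. Qed.
Lemma eta_qe (i : 'I_n) : eta q e`_i = 0.
Proof. by case: hF => _ _ _ /(_ i)[]. Qed.
Lemma eta_ep (i : 'I_n) : eta e`_i p = 0. Proof. by rewrite etaC eta_pe. Qed.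
Lemma eta_eq (i : 'I_n) : eta e`_i q = 0. Proof. by rewrite etaC eta_qe. Qed.

Definition frE := (eta_pp, eta_qq, eta_pq, eta_qp, eta_ee, eta_pe, eta_qe,
  eta_ep, eta_eq).

(** The form pairs [p] with [q], so the dual basis of an adapted frame is the frame with [p] and [q]
    exchanged. *)
Lemma coord_frame i v : coord (fr_basis F) i v = eta (tuple3 q e p)`_i v.
Proof.
have qpe (k : 'I_n) : eta q e`_k = 0 /\ eta p e`_k = 0 by rewrite !frE.
have epq (k : 'I_n) : eta e`_k p = 0 /\ eta e`_k q = 0 by rewrite !frE.
by have [_ ->] := tuple3_dual eta_qp eta_qq eta_pp eta_pq eta_ee qpe epq.
Qed.

Lemma frame_decomp v :
  v = eta q v *: p + \sum_(i < n) eta e`_i v *: e`_i + eta p v *: q.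
Proof.
rewrite {1}[v](coord_basis fr_basisP (memvf v)) sum_ord3 !coord_frame.
have -> : fr_basis F = tuple3 p e q by [].
rewrite !tuple3E; congr (_ + _ + _).
by apply: eq_bigr => i _; rewrite coord_frame !tuple3E.
Qed.

Lemma eta_frame v w : eta v w =
  eta q v * eta p w + eta p v * eta q w + \sum_(i < n) eta e`_i v * eta e`_i w.
Proof.
rewrite {1}(frame_decomp v) !etaDl !etaZl eta_suml addrAC; congr (_ + _).
by apply: eq_bigr => i _; rewrite etaZl.
Qed.

Lemma frame_ext v w : eta p v = eta p w -> eta q v = eta q w ->
  (forall i : 'I_n, eta e`_i v = eta e`_i w) -> v = w.
Proof.
move=> vp vq ve; rewrite (frame_decomp v) (frame_decomp w) vp vq.
by congr (_ + _ + _); apply: eq_bigr => i _; rewrite ve.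
Qed.

Lemma eta_nondeg v : (forall w, eta v w = 0) -> v = 0.
Proof.
by move=> v0; apply: frame_ext => [||i]; rewrite eta0r etaC v0.
Qed.

(* The positive definite form for which [p], [e_i], [q] is orthonormal. *)
Definition dot_fr v w := eta v w + eta (p - q) v * eta (p - q) w.

Lemma dot_frE v w : dot_fr v w =
  \sum_i coord (fr_basis F) i v * coord (fr_basis F) i w.
Proof.
rewrite sum_ord3 /dot_fr {1}eta_frame !coord_frame !tuple3E !etaDl !etaNl.
under [X in _ = _ + X + _]eq_bigr do rewrite !coord_frame !tuple3E.
by ring.
Qed.

Lemma eta_perp_p_ge0 z : eta p z = 0 -> 0 <= eta z z.
Proof.
move=> pz; rewrite eta_frame pz mulr0 mul0r !add0r.
by apply: sumr_ge0 => i _; exact: sqr_ge0.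
Qed.

(** On [p^perp] the form is the sum of the squares of the coordinates along the [e_i], so its null
    vectors there are the multiples of [p]. *)
Lemma isotropic_perp_p z : eta p z = 0 -> eta z z = 0 -> z = eta q z *: p.
Proof.
move=> pz zz; apply: frame_ext => [||i]; rewrite etaZr ?frE ?mulr0 ?mulr1//.
move: zz; rewrite eta_frame pz mulr0 mul0r !add0r.
move=> /psumr_eq0P H; apply/eqP; rewrite -sqrf_eq0 expr2; apply/eqP.
by apply: H => // j _; exact: sqr_ge0.
Qed.

Lemma p_neq0 : p != 0.
Proof.
apply/eqP => p0; have := eta_pq; rewrite p0 eta0l => /esym/eqP.
by rewrite oner_eq0.
Qed.

Lemma swap_adapted : adapted eta (Frame q e p).
Proof.
by apply: adapted_intro => /= [|||i j|i]; rewrite ?frE.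
Qed.

Lemma scale_adapted (a : R) : a != 0 -> adapted eta (Frame (a *: p) e (a^-1 *: q)).
Proof.
move=> a0; apply: adapted_intro => /= [|||i j|i]; rewrite ?eta_lin ?frE ?mulr0//.
by rewrite mulr1 mulfV.
Qed.

(** Keeps [p] and replaces [q] by [q']; subtracting a multiple of the isotropic [p] makes each [e_i]
    orthogonal to [q'] without changing the inner products among the [e_i]. *)
Definition move_q q' : frame V n :=
  Frame p [tuple e`_i - eta q' e`_i *: p | i < n] q'.

Lemma move_q_adapted q' : eta q' q' = 0 -> eta p q' = 1 -> adapted eta (move_q q').
Proof.
move=> qq pq.
have E (i : 'I_n) : (fr_e (move_q q'))`_i = e`_i - eta q' e`_i *: p.
  by rewrite -tnth_nth tnth_mktuple.
apply: adapted_intro => // [|i j|i]; rewrite ?frE // ?E.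
  by rewrite !eta_lin !frE; ring.
rewrite !eta_lin !frE (etaC eta q' p) pq; split; ring.
Qed.

End OneFrame.

(** Either [p'] is a multiple of [p] and rescaling suffices, or a multiple of [p'] can serve as the
    new [q]; exchanging the two ends and rescaling then puts [p'] first. *)
Lemma adapted_frame_through F p' : adapted eta F -> eta p' p' = 0 -> p' != 0 ->
  exists F', adapted eta F' /\ fr_p F' = p'.
Proof.
move=> hF p'p' p'0; have [pp'|pp'] := eqVneq (eta (fr_p F) p') 0.
  have E := isotropic_perp_p hF pp' p'p'.
  have a0 : eta (fr_q F) p' != 0.
    by apply: contraNneq p'0 => a0; rewrite E a0 scale0r.
  by exists (Frame (eta (fr_q F) p' *: fr_p F) (fr_e F) ((eta (fr_q F) p')^-1 *: fr_q F));
    split; [exact: scale_adapted | rewrite /= -E].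
set b := eta (fr_p F) p' in pp'.
have h1 : adapted eta (move_q F (b^-1 *: p')).
  by apply: move_q_adapted => //; rewrite !eta_lin ?p'p' ?mulr0// mulVf.
have h2 := swap_adapted h1.
have h3 := scale_adapted h2 pp'.
by eexists; split; [exact: h3 | rewrite /= scalerA mulfV// scale1r].
Qed.

(** For [eta x x = -1] the coordinates along [p] and [q] have a negative product, so the sign of
    their difference, hence that of the time coordinate, is decided by [eta p x] alone. *)
Lemma lobachevskianE F x : adapted eta F ->
  lobachevskian eta F x <-> eta x x = -1 /\ eta (fr_p F) x < 0.
Proof.
move=> hF; set s : R := Num.sqrt 2 / 2.
have s0 : 0 < s by rewrite /s divr_gt0// sqrtr_gt0.
have ss : s * s = 2^-1.
  by rewrite /s mulrACA -expr2 sqr_sqrtr//; field.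
have cE : coord (lorentz_basis F) ord0 x = s * (eta (fr_q F) x - eta (fr_p F) x).
  (* The vector [e_0] has norm -1, so its dual vector is [- e_0]; all other vectors of the Lorentz
     basis are their own duals. *)
  have [|||||||_ /(_ (lshift _ ord0) x)] := @tuple3_dual
    (s *: (fr_p F - fr_q F)) (s *: (fr_p F + fr_q F))
    (- (s *: (fr_p F - fr_q F))) (s *: (fr_p F + fr_q F)) (fr_e F) (fr_e F).
  - by rewrite !eta_lin !(frE hF); nra.
  - by rewrite !eta_lin !(frE hF); nra.
  - by rewrite !eta_lin !(frE hF); nra.
  - by rewrite !eta_lin !(frE hF); nra.
  - by move=> i j; rewrite !(frE hF).
  - by move=> i; rewrite !eta_lin !(frE hF); split; ring.
  - by move=> i; rewrite !eta_lin !(frE hF); split; ring.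
  rewrite tuple3E.
  have -> : lshift (n + 1) (ord0 : 'I_1) = ord0 by apply/val_inj.
  by rewrite !eta_lin => ->; ring.
rewrite /lobachevskian /= cE pmulr_rgt0//.
have S0 : 0 <= \sum_(i < n) eta (fr_e F)`_i x * eta (fr_e F)`_i x.
  by apply: sumr_ge0 => i _; exact: sqr_ge0.
split=> -[xx H]; split => //; move: xx S0 H; rewrite (eta_frame hF x x);
  move: (\sum_(i < n) _) (eta (fr_p F) x) (eta (fr_q F) x) => S b a;
  move=> E S0 H; rewrite ltNge; apply/negP => H'.
  have h1 : 0 <= a - b by lra.
  have := mulr_ge0 h1 H'; have := sqr_ge0 b; lra.
have h1 : 0 <= b - a by lra.
have h2 : 0 <= - b by lra.
have := mulr_ge0 h1 h2; have := sqr_ge0 b; lra.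
Qed.

Section Sheets.
Variable (F0 : frame V n) (hF0 : adapted eta F0).
Local Notation L := (lobachevskian eta F0).

Lemma L_norm x : L x -> eta x x = -1.
Proof. by move=> /(lobachevskianE _ hF0)[]. Qed.

(** The combination of [x] and [y] orthogonal to [p] has nonnegative norm; since [eta p x] and
    [eta p y] have the same sign, this forces the cross term to be negative. *)
Lemma L_eta_lt0 x y : L x -> L y -> eta x y < 0.
Proof.
move=> /(lobachevskianE _ hF0)[xx px] /(lobachevskianE _ hF0)[yy py].
set b := eta (fr_p F0) x in px *; set b' := eta (fr_p F0) y in py *.
have := @eta_perp_p_ge0 _ hF0 (b' *: x - b *: y).
rewrite !eta_lin -/b -/b' xx yy (etaC eta y x) mulrC subrr => /(_ erefl).
move: (eta x y) => c H; rewrite ltNge; apply/negP => c0.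
have bb' : 0 < b * b' by rewrite nmulr_rgt0.
have := mulr_ge0 (ltW bb') c0.
have : 0 < b ^+ 2 by rewrite exprn_even_gt0//= lt_eqF.
have := sqr_ge0 b'; lra.
Qed.

Lemma hyperboloid_sheet x : eta x x = -1 -> L x \/ L (- x).
Proof.
move=> xx; case: (ltrgtP (eta (fr_p F0) x) 0) => H.
- by left; apply/(lobachevskianE _ hF0).
- by right; apply/(lobachevskianE _ hF0); rewrite !eta_lin xx oppr_lt0; split=> //; ring.
- by have := eta_perp_p_ge0 hF0 H; rewrite xx; lra.
Qed.

Lemma L_of_eta_lt0 x y : L x -> eta y y = -1 -> eta x y < 0 -> L y.
Proof.
move=> Lx yy xy; have [//|/(L_eta_lt0 Lx)] := hyperboloid_sheet yy.
by rewrite etaNr; lra.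
Qed.

Lemma exists_L F : adapted eta F -> exists c : R, c != 0 /\ L (c *: (fr_p F - fr_q F)).
Proof.
move=> hF; set s : R := Num.sqrt 2 / 2.
have s0 : 0 < s by rewrite /s divr_gt0// sqrtr_gt0.
have ss : s * s = 2^-1.
  by rewrite /s mulrACA -expr2 sqr_sqrtr//; field.
have xx : eta (s *: (fr_p F - fr_q F)) (s *: (fr_p F - fr_q F)) = -1.
  by rewrite !eta_lin !(frE hF); nra.
have [?|] := hyperboloid_sheet xx; first by exists s; split=> //; rewrite gt_eqF.
by rewrite -scaleNr; exists (- s); split=> //; rewrite oppr_eq0 gt_eqF.
Qed.

(** For a frame other than the one defining [L], the vector [p] may point into either half of the
    light cone; [sg] records which one. *)
Lemma L_sign F : adapted eta F -> exists sg : R, sg != 0 /\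
  forall x, L x <-> eta x x = -1 /\ sg * eta (fr_p F) x < 0.
Proof.
move=> hF; have [c [c0 Lc]] := exists_L hF.
move: (c *: _) Lc => x0 Lc {c c0}.
have nz x : eta x x < 0 -> eta (fr_p F) x != 0.
  by apply: contraTneq => /(eta_perp_p_ge0 hF); rewrite leNgt.
exists (- eta (fr_p F) x0); split.
  by rewrite oppr_eq0 nz// (L_norm Lc); lra.
have key x : L x -> 0 < eta (fr_p F) x0 * eta (fr_p F) x.
  move=> Lx; rewrite lt_neqAle eq_sym mulf_neq0 ?nz ?L_norm// ?ltrN10//=.
  rewrite leNgt; apply/negP => neg.
  set b := eta (fr_p F) x0 in neg *; set b' := eta (fr_p F) x in neg *.
  (* If [b] and [b'] had opposite signs, this positive combination would be orthogonal to [p] and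
     still of negative norm. *)
  have := @nz (`|b'| *: x0 + `|b| *: x).
  have xx0 := L_eta_lt0 Lc Lx.
  rewrite !eta_lin (L_norm Lc) (L_norm Lx) (etaC eta x x0) -/b -/b'.
  have b0 : b != 0 by apply: contraTneq neg => ->; rewrite mul0r ltxx.
  have b'0 : b' != 0 by apply: contraTneq neg => ->; rewrite mulr0 ltxx.
  have n0 : 0 < `|b| by rewrite normr_gt0.
  have n0' : 0 < `|b'| by rewrite normr_gt0.
  have -> : `|b'| * b + `|b| * b' = 0.
    case: (ltrgtP b 0) neg b0 => hb; rewrite ?eqxx// => neg _.
      by rewrite (ltr0_norm hb) gtr0_norm; nra.
    by rewrite (gtr0_norm hb) ltr0_norm; nra.
  rewrite eqxx => H; suff : false by []; apply: H.
  move: (eta x0 x) xx0 n0 n0' => c c0; move: `|b| `|b'| => r r' r0 r'0.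
  have : r * r' * c < 0 by rewrite pmulr_rlt0// mulr_gt0.
  have := mulr_gt0 r0 r0; have := mulr_gt0 r'0 r'0; lra.
move=> x; split=> [Lx|[xx H]].
  by rewrite (L_norm Lx); split=> //; have := key _ Lx; nra.
have [//|/key] := hyperboloid_sheet xx.
by rewrite etaNr; nra.
Qed.

End Sheets.
End AdaptedFrames.

(** * The groups A, K and N *)

Section BlockElements.
Context {R : realType} {V : vectType R} {n : nat} (eta : {symmetric V}).
Hypothesis dimV : \dim {:V} = (n + 2)%N.
Variables (F : frame V n) (hF : adapted eta F).
Local Notation p := (fr_p F).
Local Notation q := (fr_q F).
Local Notation e := (fr_e F).
Implicit Types (v w : V) (f g : 'End(V)).

Definition ecol v : 'cV[R]_n := \col_i eta e`_i v.

Lemma ecol_is_linear : linear ecol.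
Proof. by move=> a v w; apply/colP => i; rewrite !mxE !eta_lin. Qed.
HB.instance Definition _ := GRing.isLinear.Build R V 'cV[R]_n _ ecol ecol_is_linear.

Lemma ecolD v w : ecol (v + w) = ecol v + ecol w. Proof. exact: linearD. Qed.
Lemma ecolZ a v : ecol (a *: v) = a *: ecol v. Proof. exact: linearZ. Qed.
Lemma ecolN v : ecol (- v) = - ecol v. Proof. exact: linearN. Qed.
Definition ecol_lin := (ecolD, ecolZ, ecolN).

Lemma coordv_frame v :
  coordv (fr_basis F) v = col_mx (eta q v)%:M (col_mx (ecol v) (eta p v)%:M).
Proof.
apply/matrixP => i j; rewrite !ord1 => {j}; move: i; apply: ord3_ind => [|k|].
- by rewrite mxE (coord_frame dimV hF) tuple3E col_mxEu mxE eqxx.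
- by rewrite mxE (coord_frame dimV hF) tuple3E col_mxEd col_mxEu mxE.
- by rewrite mxE (coord_frame dimV hF) tuple3E !col_mxEd mxE eqxx.
Qed.

Lemma scalar1_inj : injective (fun a : R => a%:M : 'M[R]_1).
Proof. by move=> a b /matrixP/(_ 0 0); rewrite !mxE. Qed.

Lemma frame_eqP v w : eta p v = eta p w -> eta q v = eta q w ->
  ecol v = ecol w -> v = w.
Proof.
move=> vp vq /colP ve; apply: (frame_ext dimV hF) => // i.
by have := ve i; rewrite !mxE.
Qed.

Lemma eta_ecol v w : eta v w =
  eta q v * eta p w + eta p v * eta q w + ((ecol v)^T *m ecol w) 0 0.
Proof.
rewrite (eta_frame dimV hF) mxE; congr (_ + _); apply: eq_bigr => i _.
by rewrite !mxE.
Qed.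

Lemma end_in_frame M v : coordv (fr_basis F) (end_in (fr_basis F) M v) =
  M *m coordv (fr_basis F) v.
Proof. exact: coordv_end_in (fr_basisP hF). Qed.

Lemma A_eltE a v : [/\ eta p (A_elt F a v) = a^-1 * eta p v,
  eta q (A_elt F a v) = a * eta q v & ecol (A_elt F a v) = ecol v].
Proof.
have := end_in_frame (block_mx a%:M 0 0 (block_mx 1%:M 0 0 (a^-1)%:M)) v.
rewrite -/(A_elt F a) !coordv_frame !mul_block_col !mul0mx !addr0 !add0r mul1mx.
rewrite -!scalar_mxM => /eq_col_mx[/scalar1_inj-> /eq_col_mx[-> /scalar1_inj->]].
by [].
Qed.

Lemma K_eltE k v : [/\ eta p (K_elt F k v) = eta p v,
  eta q (K_elt F k v) = eta q v & ecol (K_elt F k v) = k *m ecol v].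
Proof.
have := end_in_frame (block_mx 1%:M 0 0 (block_mx k 0 0 1%:M)) v.
rewrite -/(K_elt F k) !coordv_frame !mul_block_col !mul0mx !addr0 !add0r !mul1mx.
by move=> /eq_col_mx[/scalar1_inj-> /eq_col_mx[-> /scalar1_inj->]].
Qed.

Lemma N_eltE X v : [/\ eta p (N_elt F X v) = eta p v,
  eta q (N_elt F X v) = eta q v - (X^T *m ecol v) 0 0
                        - 2^-1 * (X^T *m X) 0 0 * eta p v
  & ecol (N_elt F X v) = ecol v + eta p v *: X].
Proof.
have := end_in_frame (block_mx 1%:M (row_mx (- X^T) (- (2^-1 *: (X^T *m X))))
              0    (block_mx 1%:M X 0 1%:M)) v.
rewrite -/(N_elt F X) !coordv_frame !mul_block_col mul_row_col.
rewrite !mul0mx !add0r !mul1mx.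
move=> /eq_col_mx[hq /eq_col_mx[-> /scalar1_inj->]]; split => //.
  have /matrixP/(_ 0 0) := hq; rewrite mul_mx_scalar !mxE eqxx !mulr1n => ->.
  rewrite [X in _ = _ - X - _](_ : _ = - (- X^T *m ecol v) 0 0); last first.
    by rewrite mulNmx !mxE opprK.
  by rewrite !mxE; ring.
by rewrite mul_mx_scalar.
Qed.

Lemma ecol_p : ecol p = 0.
Proof. by apply/colP => i; rewrite !mxE (frE hF). Qed.
Lemma ecol_q : ecol q = 0.
Proof. by apply/colP => i; rewrite !mxE (frE hF). Qed.

Definition evec (X : 'cV[R]_n) : V := \sum_(i < n) X i 0 *: e`_i.
Lemma eta_p_evec X : eta p (evec X) = 0.
Proof.
by rewrite eta_sumr big1 // => i _; rewrite etaZr (frE hF) mulr0.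
Qed.
Lemma eta_q_evec X : eta q (evec X) = 0.
Proof.
by rewrite eta_sumr big1 // => i _; rewrite etaZr (frE hF) mulr0.
Qed.
Lemma ecol_evec X : ecol (evec X) = X.
Proof.
apply/colP => i; rewrite mxE eta_sumr (bigD1 i)//= big1 ?addr0 => [|j ji].
  by rewrite etaZr (frE hF) eqxx mulr1.
by rewrite etaZr (frE hF) eq_sym (negbTE ji) mulr0.
Qed.

Lemma A_elt_p a : A_elt F a p = a *: p.
Proof.
have [h1 h2 h3] := A_eltE a p.
by apply: frame_eqP; rewrite ?h1 ?h2 ?h3 ?linearZ /= ?eta_lin ?(frE hF) ?ecol_p
  ?mulr0 ?mulr1 ?scaler0.
Qed.

Lemma A_elt_q a : A_elt F a q = a^-1 *: q.
Proof.
have [h1 h2 h3] := A_eltE a q.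
by apply: frame_eqP; rewrite ?h1 ?h2 ?h3 ?linearZ /= ?eta_lin ?(frE hF) ?ecol_q
  ?mulr0 ?mulr1 ?scaler0.
Qed.

Lemma K_elt_p k : K_elt F k p = p.
Proof.
have [h1 h2 h3] := K_eltE k p.
by apply: frame_eqP; rewrite ?h1 ?h2 ?h3 ?ecol_p ?mulmx0.
Qed.

Lemma K_elt_q k : K_elt F k q = q.
Proof.
have [h1 h2 h3] := K_eltE k q.
by apply: frame_eqP; rewrite ?h1 ?h2 ?h3 ?ecol_q ?mulmx0.
Qed.

Lemma N_elt_p X : N_elt F X p = p.
Proof.
have [h1 h2 h3] := N_eltE X p.
by apply: frame_eqP; rewrite ?h1 ?h2 ?h3 ?ecol_p ?(frE hF) ?mulmx0 ?scale0r ?addr0 //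
  mxE mulr0 !subr0.
Qed.

Lemma A_elt_isometry a : a != 0 -> end_isometry eta (A_elt F a).
Proof.
move=> a0 v w; rewrite eta_ecol.
have [-> -> ->] := A_eltE a v; have [-> -> ->] := A_eltE a w.
by rewrite [RHS]eta_ecol; congr (_ + _); field.
Qed.

Lemma K_elt_isometry k : k^T *m k = 1%:M -> end_isometry eta (K_elt F k).
Proof.
move=> kk v w; rewrite eta_ecol.
have [-> -> ->] := K_eltE k v; have [-> -> ->] := K_eltE k w.
by rewrite [RHS]eta_ecol trmx_mul -mulmxA (mulmxA _ k) kk mul1mx.
Qed.

Lemma dot_colC (X Y : 'cV[R]_n) : (X^T *m Y) 0 0 = (Y^T *m X) 0 0.
Proof. by rewrite !mxE; apply: eq_bigr => i _; rewrite !mxE mulrC. Qed.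

Lemma N_elt_isometry X : end_isometry eta (N_elt F X).
Proof.
move=> v w; rewrite eta_ecol.
have [-> -> ->] := N_eltE X v; have [-> -> ->] := N_eltE X w.
rewrite [RHS]eta_ecol.
have -> : (ecol v + eta p v *: X)^T = (ecol v)^T + eta p v *: X^T.
  by rewrite [LHS]linearD [X in _ + X]linearZ.
rewrite mulmxDl !mulmxDr -!scalemxAl -!scalemxAr.
rewrite [(X^T *m ecol v) 0 0]dot_colC.
rewrite ![(_ + _ : 'M[R]_1) 0 0]mxE ![(_ *: _ : 'M[R]_1) 0 0]mxE.
by field.
Qed.

Lemma A_eltM a b : (A_elt F a \o A_elt F b)%VF = A_elt F (a * b).
Proof.
apply/lfunP => v; rewrite comp_lfunE.
have [h1 h2 h3] := A_eltE a (A_elt F b v); have [k1 k2 k3] := A_eltE b v.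
have [l1 l2 l3] := A_eltE (a * b) v.
apply: frame_eqP; rewrite ?h1 ?h2 ?h3 ?k1 ?k2 ?k3 ?l1 ?l2 ?l3//; last by rewrite mulrA.
by rewrite invfM mulrA.
Qed.

Lemma A_elt1 : A_elt F 1 = \1%VF.
Proof.
apply/lfunP => v; rewrite id_lfunE; have [h1 h2 h3] := A_eltE 1 v.
by apply: frame_eqP; rewrite ?h1 ?h2 ?h3 ?invr1 ?mul1r.
Qed.

Lemma K_elt1 : K_elt F 1%:M = \1%VF.
Proof.
apply/lfunP => v; rewrite id_lfunE; have [h1 h2 h3] := K_eltE 1%:M v.
by apply: frame_eqP; rewrite ?h1 ?h2 ?h3 ?mul1mx.
Qed.

Lemma isometry_lker f : end_isometry eta f -> lker f == 0%VS.
Proof.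
move=> fi; apply/lker0P => v w vw; apply/eqP; rewrite -subr_eq0; apply/eqP.
apply: (eta_nondeg dimV hF) => z.
by rewrite -fi linearB /= vw subrr eta0l.
Qed.

Lemma isometry_inv f : end_isometry eta f -> end_isometry eta (f^-1)%VF.
Proof.
move=> fi v w; rewrite -fi -!comp_lfunE lker0_compfV ?isometry_lker//.
by rewrite !id_lfunE.
Qed.

Lemma isometry_compfV f : end_isometry eta f -> (f \o f^-1 = \1)%VF.
Proof. by move=> fi; rewrite lker0_compfV ?isometry_lker. Qed.

Lemma isometry_compVf f : end_isometry eta f -> (f^-1 \o f = \1)%VF.
Proof. by move=> fi; rewrite lker0_compVf ?isometry_lker. Qed.

Lemma isometry_fVK f v : end_isometry eta f -> f (f^-1%VF v) = v.
Proof. by move=> fi; rewrite -comp_lfunE isometry_compfV// id_lfunE. Qed.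

Lemma isometry_Vf f v : end_isometry eta f -> (f^-1)%VF (f v) = v.
Proof. by move=> fi; rewrite -comp_lfunE isometry_compVf// id_lfunE. Qed.

Lemma isometry_adj f v w : end_isometry eta f -> eta ((f^-1)%VF v) w = eta v (f w).
Proof. by move=> fi; rewrite -fi isometry_fVK. Qed.

Lemma isometry_invE f : end_isometry eta f -> ((f^-1)^-1 = f)%VF.
Proof. by move=> fi; apply: compl_inv; rewrite isometry_compVf. Qed.

Lemma end_det_K k : end_det (K_elt F k) = \det k.
Proof.
rewrite (end_det_mx_in _ (fr_basisP hF)) /K_elt end_inK ?(fr_basisP hF)//.
by rewrite !det_ublock !det_scalar1 mul1r mulr1.
Qed.

Lemma end_det_N X : end_det (N_elt F X) = 1.
Proof.
rewrite (end_det_mx_in _ (fr_basisP hF)) /N_elt end_inK ?(fr_basisP hF)//.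
by rewrite !det_ublock !det_scalar1 det1 !mul1r.
Qed.

(** [N] consists of the isometries that fix [p] and act trivially on [p^perp / p]; the parameter is
    the [E]-component of [f q]. *)
Lemma N_char f : end_isometry eta f -> f p = p ->
  (forall v, eta p v = 0 -> ecol (f v) = ecol v) -> f = N_elt F (ecol (f q)).
Proof.
move=> fi fp fE; set X := ecol (f q).
have fpv v : eta p (f v) = eta p v by rewrite -{1}fp fi.
have fe v : ecol (f v) = ecol v + eta p v *: X.
  have : eta p (v - eta p v *: q) = 0 by rewrite !eta_lin (frE hF) mulr1 subrr.
  move=> /fE.
  have -> : ecol (v - eta p v *: q) = ecol v - eta p v *: ecol q.
    by rewrite linearB [X in _ - X]linearZ.
  have -> : ecol (f (v - eta p v *: q)) = ecol (f v) - eta p v *: X.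
    by rewrite !linearB [X in _ - ecol X]linearZ [X in _ - X]linearZ.
  by rewrite ecol_q scaler0 subr0 => <-; rewrite subrK.
(* The remaining coordinate is forced by [eta (f q) (f q) = 0]; this is the quadratic entry of the
   matrices in [N]. *)
have qq : eta q (f q) = - 2^-1 * (X^T *m X) 0 0.
  have := fi q q; rewrite (eta_ecol (f q)) (frE hF) fpv (frE hF) -/X; lra.
apply/lfunP => v; have [h1 h2 h3] := N_eltE X v.
apply: frame_eqP; rewrite ?h1 ?h2 ?h3 ?fe//.
have := fi q v; rewrite (eta_ecol (f q)) !fpv (frE hF) qq -/X (fe v) mulmxDr -scalemxAr.
rewrite ![(_ + _ : 'M[R]_1) 0 0]mxE ![(_ *: _ : 'M[R]_1) 0 0]mxE; lra.
Qed.

(** The quotient [h^-1 f] fixes [p] and is trivial on [p^perp / p], so [N_char] applies. The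
    parameter need not be computed when exponentials are compared. *)
Lemma N_rel f h a : end_isometry eta f -> end_isometry eta h -> a != 0 ->
  f p = a *: p -> h p = a *: p ->
  (forall v, eta p v = 0 -> ecol (f v) = ecol (h v)) ->
  exists X, f = (h \o N_elt F X)%VF.
Proof.
move=> fi hi a0 fp hp fh.
have hVp : (h^-1)%VF p = a^-1 *: p.
  by rewrite -[in LHS](scale1r p) -(mulVf a0) -scalerA -hp linearZ /= isometry_Vf.
exists (ecol ((h^-1 \o f)%VF q)); rewrite -N_char.
- by rewrite comp_lfunA isometry_compfV// comp_lfun1l.
- by apply: isometry_comp => //; exact: isometry_inv.
- by rewrite comp_lfunE fp linearZ /= hVp scalerA mulfV// scale1r.
- move=> v pv; rewrite comp_lfunE.
  have Ef : eta p (f v) = 0.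
    by rewrite -(mul1r (eta p _)) -(mulVf a0) -mulrA -etaZl -fp fi pv mulr0.
  have Eh : eta p (h v) = 0.
    by rewrite -(mul1r (eta p _)) -(mulVf a0) -mulrA -etaZl -hp hi pv mulr0.
  have -> : f v = h v + (eta q (f v) - eta q (h v)) *: p.
    apply: frame_eqP; rewrite ?linearD ?linearZ /= ?eta_lin ?(frE hF) ?ecol_p
      ?scaler0 ?addr0 ?fh// ?Ef ?Eh; ring.
  rewrite linearD linearZ /= hVp isometry_Vf// linearD !linearZ /= ecol_p.
  by rewrite !scaler0 addr0.
Qed.

Lemma K_char f : end_isometry eta f -> end_det f = 1 -> f p = p -> f q = q ->
  K_group F f.
Proof.
move=> fi fd fp fq.
pose k : 'M[R]_n := \matrix_(i, j) eta e`_i (f e`_j).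
have fk : f = K_elt F k.
  apply/lfunP => v; have [h1 h2 h3] := K_eltE k v.
  apply: frame_eqP; rewrite ?h1 ?h2 ?h3.
  - by rewrite -{1}fp fi.
  - by rewrite -{1}fq fi.
  apply/colP => i; rewrite !mxE {1}(frame_decomp dimV hF v).
  rewrite !lfun_lin fp fq !eta_lin !(frE hF) !mulr0 add0r addr0.
  rewrite lfun_sum eta_sumr; apply: eq_bigr => j _.
  by rewrite !mxE lfunZ etaZr mulrC.
exists k => //; rewrite /= -end_det_K -fk; split => //.
apply/matrixP => i j.
have h1 := fi e`_i e`_j; move: h1; rewrite (frE hF) eta_ecol {1 3}fk.
have [a1 a2 a3] := K_eltE k e`_i; have [b1 b2 b3] := K_eltE k e`_j.
rewrite fk a1 a2 a3 b1 b2 b3 !(frE hF) !mulr0 !add0r mxE => H.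
have ej (l : 'I_n) : ecol e`_l = delta_mx l 0.
  by apply/colP => m; rewrite !mxE (frE hF) andbT.
move: H; rewrite !ej -!colE => H.
rewrite !mxE -H; apply: eq_bigr => l _; by rewrite !mxE.
Qed.

(** The intrinsic description [N_char] is visibly stable under products and inverses, so no block
    matrices are multiplied. *)
Lemma N_group_subgroup : is_subgroup (N_group F).
Proof.
have P X v : eta p v = 0 -> ecol (N_elt F X v) = ecol v.
  by have [_ _ ->] := N_eltE X v => ->; rewrite scale0r addr0.
have Q X v : eta p (N_elt F X v) = eta p v by have [] := N_eltE X v.
split.
- exists (ecol (\1%VF q)) => //; rewrite -N_char ?id_lfunE//.
    exact: isometry1.
  by move=> v; rewrite id_lfunE.
- move=> _ _ [X _ <-] [Y _ <-].
  exists (ecol ((N_elt F X \o N_elt F Y)%VF q)) => //; rewrite -N_char//.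
  + by apply: isometry_comp; exact: N_elt_isometry.
  + by rewrite comp_lfunE !N_elt_p.
  + by move=> v pv; rewrite comp_lfunE !P// Q.
- move=> _ [X _ <-]; have Ni := N_elt_isometry X.
  exists (ecol ((N_elt F X)^-1%VF q)) => //; rewrite -N_char//.
  + exact: isometry_inv.
  + by rewrite -{1}(N_elt_p X) isometry_Vf.
  + move=> v pv; rewrite -[in RHS](isometry_fVK v Ni) P//.
    by rewrite -(Q X) isometry_fVK.
Qed.

Lemma N_normal f a X : end_isometry eta f -> a != 0 -> f p = a *: p ->
  N_group F (f \o N_elt F X \o f^-1)%VF.
Proof.
move=> fi a0 fp; have fVi := isometry_inv fi.
have fVp : (f^-1)%VF p = a^-1 *: p.
  by rewrite -[in LHS](scale1r p) -(mulVf a0) -scalerA -fp linearZ /= isometry_Vf.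
exists (ecol ((f \o N_elt F X \o f^-1)%VF q)) => //; rewrite -N_char//.
- by apply: isometry_comp => //; apply: isometry_comp => //; exact: N_elt_isometry.
- by rewrite !comp_lfunE fVp linearZ /= N_elt_p linearZ /= fp scalerA mulVf// scale1r.
- move=> v pv; rewrite !comp_lfunE; set w := (f^-1)%VF v.
  have pw : eta p w = 0 by rewrite etaC isometry_adj// fp etaZr etaC pv mulr0.
  have -> : N_elt F X w = w + (eta q (N_elt F X w) - eta q w) *: p.
    have [h1 _ h3] := N_eltE X w.
    apply: frame_eqP; rewrite ?linearD ?linearZ /= ?eta_lin ?(frE hF) ?ecol_p ?h1 ?h3
      ?pw ?scaler0 ?scale0r ?addr0//; ring.
  rewrite linearD linearZ /= isometry_fVK// fp linearD !linearZ /= ecol_p.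
  by rewrite !scaler0 addr0.
Qed.

End BlockElements.

(** Among the subspaces contained in [S], one of maximal dimension must be all of [S], since
    adjoining a further vector of [S] would enlarge it. *)
Lemma lin_closed_vspace (R : realType) (W : vectType R) (S : set W) :
  S 0 -> (forall x y, S x -> S y -> S (x + y)) ->
  (forall (a : R) x, S x -> S (a *: x)) ->
  exists U : {vspace W}, forall x, x \in U <-> S x.
Proof.
move=> S0 SD SZ.
pose Q d := `[< exists U : {vspace W}, (forall x, x \in U -> S x) /\ \dim U = d >].
have Q0 : exists d, Q d.
  exists 0%N; apply/asboolP; exists 0%VS; rewrite dimv0; split=> // x.
  by rewrite memv0 => /eqP->.
have Qle d : Q d -> (d <= \dim {:W})%N.
  by move=> /asboolP[U [_ <-]]; rewrite dimvS ?subvf.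
case: (ex_maxnP Q0 Qle) => d /asboolP[U [US dU]] dmax.
exists U => x; split=> [/US //|Sx].
apply: contraT => xU.
have : Q (\dim (U + <[x]>)%VS).
  apply/asboolP; exists (U + <[x]>)%VS; split=> // y /memv_addP[u uU [v]].
  by move=> /vlineP[a ->] ->; apply: SD; [exact: US | exact: SZ].
move=> /dmax; rewrite -dU leqNgt => /negP[].
rewrite ltnNge; apply: contra xU => le.
have /eqP -> : U == (U + <[x]>)%VS by rewrite eqEdim addvSl.
by rewrite memvE addvSr.
Qed.

(** A cluster point exists by compactness of a cube, and [phi k] picks an index beyond [k] within
    [1 / (k + 1)] of it. The condition [j <= phi j] replaces monotonicity. *)
Lemma bounded_mx_subseq (R : realType) (m n : nat) (u : nat -> 'M[R]_(m, n)) :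
  (forall k i j, `|u k i j| <= 1) ->
  exists (C0 : 'M[R]_(m, n)) (phi : nat -> nat), (forall j, (j <= phi j)%N) /\
    forall i j, u (phi k) i j @[k --> \oo] --> C0 i j.
Proof.
move=> u1; pose v k := mxvec (u k).
have cK : compact [set w : 'rV[R]_(m * n) | forall i, `[-1, 1]%classic (w ord0 i)].
  have := @rV_compact R (m * n)%N (fun=> `[-1, 1]%classic) (fun=> @segment_compact R (-1) 1). exact.
have [|a [_ acl]] := cK (v @ \oo) _.
  exists 0%N => // k _ i /=; case/mxvec_indexP: i => i j.
  by rewrite mxvecE in_itv /= -ler_norml.
have H j : exists k, (j <= k)%N /\ forall i, `|a 0 i - v k 0 i| < j.+1%:R^-1.
  have [] := acl (v @` [set k | (j <= k)%N]) (ball a (j.+1%:R^-1)).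
  - by exists j => // k /= jk; exists k.
  - by apply/nbhs_ballP; exists (j.+1%:R^-1) => /=; rewrite ?invr_gt0.
  move=> _ [[k /= jk <-] [_ B]]; exists k; split=> // i.
  exact: B.
have [phi phiP] := choice H.
exists (vec_mx a), phi; split=> [j|i j]; first by have [] := phiP j.
apply/cvgrPdist_lt => eps eps0.
have := @cvg_harmonic R => /cvgrPdist_lt/(_ _ eps0); apply: filterS => k /=.
rewrite sub0r normrN ger0_norm ?invr_ge0// => lt.
have [_ /(_ (mxvec_index i j))] := phiP k.
by rewrite /v mxvecE mxE => /lt_trans; apply.
Qed.

(** * Convergence of endomorphisms through matrix coefficients *)

Section WeakConvergence.
Context {R : realType} {V : vectType R} {n : nat} (eta : {symmetric V}).
Hypothesis dimV : \dim {:V} = (n + 2)%N.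
Variables (F : frame V n) (hF : adapted eta F).
Implicit Types (v w : V) (f g X Y : 'End(V)).
Local Notation p := (fr_p F).
Local Notation q := (fr_q F).
Local Notation e := (fr_e F).

(** Equivalent to convergence of matrices in finite dimension, but adapted to [eta]: it passes to
    inverses of isometries by taking adjoints. *)
Definition weak_cvg (c : nat -> 'End(V)) (c0 : 'End(V)) :=
  forall v w, eta (c k v) w @[k --> \oo] --> eta (c0 v) w.

Lemma weak_cvg_eta (c d : nat -> 'End(V)) c0 d0 v w :
  weak_cvg c c0 -> weak_cvg d d0 ->
  eta (c k v) (d k w) @[k --> \oo] --> eta (c0 v) (d0 w).
Proof.
move=> cc dd.
have cE x y : eta x y = eta x q * eta y p + eta x p * eta y q +
    \sum_(i < n) eta x e`_i * eta y e`_i.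
  rewrite (eta_frame dimV hF) ![eta _ x]etaC ![eta _ y]etaC; congr (_ + _).
  by apply: eq_bigr => i _; rewrite ![eta e`_i _]etaC.
rewrite cE; under eq_cvg do rewrite cE.
apply: cvgD; first by apply: cvgD; apply: cvgM.
by apply: cvg_sumr => i; apply: cvgM.
Qed.

Lemma weak_cvg_scalar (c : nat -> 'End(V)) c0 (phi : {scalar 'End(V)}) :
  weak_cvg c c0 -> phi (c k) @[k --> \oo] --> phi c0.
Proof.
move=> cc; have hb := fr_basisP hF; set b := fr_basis F in hb.
pose a i j : R := phi (end_in b (delta_mx i j)).
have phiE f : phi f = \sum_i \sum_j a i j * mx_in b f i j by exact: scalar_mx_inE.
rewrite phiE; under eq_cvg do rewrite phiE.
apply: cvg_sumr => i; apply: cvg_sumr => j; apply: cvgMl_tmp.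
rewrite mxE (coord_frame dimV hF) etaC.
under eq_cvg do rewrite mxE (coord_frame dimV hF) etaC.
exact: cc.
Qed.

(** The coordinates of the part outside [U] are linear functionals vanishing along the sequence.
    Applied to the Lie algebra, this is the closedness that [G] itself may lack. *)
Lemma weak_cvg_vspace (c : nat -> 'End(V)) c0 (U : {vspace 'End(V)}) :
  weak_cvg c c0 -> (forall k, c k \in U) -> c0 \in U.
Proof.
move=> cc cU; pose P := (\1 - projv U)%VF.
suff : P c0 = 0.
  rewrite add_lfunE opp_lfunE id_lfunE => /eqP; rewrite subr_eq0 => /eqP->.
  exact: memv_proj.
apply: (coordv_inj (vbasisP {:'End(V)})); apply/colP => i; rewrite linear0.
pose phi (f : 'End(V)) : R := coord (vbasis {:'End(V)}) i (P f).
have phiL : scalar phi.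
  by move=> a f g; rewrite /phi linearP linearP.
pose L := GRing.isLinear.Build _ _ _ _ _ phiL.
pose phi' : {scalar 'End(V)} := HB.pack phi L.
have := @weak_cvg_scalar _ _ phi' cc.
rewrite (_ : (fun k => phi' (c k)) = fun=> 0).
  move=> H; rewrite !mxE; apply: (cvg_unique _ H); [by [] | exact: cvg_cst].
apply/funext => k /=; rewrite /phi /P add_lfunE opp_lfunE id_lfunE projv_id//.
by rewrite subrr linear0.
Qed.

End WeakConvergence.

(** * The Lie algebra of a connected Lie subgroup and its invariant subspaces *)

Section LieGroup.
Context {R : realType} {V : vectType R} {n : nat} (eta : {symmetric V}).
Hypothesis dimV : \dim {:V} = (n + 2)%N.
Variables (F0 : frame V n) (hF0 : adapted eta F0).
Variables (G : set 'End(V)) (hG : connected_lie_subgroup (SO eta) G).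
Implicit Types (v w : V) (f X Y : 'End(V)).
Local Notation g := (lie_algebra G).

Lemma G_iso f : G f -> end_isometry eta f.
Proof. by case: hG => sG _ _ _ /sG[]. Qed.
Lemma G_det f : G f -> end_det f = 1.
Proof. by case: hG => sG _ _ _ /sG[]. Qed.
Lemma G_1 : G \1%VF.
Proof. by case: hG => _ []. Qed.
Lemma G_comp f f' : G f -> G f' -> G (f \o f')%VF.
Proof. by case: hG => _ [_ + _] _ _; apply. Qed.
Lemma G_inv f : G f -> G (f^-1)%VF.
Proof. by case: hG => _ [_ _ +] _ _; apply. Qed.

Lemma lie_exp X : g X -> G (end_exp X).
Proof. by move=> /(_ 1); rewrite scale1r. Qed.
Lemma lie_0 : g 0. Proof. by case: hG => _ _ []. Qed.
Lemma lie_D X Y : g X -> g Y -> g (X + Y).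
Proof. by case: hG => _ _ [_ + _ _] _; apply. Qed.
Lemma lie_Z a X : g X -> g (a *: X).
Proof. by case: hG => _ _ [_ _ + _] _; apply. Qed.
Lemma lie_N X : g X -> g (- X).
Proof. by move=> gX; rewrite -scaleN1r; exact: lie_Z. Qed.
Lemma lie_B X Y : g X -> g Y -> g (X - Y).
Proof. by move=> gX gY; exact: (lie_D gX (lie_N gY)). Qed.
Lemma lie_bracket X Y : g X -> g Y -> g ((X \o Y)%VF - (Y \o X)%VF).
Proof. by case: hG => _ _ [_ _ _ +] _; apply. Qed.

Lemma lie_vspace : exists U : {vspace 'End(V)}, forall X, X \in U <-> g X.
Proof.
by apply: lin_closed_vspace; [exact: lie_0 | exact: lie_D | exact: lie_Z].
Qed.

(* Differentiate [eta (exp (s X) v) w = eta v (exp (- s X) w)] at [s = 0]. *)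
Lemma exp_isometry_skew X :
  (forall t, end_isometry eta (end_exp (t *: X))) -> skew_end eta X.
Proof.
move=> iX v w.
have h1 := end_exp_scalar_derive X (eval_form eta v w) 0.
have h2 := end_exp_scalar_derive (- X) (eval_form eta w v) 0.
have E : (fun s => eval_form eta v w (end_exp (s *: X))) =
         (fun s => eval_form eta w v (end_exp (s *: - X))).
  apply/funext => s; rewrite /eval_form /= etaC -(isometry_adj dimV hF0) //.
  by rewrite end_exp_inv scalerN.
have [_ e1] := h1; have [_ e2] := h2; move: e1; rewrite E e2.
rewrite !scale0r end_exp0 !comp_lfun1r => e3.
have : eta ((- X) w) v = eta (X v) w := e3.
by rewrite opp_lfunE etaNl etaC => <-.
Qed.

Lemma lie_skew X : g X -> skew_end eta X.
Proof. by move=> gX; apply: exp_isometry_skew => t; exact: G_iso. Qed.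

Lemma lie_conj f X : G f -> g X -> g (f \o X \o f^-1)%VF.
Proof.
move=> Gf gX t.
have fi := G_iso Gf.
have -> : end_exp (t *: (f \o X \o f^-1)%VF) = (f \o end_exp (t *: X) \o f^-1)%VF.
  have : (f \o (t *: X) = (t *: (f \o X \o f^-1)) \o f)%VF.
    rewrite -comp_lfunZl -comp_lfunZr -!comp_lfunA (isometry_compVf dimV hF0)//.
    by rewrite comp_lfun1r.
  move: (t *: (f \o X \o f^-1)%VF) => Y /end_exp_intertwine ->.
  by rewrite -comp_lfunA (isometry_compfV dimV hF0)// comp_lfun1r.
by apply: G_comp; [apply: G_comp => //; exact: gX | exact: G_inv].
Qed.

Lemma G_generated f : G f -> exists s : seq 'End(V),
  (forall X, X \in s -> g X) /\
  f = foldr (fun X h => (end_exp X \o h)%VF) \1%VF s.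
Proof. by case: hG => _ _ _; apply. Qed.

Lemma G_ind (P : 'End(V) -> Prop) : P \1%VF ->
  (forall X f, g X -> P f -> P (end_exp X \o f)%VF) -> forall f, G f -> P f.
Proof.
move=> P1 PS f /G_generated[s [sg ->]].
elim: s sg => [|X s IH] sg //=.
apply: PS; first by apply: sg; rewrite mem_head.
by apply: IH => Y Ys; apply: sg; rewrite in_cons Ys orbT.
Qed.

Lemma G_invariant (U : {vspace V}) :
  (forall X v, g X -> v \in U -> X v \in U) ->
  forall f v, G f -> v \in U -> f v \in U.
Proof.
move=> gU f v Gf; move: f Gf v; apply: G_ind => [v|X f gX IH v vU].
  by rewrite id_lfunE.
by rewrite comp_lfunE; apply: end_exp_invariant => [w|]; [exact: gU | exact: IH].
Qed.

Lemma G_fix v : (forall X, g X -> X v = 0) -> forall f, G f -> f v = v.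
Proof.
move=> gv; apply: G_ind => [|X f gX fv]; first by rewrite id_lfunE.
rewrite comp_lfunE fv (@end_exp_eigen _ _ _ _ 0) ?expR0 ?scale1r// scale0r.
exact: gv.
Qed.

Section Transitive.
Hypothesis hT : acts_transitively G (lobachevskian eta F0).
Local Notation L := (lobachevskian eta F0).

(* A proper subspace [U] containing a hyperbolic plane meets [L] in a proper nonempty subset. *)
Lemma invariant_full (F : frame V n) (U : {vspace V}) : adapted eta F ->
  fr_p F \in U -> fr_q F \in U ->
  (forall X v, g X -> v \in U -> X v \in U) -> forall v, v \in U.
Proof.
move=> hF pU qU gU v.
have [c [c0 Lx]] := exists_L dimV hF0 hF.
set x := c *: _ in Lx.
have xU : x \in U by rewrite memvZ// memvB.
clearbody x.
have orth0 z : (forall u, u \in U -> eta z u = 0) -> z = 0.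
  move=> zU; apply/eqP/negP => /negP z0.
  have pz : eta (fr_p F) z = 0 by rewrite etaC zU.
  have qz : eta (fr_q F) z = 0 by rewrite etaC zU.
  have zz0 : 0 < eta z z.
    rewrite lt_neqAle (eta_perp_p_ge0 dimV hF pz) andbT eq_sym.
    apply: contra z0 => /eqP zz.
    by rewrite (isotropic_perp_p dimV hF pz zz) qz scale0r.
  (* As [z] is orthogonal to [x], the coefficient makes [eta y y = -1]. Transitivity and invariance
     put [y], hence [z], into [U], although [z] is orthogonal to [U] and has positive norm. *)
  pose y := Num.sqrt (1 + eta z z) *: x + z.
  have xz : eta x z = 0 by rewrite etaC zU.
  have sq : Num.sqrt (1 + eta z z) ^+ 2 = 1 + eta z z.
    by rewrite sqr_sqrtr//; lra.
  have s0 : 0 < Num.sqrt (1 + eta z z) by rewrite sqrtr_gt0; lra.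
  have Ly : L y.
    apply: (L_of_eta_lt0 dimV hF0 Lx).
      rewrite /y etaDl !etaDr !etaZl !etaZr (etaC eta z x) xz (L_norm dimV hF0 Lx).
      by move: sq; rewrite expr2; lra.
    by rewrite /y etaDr etaZr xz (L_norm dimV hF0 Lx); lra.
  have [f [Gf fx]] := hT.2 _ _ Lx Ly.
  have yU : y \in U by rewrite -fx; apply: G_invariant.
  have zU' : z \in U.
    have -> : z = y - Num.sqrt (1 + eta z z) *: x by rewrite /y addrC addKr.
    by rewrite memvB// memvZ.
  by move: zz0; rewrite (zU _ zU') ltxx.
have UU0 : (orthov eta U = 0)%VS.
  apply/eqP; rewrite -subv0; apply/subvP => z /mem_orthovP zU.
  by rewrite memv0; apply/eqP; apply: orth0.
suff -> : U = fullv by rewrite memvf.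
apply/eqP; rewrite eqEdim subvf /= leqNgt; apply/negP => dU.
(* The map [v |-> (eta v u_i)_i] over a basis [u_i] of [U] has a nonzero kernel. *)
pose h v : 'rV[R]_(\dim U) := \row_i eta v (vbasis U)`_i.
have hlin : linear h by move=> a y z; apply/rowP => i; rewrite !mxE !eta_lin.
pose hL := GRing.isLinear.Build _ _ _ _ _ hlin.
pose h' : {linear V -> 'rV[R]_(\dim U)} := HB.pack h hL.
have /lker0P/eqP k0 : injective (linfun h').
  move=> y z; rewrite !lfunE /= => yz; apply/eqP; rewrite -subr_eq0; apply/eqP.
  apply: orth0 => u uU; rewrite (coord_vbasis uU) eta_sumr big1 // => i _.
  have /rowP/(_ i) := yz; rewrite !mxE etaZr !eta_lin => ->.
  by rewrite subrr mulr0.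
have := limg_ker_dim (linfun h') fullv; rewrite k0 capv0 dimv0 add0n => H.
have : (\dim (limg (linfun h')) <= \dim U)%N.
  by rewrite (leq_trans (dimvS (subvf _)))// dimvf dim_matrix mul1r.
by rewrite H leqNgt dU.
Qed.

End Transitive.
End LieGroup.

Lemma cvg_cst_unique (R : realType) (u : nat -> R) (l a : R) :
  u @ \oo --> l -> (forall k, u k = a) -> l = a.
Proof.
move=> ul ua; apply: (cvg_unique _ ul) => //.
by rewrite (_ : u = fun=> a); [exact: cvg_cst | apply/funext].
Qed.

(** * Nilpotent elements obtained as limits of conjugates *)

Section LimitNilpotent.
Context {R : realType} {V : vectType R} {n : nat} (eta : {symmetric V}).
Hypothesis dimV : \dim {:V} = (n + 2)%N.
Implicit Types (F : frame V n) (v w : V) (f X Y : 'End(V)).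

Lemma A_elt_inv_decomp F (hF : adapted eta F) (a : R) v : a != 0 ->
  ((A_elt F a)^-1)%VF v = (a^-1 * eta (fr_q F) v) *: fr_p F +
    (v - eta (fr_q F) v *: fr_p F - eta (fr_p F) v *: fr_q F) +
    (a * eta (fr_p F) v) *: fr_q F.
Proof.
move=> a0.
have -> : ((A_elt F a)^-1)%VF = A_elt F a^-1.
  by apply: compl_inv; rewrite (A_eltM dimV hF) mulfV// (A_elt1 dimV hF).
have [h1 h2 h3] := A_eltE dimV hF a^-1 v.
apply: (frame_eqP dimV hF); rewrite ?h1 ?h2 ?h3 ?invrK.
- by rewrite !eta_lin !(frE hF); ring.
- by rewrite !eta_lin !(frE hF); ring.
- by rewrite !ecol_lin (ecol_p hF) (ecol_q hF) !scaler0 !oppr0 !addr0 add0r.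
Qed.

(* The component of [Y] in the eigenspace of [ad (wedge p q)] on which
   conjugation by [A_elt F a] is multiplication by [a]. *)
Definition nil_part F Y : 'End(V) :=
  wedge eta (fr_p F) (Y (fr_q F) - eta (fr_p F) (Y (fr_q F)) *: fr_q F).

Lemma nil_partE F (hF : adapted eta F) Y v w : skew_end eta Y ->
  let vE := v - eta (fr_q F) v *: fr_p F - eta (fr_p F) v *: fr_q F in
  let wE := w - eta (fr_q F) w *: fr_p F - eta (fr_p F) w *: fr_q F in
  eta (nil_part F Y v) w = eta (fr_p F) w * eta (Y vE) (fr_q F)
                         + eta (fr_p F) v * eta (Y (fr_q F)) wE.
Proof.
move=> sY vE wE; rewrite /nil_part wedgeE !eta_lin /vE /wE !lfun_lin !eta_lin.
have h1 := skew_self (fr_q F) sY.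
have h2 : eta (Y v) (fr_q F) = - eta (Y (fr_q F)) v by rewrite sY etaC.
have h3 : eta (Y (fr_p F)) (fr_q F) = - eta (Y (fr_q F)) (fr_p F) by rewrite sY etaC.
by rewrite h1 h2 h3 (etaC eta (fr_p F) (Y _)); ring.
Qed.

(** An expansion in powers of [a]. The terms of degree 2 and -2 before rescaling contain
    [eta (Y q) q] and [eta (Y p) p], which vanish by skewness, so after division by [a] the leading
    term is that of [nil_part]. *)
Lemma A_conj_scaled F (hF : adapted eta F) Y (a : R) v w : skew_end eta Y -> a != 0 ->
  let vE := v - eta (fr_q F) v *: fr_p F - eta (fr_p F) v *: fr_q F in
  let wE := w - eta (fr_q F) w *: fr_p F - eta (fr_p F) w *: fr_q F in
  a^-1 * eta (Y ((A_elt F a)^-1%VF v)) ((A_elt F a)^-1%VF w) =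
  eta (fr_p F) w * eta (Y vE) (fr_q F) + eta (fr_p F) v * eta (Y (fr_q F)) wE
  + a^-1 * (eta (Y vE) wE + eta (fr_q F) v * eta (fr_p F) w * eta (Y (fr_p F)) (fr_q F)
            + eta (fr_p F) v * eta (fr_q F) w * eta (Y (fr_q F)) (fr_p F))
  + a^-1 * (a^-1 * (eta (fr_q F) v * eta (Y (fr_p F)) wE
                    + eta (fr_q F) w * eta (Y vE) (fr_p F))).
Proof.
move=> sY a0 vE wE; rewrite !(A_elt_inv_decomp hF)// -/vE -/wE.
rewrite !lfun_lin !eta_lin (skew_self (fr_p F) sY) (skew_self (fr_q F) sY).
by field.
Qed.

(** An isometry fixing [p - q] preserves the positive definite form [dot_fr], for which the frame is
    orthonormal; its matrix entries are therefore bounded by 1. *)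
Lemma weak_cvg_subseq F (hF : adapted eta F) (c : nat -> 'End(V)) :
  (forall k, end_isometry eta (c k)) ->
  (forall k, c k (fr_p F - fr_q F) = fr_p F - fr_q F) ->
  exists c0 (phi : nat -> nat), (forall j, (j <= phi j)%N) /\
    weak_cvg eta (fun k => c (phi k)) c0.
Proof.
move=> ci cpq; have hb := fr_basisP hF.
have dotc k v w : dot_fr eta F (c k v) (c k w) = dot_fr eta F v w.
  by rewrite /dot_fr ci -{1 2}(cpq k) !ci.
have bd k i j : `|mx_in (fr_basis F) (c k) i j| <= 1.
  rewrite -(@ler_pXn2r _ 2)// ?nnegrE// expr1n real_normK ?num_real//.
  have := dotc k (fr_basis F)`_j (fr_basis F)`_j.
  rewrite !(dot_frE dimV hF) => H.
  have -> : (1 : R) = \sum_i coord (fr_basis F) i (fr_basis F)`_j *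
                       coord (fr_basis F) i (fr_basis F)`_j.
    rewrite (bigD1 j)//= big1 ?addr0 => [|l lj].
      by rewrite coord_free ?(basis_free hb)// eqxx mulr1.
    by rewrite coord_free ?(basis_free hb)// eq_sym (negbTE lj) mulr0.
  rewrite -H (bigD1 i)//= mxE expr2 lerDl; apply: sumr_ge0 => l _.
  exact: sqr_ge0.
have [C0 [phi [phij H]]] := bounded_mx_subseq bd.
exists (end_in (fr_basis F) C0), phi; split=> // v w.
have E f : eta (f v) w = \sum_i \sum_j mx_in (fr_basis F) f i j *
    (coord (fr_basis F) j v * eta (fr_basis F)`_i w).
  rewrite -{1}[f v](coordvK hb) eta_suml; apply: eq_bigr => i _.
  rewrite etaZl mx_in_coordv// [(_ *m _) i 0]mxE mulr_suml.
  by apply: eq_bigr => j _; rewrite [coordv _ _ _ _]mxE mulrA.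
rewrite E; under eq_cvg do rewrite E.
apply: cvg_sumr => i; apply: cvg_sumr => j; apply: cvgMr_tmp.
by rewrite end_inK.
Qed.

Section InGroup.
Variables (F0 : frame V n) (hF0 : adapted eta F0).
Variables (G : set 'End(V)) (hG : connected_lie_subgroup (SO eta) G).
Local Notation g := (lie_algebra G).

(* Conjugate [X] by [A_elt F k.+1%:R \o c k], divide by [k.+1%:R] and pass to a
   limit point [c0] of [c], which exists since the stabilizer of [p - q] is
   compact: all components but [nil_part] disappear. *)
Lemma limit_nil_part F (hF : adapted eta F) (c : nat -> 'End(V)) :
  (forall k, end_isometry eta (c k)) ->
  (forall k, c k (fr_p F - fr_q F) = fr_p F - fr_q F) ->
  (forall k, G (A_elt F k.+1%:R \o c k)%VF) ->
  exists c0 : 'End(V), [/\ end_isometry eta c0,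
    forall v w, (forall k, c k v = w) -> c0 v = w &
    forall X, g X -> g (nil_part F (c0 \o X \o c0^-1)%VF)].
Proof.
move=> ci cpq Gc.
have [c0 [phi [phij cc]]] := weak_cvg_subseq hF ci cpq.
have c0i : end_isometry eta c0.
  move=> v w; apply: (cvg_cst_unique (weak_cvg_eta dimV hF cc cc)) => k.
  exact: ci.
exists c0; split=> [|v w cv|X gX]; first exact: c0i.
  apply/eqP; rewrite -subr_eq0; apply/eqP; apply: (eta_nondeg dimV hF) => z.
  rewrite etaDl etaNl; apply/eqP; rewrite subr_eq0; apply/eqP.
  by apply: (cvg_cst_unique (cc v z)) => k; rewrite cv.
have [U UP] := lie_vspace hG.
pose f k := (A_elt F (phi k).+1%:R \o c (phi k))%VF.
pose M k : 'End(V) := ((phi k).+1%:R^-1 : R) *: (f k \o X \o (f k)^-1)%VF.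
have MU k : M k \in U.
  apply/UP; apply: (lie_Z hG); apply: (lie_conj dimV hF hG) => //; exact: Gc.
suff Mc : weak_cvg eta M (nil_part F (c0 \o X \o c0^-1)%VF).
  by apply/UP; exact: (weak_cvg_vspace dimV hF Mc MU).
pose Y k := (c (phi k) \o X \o (c (phi k))^-1)%VF.
have sX := lie_skew dimV hF hG gX.
have conj_skew h : end_isometry eta h -> skew_end eta (h \o X \o h^-1)%VF.
  move=> hi v w; rewrite !comp_lfunE.
  rewrite -{1}(isometry_fVK dimV hF w hi) hi sX -hi.
  by rewrite (isometry_fVK dimV hF _ hi).
(* The inverses converge as well: the inverse of an isometry is its adjoint, so its matrix
   coefficients are those of [c (phi k)] with the arguments exchanged. *)
have Yc v w : eta (Y k v) w @[k --> \oo] --> eta ((c0 \o X \o c0^-1)%VF v) w.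
  have E h : end_isometry eta h -> eta ((h \o X \o h^-1)%VF v) w =
      eta ((X \o h^-1)%VF v) ((h^-1)%VF w).
    by move=> hi; rewrite !comp_lfunE -{1}(isometry_fVK dimV hF w hi) hi.
  rewrite E//; rewrite (_ : (fun k => _) =
    fun k => eta ((X \o (c (phi k))^-1)%VF v) (((c (phi k))^-1)%VF w)); last first.
    by apply/funext => k; rewrite /Y E.
  apply: (@weak_cvg_eta _ _ _ _ dimV _ hF (fun k => X \o (c (phi k))^-1)%VF
    (fun k => (c (phi k))^-1)%VF (X \o c0^-1)%VF (c0^-1)%VF v w) => x y.
    rewrite comp_lfunE sX (isometry_adj dimV hF)// (_ : (fun k => _) =
      fun k => - eta (c (phi k) (X y)) x).
      by rewrite etaC; apply: cvgN; exact: cc.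
    by apply/funext => k; rewrite comp_lfunE sX (isometry_adj dimV hF)// etaC.
  rewrite (isometry_adj dimV hF)// (_ : (fun k => _) =
    fun k => eta (c (phi k) y) x); first by rewrite etaC; exact: cc.
  by apply/funext => k; rewrite (isometry_adj dimV hF)// etaC.
have ti : ((phi k).+1%:R^-1 : R) @[k --> \oo] --> (0 : R).
  apply/cvgrPdist_lt => eps eps0.
  have := @cvg_harmonic R => /cvgrPdist_lt/(_ _ eps0); apply: filterS => k /=.
  rewrite !sub0r !normrN !ger0_norm ?invr_ge0//; apply: le_lt_trans.
  by rewrite lef_pV2 ?posrE// ler_nat ltnS.
move=> v w; rewrite (nil_partE hF); last exact: conj_skew.
set vE := v - _ - _; set wE := w - _ - _.
have ME k : eta (M k v) w = (phi k).+1%:R^-1 *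
    eta (Y k ((A_elt F (phi k).+1%:R)^-1%VF v)) ((A_elt F (phi k).+1%:R)^-1%VF w).
  have a0 : (phi k).+1%:R != 0 :> R by rewrite pnatr_eq0.
  have Ai := A_elt_isometry dimV hF a0.
  have fi : end_isometry eta (f k) by apply: isometry_comp.
  have fV : ((f k)^-1 = (c (phi k))^-1 \o (A_elt F (phi k).+1%:R)^-1)%VF.
    apply: compl_inv; rewrite /f -!comp_lfunA (comp_lfunA (c _)).
    by rewrite (isometry_compfV dimV hF)// comp_lfun1l (isometry_compfV dimV hF).
  rewrite /M scale_lfunE etaZl fV /f; congr (_ * _).
  rewrite !comp_lfunE -{1}(isometry_fVK dimV hF w Ai) Ai.
  by rewrite /Y ?comp_lfunE.
(* The three coefficients converge; as [a2] and [a3] come with the factors [1/a] and [1/a^2], where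
   [a = (phi k).+1], only [a1] survives. *)
pose a1 k := eta (fr_p F) w * eta (Y k vE) (fr_q F)
    + eta (fr_p F) v * eta (Y k (fr_q F)) wE.
pose a2 k := eta (Y k vE) wE
    + eta (fr_q F) v * eta (fr_p F) w * eta (Y k (fr_p F)) (fr_q F)
    + eta (fr_p F) v * eta (fr_q F) w * eta (Y k (fr_q F)) (fr_p F).
pose a3 k := eta (fr_q F) v * eta (Y k (fr_p F)) wE
    + eta (fr_q F) w * eta (Y k vE) (fr_p F).
have -> : (fun k => eta (M k v) w) = fun k => a1 k + (phi k).+1%:R^-1 * a2 k
    + (phi k).+1%:R^-1 * ((phi k).+1%:R^-1 * a3 k).
  apply/funext => k; rewrite ME; apply: (A_conj_scaled hF); first exact: conj_skew.
  by rewrite pnatr_eq0.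
set Y0 := (c0 \o X \o c0^-1)%VF in Yc *.
have c1 : a1 @ \oo --> eta (fr_p F) w * eta (Y0 vE) (fr_q F)
    + eta (fr_p F) v * eta (Y0 (fr_q F)) wE by apply: cvgD; apply: cvgMl_tmp.
have c2 : a2 @ \oo --> eta (Y0 vE) wE
    + eta (fr_q F) v * eta (fr_p F) w * eta (Y0 (fr_p F)) (fr_q F)
    + eta (fr_p F) v * eta (fr_q F) w * eta (Y0 (fr_q F)) (fr_p F).
  by apply: cvgD; [apply: cvgD => //|]; apply: cvgMl_tmp.
have c3 : a3 @ \oo --> eta (fr_q F) v * eta (Y0 (fr_p F)) wE
    + eta (fr_q F) w * eta (Y0 vE) (fr_p F) by apply: cvgD; apply: cvgMl_tmp.
have := cvgD (cvgD c1 (cvgM ti c2)) (cvgM ti (cvgM ti c3)).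
by rewrite !mul0r !addr0; apply.
Qed.

End InGroup.
End LimitNilpotent.

#[local] Opaque lie_algebra wedge.

(** * Groups without invariant isotropic line *)

Section Irreducible.
Context {R : realType} {V : vectType R} {n : nat} (eta : {symmetric V}).
Hypothesis dimV : \dim {:V} = (n + 2)%N.
Variables (F0 : frame V n) (hF0 : adapted eta F0).
Variables (G : set 'End(V)) (hG : connected_lie_subgroup (SO eta) G).
Local Notation g := (lie_algebra G).
Local Notation L := (lobachevskian eta F0).
Implicit Types (F : frame V n) (u v w x y z : V) (f X Y : 'End(V)).

(* [[p /\ u, q /\ v], p /\ u] = |u|^2 (p /\ v) - 2 <u, v> (p /\ u)]. *)
Lemma lie_wedge_transfer F u v : adapted eta F ->
  eta (fr_p F) u = 0 -> eta (fr_q F) u = 0 ->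
  eta (fr_p F) v = 0 -> eta (fr_q F) v = 0 -> eta u u != 0 ->
  g (wedge eta (fr_p F) u) -> g (wedge eta (fr_q F) v) -> g (wedge eta (fr_p F) v).
Proof.
move=> hF pu qu pv qv uu gu gv.
set p := fr_p F in pu pv gu *; set q := fr_q F in qu qv gv *.
have pp : eta p p = 0 := eta_pp hF.
have qp : eta q p = 1 := eta_qp hF.
have h1 := lie_bracket hG gu gv.
rewrite wedge_bracket in h1; last exact: wedge_skew.
rewrite !wedgeE (etaC eta p q) qp (etaC eta u q) qu pv !scale0r scale1r subr0 add0r
  wedgeNr wedgeZr in h1.
have h2 := lie_bracket hG h1 gu.
rewrite wedge_bracket in h2; last first.
  apply: skew_add; first exact: wedge_skew.
  by rewrite -scaleNr; apply: skew_scale; exact: wedge_skew.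
have e1 : (wedge eta u v - eta u v *: wedge eta q p) p = - eta u v *: p.
  rewrite add_lfunE opp_lfunE scale_lfunE !wedgeE (etaC eta u p) pu (etaC eta v p) pv.
  by rewrite qp pp !scale0r subr0 sub0r subr0 scale1r scaleNr.
have e2 : (wedge eta u v - eta u v *: wedge eta q p) u = eta u u *: v - eta u v *: u.
  rewrite add_lfunE opp_lfunE scale_lfunE !wedgeE qu pu !scale0r subrr scaler0 subr0.
  by rewrite (etaC eta v u).
rewrite e1 e2 wedgeZl wedgeDr wedgeNr !wedgeZr in h2.
have -> : wedge eta p v = (eta u u)^-1 *: ((- eta u v *: wedge eta p u +
    (eta u u *: wedge eta p v - eta u v *: wedge eta p u)) +
    (2 * eta u v) *: wedge eta p u).
  rewrite (_ : 2 * eta u v = eta u v + eta u v); last by ring.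
  rewrite scalerDl scaleNr addrACA addNr add0r subrK.
  by rewrite scalerA mulVf// scale1r.
exact: (lie_Z hG _ (lie_D hG h2 (lie_Z hG _ gu))).
Qed.

Section AllWedges.
Variables (F : frame V n) (hF : adapted eta F).
Local Notation p := (fr_p F).
Local Notation q := (fr_q F).
Variable v : V.
Hypotheses (pv : eta p v = 0) (qv : eta q v = 0) (vv : eta v v != 0).
Hypotheses (gpv : g (wedge eta p v)) (gqv : g (wedge eta q v)).

(** The bracket of [p /\ v] and [q /\ v] is [<v, v> (p /\ q)]. *)
Let gpq : g (wedge eta p q).
Proof.
have h1 := lie_bracket hG gpv gqv.
rewrite wedge_bracket in h1; last exact: wedge_skew.
rewrite !wedgeE (eta_pq hF) (etaC eta v q) qv pv !scale0r scale1r subr0 add0r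
  wedgeNr wedgeZr wedge_id add0r wedgeC scalerN opprK in h1.
have -> : wedge eta p q = (eta v v)^-1 *: (eta v v *: wedge eta p q).
  by rewrite scalerA mulVf// scale1r.
exact: (lie_Z hG).
Qed.

Let gpz z : eta p z = 0 -> eta q z = 0 -> g (wedge eta q z) -> g (wedge eta p z).
Proof. exact: (fun pz qz => lie_wedge_transfer hF pv qv pz qz vv gpv). Qed.

Let gqz z : eta p z = 0 -> eta q z = 0 -> g (wedge eta p z) -> g (wedge eta q z).
Proof.
move=> pz qz.
exact: (lie_wedge_transfer (swap_adapted dimV hF) qv pv qz pz vv gqv).
Qed.

(** The component of [w] orthogonal to [p] and [q] is handled by [gqz]; the other components
    contribute only multiples of [p /\ q]. *)
Let gqw w : g (wedge eta p w) -> g (wedge eta q w).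
Proof.
move=> gw; set z := w - eta q w *: p - eta p w *: q.
have pz : eta p z = 0 by rewrite /z !eta_lin !(frE hF); ring.
have qz : eta q z = 0 by rewrite /z !eta_lin !(frE hF); ring.
have wE : w = z + eta q w *: p + eta p w *: q by rewrite /z addrAC !subrK.
have gz : g (wedge eta p z).
  rewrite /z !wedgeDr !wedgeNr !wedgeZr wedge_id scaler0 subr0.
  exact: (lie_B hG gw (lie_Z hG _ gpq)).
rewrite wE; clearbody z; rewrite !wedgeDr !wedgeZr wedge_id scaler0 addr0.
rewrite [wedge eta q p]wedgeC.
exact: (lie_D hG (gqz pz qz gz) (lie_Z hG _ (lie_N hG gpq))).
Qed.

(** The bracket of [p /\ w] and [q /\ w'] is [w /\ w'] plus multiples of [p /\ w'], [q /\ w] and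
    [q /\ p], which are all available. *)
Let gww w w' : g (wedge eta p w) -> g (wedge eta p w') -> g (wedge eta w w').
Proof.
move=> gw gw'; have gqw' := gqw gw'.
have h1 := lie_bracket hG gw gqw'.
rewrite wedge_bracket in h1; last exact: wedge_skew.
rewrite !wedgeE (eta_pq hF) scale1r wedgeDl wedgeNl wedgeZl wedgeDr wedgeNr !wedgeZr in h1.
have -> : wedge eta w w' = (wedge eta w w' - eta w q *: wedge eta p w' +
     (eta p w' *: wedge eta q w - eta w w' *: wedge eta q p)) +
     (eta w q *: wedge eta p w' - (eta p w' *: wedge eta q w - eta w w' *: wedge eta q p)).
  by rewrite addrACA subrK subrr addr0.
have gqp : g (wedge eta q p) by rewrite wedgeC; exact: (lie_N hG gpq).
apply: (lie_D hG h1); apply: (lie_B hG (lie_Z hG _ gw')).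
exact: (lie_B hG (lie_Z hG _ (gqw gw)) (lie_Z hG _ gqp)).
Qed.

Lemma lie_all_wedges : acts_transitively G L -> forall w w', g (wedge eta w w').
Proof.
move=> hT.
have [|||U UP] := @lin_closed_vspace R V [set w | g (wedge eta p w)].
- by rewrite /= wedge0r; exact: (lie_0 hG).
- by move=> x y /= gx gy; rewrite wedgeDr; exact: (lie_D hG gx gy).
- by move=> a x /= gx; rewrite wedgeZr; exact: (lie_Z hG _ gx).
suff UV w : w \in U by move=> w w'; apply: gww; exact/UP.
apply: (invariant_full dimV hF0 hG hT hF).
- by apply/UP; rewrite /= wedge_id; exact: (lie_0 hG).
- exact/UP.
move=> X {}w gX /UP gw; apply/UP => /=.
have sX := lie_skew dimV hF0 hG gX.
(* With [y], [x] the components of [X p], [X q] orthogonal to [p] and [q], the bracket of [X] with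
   [p /\ q] is [y /\ q + p /\ x]. A second bracket with [p /\ q] reverses only the first summand, so
   the difference isolates [q /\ y], which [gpz] turns into [p /\ y]. *)
have Xp : g (wedge eta p (X p)).
  set y := X p - eta q (X p) *: p; set x := X q - eta p (X q) *: q.
  have pXp : eta p (X p) = 0 by rewrite etaC; exact: skew_self.
  have qXq : eta q (X q) = 0 by rewrite etaC; exact: skew_self.
  have Xpq : eta p (X q) = - eta q (X p) by rewrite etaC sX.
  have py : eta p y = 0 by rewrite /y !eta_lin !(frE hF) pXp; ring.
  have qy : eta q y = 0 by rewrite /y !eta_lin !(frE hF); ring.
  have px : eta p x = 0 by rewrite /x !eta_lin !(frE hF); ring.
  have qx : eta q x = 0 by rewrite /x !eta_lin !(frE hF) qXq; ring.
  have XpE : X p = y + eta q (X p) *: p by rewrite subrK.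
  have XqE : X q = x - eta q (X p) *: q by rewrite -scaleNr -Xpq subrK.
  have h1 := lie_bracket hG gX gpq.
  rewrite (wedge_bracket _ _ sX) XpE XqE wedgeDl wedgeDr wedgeNr wedgeZl wedgeZr in h1.
  rewrite addrACA subrr addr0 in h1.
  have h2 := lie_bracket hG h1 gpq.
  rewrite wedge_bracket in h2; last by apply: skew_add; exact: wedge_skew.
  rewrite !add_lfunE !wedgeE !(frE hF) (etaC eta y p) py (etaC eta x p) px
    (etaC eta y q) qy (etaC eta x q) qx !scale0r !scale1r !subr0 !add0r !addr0 in h2.
  have h3 := lie_B hG h2 h1.
  rewrite wedgeNl (wedgeC _ y q) opprK opprD opprK addrACA subrr addr0 in h3.
  have gy : g (wedge eta q y).
    have -> : wedge eta q y = 2^-1 *: (wedge eta q y + wedge eta q y).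
      by rewrite scalerDr -scalerDl (_ : 2^-1 + 2^-1 = 1) ?scale1r//; lra.
    exact: (lie_Z hG _ h3).
  rewrite XpE wedgeDr wedgeZr wedge_id scaler0 addr0.
  exact: (gpz py qy gy).
(* In [[X, p /\ w] = X p /\ w + p /\ X w] the first summand is in the algebra by [gww]. *)
have h1 := lie_bracket hG gX gw; rewrite (wedge_bracket _ _ sX) in h1.
have -> : wedge eta p (X w) = (wedge eta (X p) w + wedge eta p (X w)) - wedge eta (X p) w.
  by rewrite addrC addKr.
exact: (lie_B hG h1 (gww Xp gw)).
Qed.
End AllWedges.

(* If the nilpotent parts of all [d0 X d0^-1] vanish, then all of them have [q]
   as an eigenvector. *)
Lemma nilpotent_or_line : acts_transitively G L ->
  (exists v, [/\ v != 0, eta v v = 0 & forall X, g X -> exists a, X v = a *: v]) \/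
  exists x, [/\ x != 0, eta (fr_p F0) x = 0, eta (fr_q F0) x = 0
              & g (wedge eta (fr_p F0) x)].
Proof.
move=> hT; set p := fr_p F0; set q := fr_q F0.
have [c [c0 Lo]] := exists_L dimV hF0 hF0.
have k0 k : (k.+1%:R : R) != 0 by rewrite pnatr_eq0.
have Ai k := A_elt_isometry dimV hF0 (k0 k).
have H k : exists f : 'End(V), G f /\ f (c *: (p - q)) = A_elt F0 k.+1%:R (c *: (p - q)).
  apply: hT.2 => //; apply/(lobachevskianE dimV _ hF0); split.
    by rewrite Ai (L_norm dimV hF0 Lo).
  have [-> _ _] := A_eltE dimV hF0 k.+1%:R (c *: (p - q)).
  rewrite pmulr_rlt0 ?invr_gt0//.
  by have /(lobachevskianE dimV _ hF0)[] := Lo.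
have [f fP] := choice H.
pose d k := ((A_elt F0 k.+1%:R)^-1 \o f k)%VF.
have di k : end_isometry eta (d k).
  apply: isometry_comp; first exact: (isometry_inv dimV hF0).
  exact: (G_iso hG (fP k).1).
have dpq k : d k (p - q) = p - q.
  apply: (scalerI c0); rewrite -lfunZ comp_lfunE (fP k).2.
  by rewrite (isometry_Vf dimV hF0).
have Ad k : (A_elt F0 k.+1%:R \o d k)%VF = f k.
  by rewrite /d comp_lfunA (isometry_compfV dimV hF0)// comp_lfun1l.
have [|d0 [d0i _ d0g]] := limit_nil_part dimV hG hF0 di dpq.
  by move=> k; rewrite Ad; exact: (fP k).1.
have [[X [gX nX]]|all0] := pselect (exists X, g X /\
  (d0 \o X \o d0^-1)%VF q - eta p ((d0 \o X \o d0^-1)%VF q) *: q != 0).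
  right; exists ((d0 \o X \o d0^-1)%VF q - eta p ((d0 \o X \o d0^-1)%VF q) *: q).
  split; [exact: nX | | | exact: (d0g X gX)].
    by rewrite !eta_lin (eta_pq hF0); ring.
  rewrite !eta_lin (eta_qq hF0) mulr0 subr0 !comp_lfunE -(isometry_adj dimV hF0)//.
  by rewrite etaC; apply: skew_self; exact: (lie_skew dimV hF0 hG).
left; exists ((d0^-1)%VF q); split.
- apply/eqP => q0; have := isometry_fVK dimV hF0 q d0i; rewrite q0 lfun0 => /esym/eqP.
  by rewrite (negbTE (p_neq0 (swap_adapted dimV hF0))).
- by rewrite (isometry_inv dimV hF0 d0i) (eta_qq hF0).
move=> X gX; exists (eta p ((d0 \o X \o d0^-1)%VF q)).
apply/eqP; rewrite -subr_eq0; apply/eqP.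
apply: (lker0P (isometry_lker dimV hF0 d0i)).
rewrite lfun0 lfunD lfunN lfunZ (isometry_fVK dimV hF0)//.
apply: contrapT => H0; apply: all0; exists X; split=> //.
by rewrite [X in X - _]comp_lfunE comp_lfunE; apply/eqP.
Qed.

Lemma line_or_all_wedges : acts_transitively G L ->
  (exists v, [/\ v != 0, eta v v = 0 & forall f, G f -> exists a, f v = a *: v]) \/
  forall u v, g (wedge eta u v).
Proof.
move=> hT; have [[v [v0 vv gv]]|[x [x0 px qx gx]]] := nilpotent_or_line hT.
  left; exists v; split=> // f Gf.
  suff : f v \in <[v]>%VS by move=> /vlineP.
  apply: (G_invariant hG) => //; last exact: memv_line.
  move=> X _ gX /vlineP[a ->]; have [b Xb] := gv X gX.
  by rewrite lfunZ Xb; apply/memvZ/memvZ/memv_line.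
set p := fr_p F0 in px gx.
have [Gp|/existsNP[f /not_implyP[Gf nf]]] :=
    pselect (forall f, G f -> exists a, f p = a *: p).
  by left; exists p; split=> //; [exact: (p_neq0 hF0) | exact: (eta_pp hF0)].
right; have fi := G_iso hG Gf; set p' := f p in nf.
have pp' : eta p' p' = 0 by rewrite fi (eta_pp hF0).
have b0 : eta p p' != 0.
  apply/eqP => b0; apply: nf; exists (eta (fr_q F0) p').
  exact: (isotropic_perp_p dimV hF0).
(* The moved line is not orthogonal to [p], so a multiple of [p'] completes [p] to a hyperbolic
   pair; conjugating [p /\ x] by [f] gives a wedge with this [q]. *)
set q := (eta p p')^-1 *: p'.
have qq : eta q q = 0 by rewrite !eta_lin pp' !mulr0.
have pq : eta p q = 1 by rewrite !eta_lin mulVf.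
have hF := move_q_adapted dimV hF0 qq pq.
have gfx : g (wedge eta p' (f x)).
  rewrite -(wedge_conj _ _ fi (isometry_compfV dimV hF0 fi)).
  exact: (lie_conj dimV hF0 hG Gf gx).
have xx : eta x x != 0.
  apply: contra x0 => /eqP xx; rewrite (isotropic_perp_p dimV hF0 px xx) qx.
  by rewrite scale0r.
have pp : eta p p = 0 := eta_pp hF0.
have qfx : eta q (f x) = 0 by rewrite eta_lin fi px mulr0.
have gqfx : g (wedge eta q (f x)) by rewrite wedgeZl; exact: (lie_Z hG _ gfx).
(* These corrections change neither [p /\ x], nor [q /\ f x], nor the norms of [x] and [f x], but
   make both vectors orthogonal to [p] and [q]. *)
clearbody q; pose v := f x - eta p (f x) *: q; pose u := x - eta q x *: p.
have pv : eta p v = 0 by rewrite /v !eta_lin pq; ring.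
have qv : eta q v = 0 by rewrite /v !eta_lin qq qfx; ring.
have pu : eta p u = 0 by rewrite /u !eta_lin pp px; ring.
have qu : eta q u = 0 by rewrite /u !eta_lin (etaC eta q p) pq; ring.
have uu : eta u u != 0.
  rewrite (_ : eta u u = eta x x)//.
  by rewrite /u !eta_lin pp px (etaC eta x p) px; ring.
have vv : eta v v != 0.
  rewrite (_ : eta v v = eta x x)//.
  by rewrite /v !eta_lin qq qfx (etaC eta (f x) q) qfx fi; ring.
have gu : g (wedge eta p u).
  by rewrite /u wedgeDr wedgeNr wedgeZr wedge_id scaler0 subr0.
have gv : g (wedge eta q v).
  rewrite /v wedgeDr wedgeNr wedgeZr wedge_id scaler0 subr0.
  exact: gqfx.
have gpv : g (wedge eta p v) by exact: (lie_wedge_transfer hF pu qu pv qv uu gu gv).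
exact: (lie_all_wedges hF pv qv vv gpv gv hT).
Qed.

End Irreducible.

(** * Rotations generated by wedges and the identity component of [SO(V)] *)

Section Rotations.
Context {R : realType} {V : vectType R} {n : nat} (eta : {symmetric V}).
Hypothesis dimV : \dim {:V} = (n + 2)%N.
Variables (F0 : frame V n) (hF0 : adapted eta F0).
Variables (G : set 'End(V)) (hG : connected_lie_subgroup (SO eta) G).
Local Notation g := (lie_algebra G).
Local Notation L := (lobachevskian eta F0).
Implicit Types (u v w x y z : V) (f X Y : 'End(V)).

(** Rodrigues' formula: [J^3 = - J] makes the right-hand side solve the differential equation of the
    exponential. *)
Lemma exp_wedge_rotation u w t : eta u u = 1 -> eta w w = 1 -> eta u w = 0 ->
  end_exp (t *: wedge eta u w) =
    \1%VF + sin t *: wedge eta u w +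
    (1 - cos t) *: (wedge eta u w \o wedge eta u w)%VF.
Proof.
move=> uu ww uw; set J := wedge eta u w.
have J3 : (J \o (J \o J) = - J)%VF.
  apply/lfunP => z; rewrite opp_lfunE !comp_lfunE !wedgeE !eta_lin.
  by rewrite uu ww uw (etaC eta w u) uw !mulr1 !mulr0 !subr0 !sub0r !scaleNr opprK opprB addrC.
rewrite -(@end_exp_unique _ _ J (fun t => \1%VF + sin t *: J + (1 - cos t) *: (J \o J)%VF))//.
  by rewrite sin0 cos0 subrr !scale0r !addr0.
move=> s.
have -> : (J \o (\1 + sin s *: J + (1 - cos s) *: (J \o J)))%VF =
    cos s *: J + sin s *: (J \o J)%VF.
  rewrite !comp_lfunDr -!comp_lfunZr J3 comp_lfun1r scalerN scalerBl scale1r.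
  by rewrite opprB addrAC addrCA subrr addr0.
move: J3 => _ i j; rewrite /end_mx.
have E t' : mx_in (vbasis {:V}) (\1%VF + sin t' *: J + (1 - cos t') *: (J \o J)%VF) i j =
   mx_in (vbasis {:V}) \1%VF i j + sin t' * mx_in (vbasis {:V}) J i j
   + (1 - cos t') * mx_in (vbasis {:V}) (J \o J)%VF i j.
  by rewrite !linearD !linearZ ![(_ + _ : 'M[R]_(\dim {:V})) i j]mxE
    ![(_ *: _ : 'M[R]_(\dim {:V})) i j]mxE.
under eq_fun do rewrite E.
rewrite linearD !linearZ /= ![(_ + _ : 'M[R]_(\dim {:V})) i j]mxE
    ![(_ *: _ : 'M[R]_(\dim {:V})) i j]mxE.
move: (mx_in _ \1%VF i j) (mx_in _ J i j) (mx_in _ (J \o J)%VF i j) => a b c.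
by apply: is_derive_eq; rewrite /GRing.scale /=; ring.
Qed.

Lemma rotation_apply u w t : eta u u = 1 -> eta w w = 1 -> eta u w = 0 ->
  end_exp (t *: wedge eta u w) u = cos t *: u + sin t *: w.
Proof.
move=> uu ww uw; rewrite exp_wedge_rotation// !add_lfunE !scale_lfunE id_lfunE comp_lfunE.
have -> : wedge eta u w u = w by rewrite wedgeE uu (etaC eta w) uw scale1r scale0r subr0.
have -> : wedge eta u w w = - u by rewrite wedgeE uw ww scale1r scale0r sub0r.
by rewrite scalerN scalerBl scale1r opprB addrC addrA subrK.
Qed.

Lemma rotation_fix u w t z : eta u z = 0 -> eta w z = 0 ->
  end_exp (t *: wedge eta u w) z = z.
Proof.
move=> uz wz; rewrite (@end_exp_eigen _ _ _ _ 0) ?expR0 ?scale1r//.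
by rewrite scale_lfunE wedgeE uz wz !scale0r subrr scaler0.
Qed.

Lemma eta_coordv m (b : m.-tuple V) v w : basis_of {:V} b ->
  eta v w = ((coordv b v)^T *m (\matrix_(i, j) eta b`_i b`_j) *m coordv b w) 0 0.
Proof.
move=> hb; rewrite -{1}[v](coordvK hb) -{1}[w](coordvK hb) -mulmxA mxE eta_suml.
apply: eq_bigr => i _; rewrite etaZl eta_sumr [X in _ = X * _]mxE; congr (_ * _).
rewrite [RHS]mxE; apply: eq_bigr => j _; rewrite etaZr mulrC; congr (_ * _).
by rewrite mxE.
Qed.

(** Skewness says that the Gram matrix intertwines [M] with [- M^T], hence [exp M] with the
    transpose of [exp(- M)]. *)
Lemma skew_exp_isometry X : skew_end eta X -> end_isometry eta (end_exp X).
Proof.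
move=> sX v w; have hb := vbasisP {:V}.
set b := vbasis {:V} in hb; set M := mx_in b X.
pose B : 'M[R]_(\dim {:V}) := \matrix_(i, j) eta b`_i b`_j.
have BM : B *m M = (- M^T) *m B.
  apply/matrixP => i j; rewrite mulNmx mxE [RHS]mxE.
  have := sX b`_i b`_j; rewrite -{1}[X b`_i](coordvK hb) -{1}[X b`_j](coordvK hb).
  rewrite eta_suml eta_sumr => H.
  rewrite -[LHS]opprK; congr (- _).
  transitivity (- \sum_k eta b`_i (coordv b (X b`_j) k 0 *: b`_k)).
    by congr (- _); apply: eq_bigr => k _; rewrite !mxE etaZr mulrC.
  rewrite -H mxE; apply: eq_bigr => k _; by rewrite etaZl !mxE.
rewrite !(@eta_coordv _ b)// !mx_in_coordv// mx_in_exp// -/M -/B.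
rewrite trmx_mul -!mulmxA [B *m (_ *m _)]mulmxA (expmx_intertwine BM).
rewrite -linearN /= expmx_tr !mulmxA -(mulmxA _ (expmx M)^T) -trmx_mul expmxNl.
by rewrite trmx1 mulmx1.
Qed.

(** Invariance of the nondegenerate Gram matrix gives determinant 1 or -1, and exponentials have
    positive determinant. *)
Lemma skew_exp_SO X : skew_end eta X -> SO eta (end_exp X).
Proof.
move=> sX; split; first exact: skew_exp_isometry.
have i := skew_exp_isometry sX.
have hb := fr_basisP hF0.
set f := end_exp X in i *.
pose B : 'M[R]_(1 + (n + 1)) := \matrix_(i, j) eta (fr_basis F0)`_i (fr_basis F0)`_j.
have d2 : end_det f ^+ 2 * \det B = \det B.
  have E : (mx_in (fr_basis F0) f)^T *m B *m mx_in (fr_basis F0) f = B.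
    apply/matrixP => k l.
    have entry (A : 'M[R]_(1 + (n + 1))) :
        A k l = (delta_mx (0 : 'I_1) k *m A *m delta_mx l (0 : 'I_1)) 0 0.
      by rewrite -rowE -colE !mxE.
    rewrite entry [RHS]mxE -i (@eta_coordv _ (fr_basis F0))// !mx_in_col -/B !colE.
    by rewrite trmx_mul trmx_delta !mulmxA.
  by rewrite -[in RHS]E !det_mulmx det_tr (end_det_mx_in _ hb) expr2 mulrAC.
have B0 : \det B != 0.
  apply/eqP => /eqP/det0P[r r0 rB]; move/eqP: r0; apply.
  pose v := \sum_i r 0 i *: (fr_basis F0)`_i.
  have v0 : v = 0.
    apply: (eta_nondeg dimV hF0) => w; rewrite (@eta_coordv _ (fr_basis F0))//.
    rewrite (_ : (coordv (fr_basis F0) v)^T = r) ?rB ?mul0mx ?mxE//.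
    have -> : v = \sum_i (r^T) i 0 *: (fr_basis F0)`_i.
      by apply: eq_bigr => k _; rewrite mxE.
    by rewrite coordv_sum// trmxK.
  have : coordv (fr_basis F0) v = r^T.
    have -> : v = \sum_i (r^T) i 0 *: (fr_basis F0)`_i.
      by apply: eq_bigr => k _; rewrite mxE.
    by rewrite coordv_sum.
  by rewrite v0 linear0 => /(congr1 trmx); rewrite trmx0 trmxK.
have {}d2 : end_det f ^+ 2 = 1 by apply: (mulIf B0); rewrite d2 mul1r.
have d0 : 0 < end_det f by exact: end_exp_det_gt0.
by apply/eqP; rewrite -(@eqrXn2 _ 2)// ?ler01 ?(ltW d0)// d2 expr1n.
Qed.

Lemma end_det_eigenbasis m (b : m.-tuple V) (d : 'I_m -> R) f :
  basis_of {:V} b -> (forall j : 'I_m, f b`_j = d j *: b`_j) -> end_det f = \prod_j d j.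
Proof.
move=> hb fb; rewrite (end_det_mx_in _ hb).
have -> : mx_in b f = diag_mx (\row_j d j).
  apply/matrixP => i j; rewrite !mxE fb linearZ /= coord_free ?(basis_free hb)//.
  by rewrite eq_sym; case: eqP => [->|_]; rewrite ?mulr1 ?mulr0 ?mulr1n ?mulr0n.
by rewrite det_diag; apply: eq_bigr => j _; rewrite mxE.
Qed.

Section Full.
Hypothesis hT : acts_transitively G L.
Hypothesis all_wedge : forall u v, g (wedge eta u v).

(** The rotation takes place in the plane of [a] and [b]. If [b = a] or [b = - a] there is no such
    plane, and [w0] supplies one. *)
Lemma exists_rotation o a b w0 :
  (forall z, eta o z = 0 -> 0 <= eta z z ?= iff (z == 0)) ->
  eta a a = 1 -> eta b b = 1 -> eta o a = 0 -> eta o b = 0 ->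
  eta w0 w0 = 1 -> eta a w0 = 0 ->
  exists f, [/\ G f, f a = b &
    forall z, eta a z = 0 -> eta b z = 0 -> eta w0 z = 0 -> f z = z].
Proof.
move=> opos aa bb oa ob w0w0 aw0.
pose c := eta a b; pose z := b - c *: a.
have oz : eta o z = 0 by rewrite /z !eta_lin oa ob; ring.
have az : eta a z = 0 by rewrite /z !eta_lin aa -/c; ring.
have zz : eta z z = 1 - c ^+ 2.
  by rewrite /z !eta_lin aa bb (etaC eta b a) -/c; ring.
have [z_ge z_eq] := opos _ oz.
have c1 : c ^+ 2 <= 1 by move: z_ge; rewrite zz subr_ge0.
have cI : -1 <= c <= 1.
  by rewrite -ler_norml -(@ler_pXn2r _ 2)// ?nnegrE// expr1n real_normK ?num_real.
have Gexp u w t : G (end_exp (t *: wedge eta u w)) by apply: all_wedge.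
have [z0|z0] := eqVneq z 0.
  have bE : b = c *: a by apply/eqP; rewrite -subr_eq0 -/z z0.
  have cc : c ^+ 2 = 1 by move: zz; rewrite z0 eta0l; lra.
  exists (end_exp (acos c *: wedge eta a w0)); split=> //.
    rewrite rotation_apply// acosK ?in_itv//= sin_acos// cc subrr sqrtr0 scale0r addr0.
    by rewrite bE.
  by move=> x ax _ wx; apply: rotation_fix.
have zz0 : 0 < eta z z by rewrite lt_neqAle z_ge andbT z_eq z0.
set r := Num.sqrt (1 - c ^+ 2).
have r0 : 0 < r by rewrite sqrtr_gt0 -zz.
have rr : r ^+ 2 = eta z z by rewrite sqr_sqrtr -?zz// ltW.
pose w := r^-1 *: z.
have ww : eta w w = 1 by rewrite /w etaZl etaZr -rr; field; rewrite gt_eqF.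
have aw : eta a w = 0 by rewrite /w etaZr az mulr0.
exists (end_exp (acos c *: wedge eta a w)); split=> //.
  rewrite rotation_apply// acosK ?in_itv//= sin_acos// -/r /w scalerA mulfV ?gt_eqF//.
  by rewrite scale1r /z addrC subrK.
move=> x ax bx _; apply: rotation_fix => //.
by rewrite /w /z !eta_lin ax bx; ring.
Qed.

(** Transitivity provides an element of [G] agreeing with [f] at one point [o]. Dividing by it
    leaves an isometry fixing [o], which acts on the Euclidean space [o^perp]. *)
Lemma SO_L_sub f : SO eta f -> (forall x, L x -> L (f x)) -> G f.
Proof.
move=> [fi fd] fL; have [c [c0 Lo]] := exists_L dimV hF0 hF0.
set p := fr_p F0 in Lo; set q := fr_q F0 in Lo; set o := c *: (p - q) in Lo.
have [g0 [Gg0 g0o]] := hT.2 _ _ Lo (fL _ Lo).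
have pp : eta p p = 0 := eta_pp hF0. have qq : eta q q = 0 := eta_qq hF0.
have pq : eta p q = 1 := eta_pq hF0. have qp : eta q p = 1 := eta_qp hF0.
have oE z : eta o z = c * (eta p z - eta q z) by rewrite /o !eta_lin; ring.
have opos z : eta o z = 0 -> 0 <= eta z z ?= iff (z == 0).
  rewrite oE => /eqP; rewrite mulf_eq0 (negbTE c0) /= subr_eq0 => /eqP pqz.
  have S0 : 0 <= \sum_(i < n) eta (fr_e F0)`_i z * eta (fr_e F0)`_i z.
    by apply: sumr_ge0 => i _; exact: sqr_ge0.
  have E : eta z z = 2 * eta q z ^+ 2
      + \sum_(i < n) eta (fr_e F0)`_i z * eta (fr_e F0)`_i z.
    by rewrite (eta_frame dimV hF0 z z) -/p -/q pqz; ring.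
  have q0 := sqr_ge0 (eta q z).
  split; first by rewrite E; lra.
  apply/eqP/eqP => [/esym zz|->]; last by rewrite eta0l.
  have q1 : eta q z = 0 by apply/eqP; rewrite -sqrf_eq0; apply/eqP; lra.
  apply: (frame_ext dimV hF0); rewrite ?eta0r -/p -/q ?pqz// => i.
  rewrite eta0r; move: zz; rewrite E q1 expr0n mulr0 add0r => /psumr_eq0P H.
  apply/eqP; rewrite -sqrf_eq0 expr2; apply/eqP; apply: H => // j _; exact: sqr_ge0.
pose s : R := Num.sqrt 2 / 2.
have s0 : 0 < s by rewrite /s divr_gt0// sqrtr_gt0.
have ss : s * s = 2^-1 by rewrite /s mulrACA -expr2 sqr_sqrtr//; field.
(* The default of [nth] is part of the data: index [n], just past the [e_i], gives the last vector
   of the orthonormal basis of [o^perp]. *)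
pose r i : V := nth (s *: (p + q)) (fr_e F0) i.
have re (i : 'I_n) : r i = (fr_e F0)`_i by apply: set_nth_default; rewrite size_tuple.
have rn : r n = s *: (p + q) by rewrite /r nth_default// size_tuple.
have rcases i : (i <= n)%N -> (exists i' : 'I_n, i = i' /\ r i = (fr_e F0)`_i') \/
    (i = n /\ r i = s *: (p + q)).
  rewrite leq_eqVlt => /orP[/eqP->|lt]; [by right|left].
  by exists (Ordinal lt); rewrite -re.
have ror i : (i <= n)%N -> eta o (r i) = 0.
  move=> /rcases[[i' [_ ->]]|[_ ->]]; rewrite oE; first by rewrite !(frE hF0); ring.
  by rewrite !eta_lin pp qq pq qp; ring.
have rr i j : (i <= n)%N -> (j <= n)%N -> eta (r i) (r j) = (i == j)%:R.
  move=> /rcases[[i' [-> ->]]|[-> ->]] /rcases[[j' [-> ->]]|[-> ->]].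
  - by rewrite (frE hF0).
  - by rewrite !eta_lin !(frE hF0) (ltn_eqF (ltn_ord _)) mulr0n; ring.
  - by rewrite !eta_lin !(frE hF0) eq_sym (ltn_eqF (ltn_ord _)) mulr0n; ring.
  - by rewrite eqxx !eta_lin pp qq pq qp mulr1n; lra.
(* [f] is brought to the identity by rotating the orthonormal basis [r] of [o^perp]
   back one vector at a time; the last vector is settled by [det f = 1]. *)
suff main m h : (m <= n)%N -> SO eta h -> h o = o ->
    (forall i, (i < n - m)%N -> h (r i) = r i) -> G h.
  pose h := (g0^-1 \o f)%VF.
  have g0i := G_iso hG Gg0.
  have -> : f = (g0 \o h)%VF.
    by rewrite /h comp_lfunA (isometry_compfV dimV hF0)// comp_lfun1l.
  apply: (G_comp hG) => //; apply: (main n) => //.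
  - split; first by apply: isometry_comp => //; exact: (isometry_inv dimV hF0).
    by rewrite /h end_det_comp fd (G_det hG (G_inv hG Gg0)) mulr1.
  - by rewrite /h comp_lfunE -g0o (isometry_Vf dimV hF0).
  - by rewrite subnn.
elim: m h => [|m IH] h mn [hi hd] ho hr.
  (* Now [p - q] and all [e_i] are fixed, so [p + q] is an eigenvector, and its eigenvalue [l]
     equals the determinant. *)
  rewrite subn0 in hr.
  have hpq : h (p - q) = p - q by apply: (scalerI c0); rewrite -lfunZ ho.
  have he (i : 'I_n) : h (fr_e F0)`_i = (fr_e F0)`_i by rewrite -re hr.
  have hrn : h (p + q) = eta q (h (p + q)) *: (p + q).
    apply: (frame_ext dimV hF0) => [||i].
    - have : eta (p - q) (h (p + q)) = 0.
        by rewrite -{1}hpq hi !eta_lin pp qq pq qp; ring.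
      by rewrite etaZr !eta_lin -/p -/q pp pq; lra.
    - by rewrite etaZr !eta_lin -/p -/q qq qp; ring.
    by rewrite -{1}he hi etaZr !eta_lin !(frE hF0); ring.
  pose l := eta q (h (p + q)); rewrite -/l in hrn.
  have [|||||||hb _] := @tuple3_dual _ _ _ eta dimV (p - q) (p + q)
      (2^-1 *: (q - p)) (2^-1 *: (p + q)) (fr_e F0) (fr_e F0).
  - by rewrite !eta_lin pp qq pq qp; field.
  - by rewrite !eta_lin pp qq pq qp; field.
  - by rewrite !eta_lin pp qq pq qp; field.
  - by rewrite !eta_lin pp qq pq qp; field.
  - by move=> i j; rewrite (frE hF0).
  - by move=> i; rewrite !eta_lin !(frE hF0); split; field.
  - by move=> i; rewrite !eta_lin !(frE hF0); split; ring.
  pose d (i : 'I_(1 + (n + 1))) : R := if i == rshift 1 (rshift n ord0) then l else 1.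
  have hd' : end_det h = \prod_j d j.
    apply: (end_det_eigenbasis hb); apply: ord3_ind => [|i|]; rewrite ?tuple3E /d.
    - by rewrite eq_lrshift scale1r.
    - by rewrite (inj_eq (@rshift_inj _ _)) eq_lrshift scale1r.
    - by rewrite eqxx.
  have l1 : l = 1.
    rewrite -hd hd' (bigD1 (rshift 1 (rshift n ord0)))//= {1}/d eqxx big1 ?mulr1//.
    by move=> i /negbTE ni; rewrite /d ni.
  have -> : h = \1%VF.
    apply: (mx_in_inj hb); rewrite mx_in1//; apply/matrixP => i j; rewrite !mxE.
    rewrite (_ : h _ = (tuple3 (p - q) (fr_e F0) (p + q))`_j).
      by rewrite coord_free ?(basis_free hb)// eq_sym.
    move: j; apply: ord3_ind => [|k|]; rewrite ?tuple3E//.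
    by rewrite hrn l1 scale1r.
  exact: (G_1 hG).
(* [k] is the first index not known to be fixed. As [k < n], the vector [h (r k.+1)] exists; it is
   orthogonal to [h (r k)] and to the vectors already fixed, so it can play the role of [w0]. *)
set k := (n - m.+1)%N; have kn : (k < n)%N.
  by rewrite /k; case: (n) mn => // n' _; rewrite subSS ltnS leq_subr.
have kE : (n - m)%N = k.+1 by rewrite /k subnSK.
have aa : eta (h (r k)) (h (r k)) = 1 by rewrite hi rr ?eqxx// ltnW.
have oh x : eta o (h x) = eta o x by rewrite -{1}ho hi.
have [|||||f' [Gf' f'k f'z]] := @exists_rotation o (h (r k)) (r k) (h (r k.+1)) opos aa.
- by rewrite rr ?eqxx// ltnW.
- by rewrite oh ror// ltnW.
- by rewrite ror// ltnW.
- by rewrite hi rr ?eqxx.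
- by rewrite hi rr// ?(ltnW kn)// (ltn_eqF (ltnSn k)).
have hf' : G (f' \o h)%VF.
  apply: IH; first exact: ltnW.
  - split; first by apply: isometry_comp => //; exact: (G_iso hG).
    by rewrite end_det_comp hd (G_det hG Gf') mulr1.
  - rewrite comp_lfunE ho f'z//; rewrite ![eta _ o]etaC ?oh ror// ltnW//.
  - move=> i; rewrite kE ltnS leq_eqVlt => /orP[/eqP->|ik]; first by rewrite comp_lfunE f'k.
    rewrite comp_lfunE hr//; apply: f'z.
    + by rewrite -(hr _ ik) hi rr ?(gtn_eqF ik)// ltnW// (ltn_trans ik).
    + by rewrite rr ?(gtn_eqF ik)// ltnW// (ltn_trans ik).
    + by rewrite -(hr _ ik) hi rr ?(gtn_eqF (ltnW _))// ltnW// (ltn_trans ik).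
have -> : h = (f'^-1 \o (f' \o h))%VF.
  by rewrite comp_lfunA (isometry_compVf dimV hF0 (G_iso hG Gf')) comp_lfun1l.
by apply: (G_comp hG) => //; exact: (G_inv hG).
Qed.

(** For [x] in [L], the continuous function [eta (f x) x] never vanishes on [SO(V)], since [f x]
    lies on one of the two sheets; being negative at the identity, it stays negative on the
    connected component. *)
Lemma SO0_preserves_L f : SO0 eta f -> SO eta f /\ (forall x, L x -> L (f x)).
Proof.
have hv := vbasisP {:V}.
have emI : injective (@end_mx R V) by apply: mx_in_inj.
case=> C [C1 CSO Cc] Cf.
have Sf : SO eta f by have [f' Sf' /emI <-] := CSO _ Cf.
split=> // x Lx.
pose h (M : 'M[R]_(\dim {:V})) := eta (end_in (vbasis {:V}) M x) x.
have hE f' : h (end_mx f') = eta (f' x) x by rewrite /h mx_inK.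
have hc : connected (h @` C).
  apply: connected_continuous_connected => //; apply: continuous_subspaceT.
  have -> : h = fun M => \sum_(i < \dim {:V}) \sum_(j < \dim {:V}) (coordv (vbasis {:V}) x j 0 *
      eta (vbasis {:V})`_i x) * M i j.
    apply/funext => M; rewrite /h -{1}[end_in _ _ _](coordvK hv) eta_suml.
    apply: eq_bigr => i _; rewrite etaZl coordv_end_in// [(_ *m _) i 0]mxE mulr_suml.
    by apply: eq_bigr => j _; ring.
  apply: continuous_big => [|i _]; first exact: add_continuous.
  apply: continuous_big => [|j _ M]; first exact: add_continuous.
  have H := @coord_continuous R (\dim {:V}) (\dim {:V}) i j M.
  exact: (@cvgMl_tmp _ _ _ (nbhs_filter M) _ _ _ H).
have hneg M : C M -> h M != 0.
  move=> /CSO[f' [f'i _] <-]; rewrite hE etaC.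
  have fx : eta (f' x) (f' x) = -1 by rewrite f'i (L_norm dimV hF0 Lx).
  have [/(L_eta_lt0 dimV hF0 Lx)|/(L_eta_lt0 dimV hF0 Lx)] := hyperboloid_sheet dimV hF0 fx.
    by move/lt_eqF->.
  by rewrite etaNr oppr_lt0 => /gt_eqF->.
have h1 : h (end_mx \1%VF) < 0.
  by rewrite hE id_lfunE (L_norm dimV hF0 Lx); lra.
have hf : h (end_mx f) < 0.
  rewrite ltNge; apply/negP => h0.
  have [] // : (h @` C) 0.
    have I1 : (h @` C) (h (end_mx \1%VF)) by exists (end_mx \1%VF).
    have If : (h @` C) (h (end_mx f)) by exists (end_mx f).
    by move/connected_intervalP: hc => /(_ _ _ I1 If); apply; rewrite h0 (ltW h1).
  by move=> M CM hM; have := hneg _ CM; rewrite hM eqxx.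
apply: (L_of_eta_lt0 dimV hF0 Lx); last by rewrite etaC -hE.
by rewrite Sf.1 (L_norm dimV hF0 Lx).
Qed.

Lemma exp_path_continuous X f : continuous (fun t : R => end_mx (end_exp (t *: X) \o f)%VF).
Proof.
have hv := vbasisP {:V}.
move=> t; apply: cvg_mx_entries => i j.
have E s : end_mx (end_exp (s *: X) \o f)%VF i j =
   \sum_k expmx (s *: end_mx X) i k * end_mx f k j.
  by rewrite /end_mx mx_in_comp// mxE mx_in_exp// linearZ.
suff H : forall h : R -> R,
    (forall s, h s = \sum_k expmx (s *: end_mx X) i k * end_mx f k j) ->
    h s @[s --> t] --> h t by exact: (H _ E).
move=> h /funext->.
apply: cvg_big => [|k _]; first exact: add_continuous.
apply: cvgMr_tmp.
have [D _] := expmx_derive (end_mx X) t i k.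
by have /derivable1_diffP/differentiable_continuous := D.
Qed.

Lemma G_sub_SO0 f : G f -> SO0 eta f.
Proof.
move=> Gf; suff [] : G f /\ SO0 eta f by [].
have sG h : G h -> SO eta h by case: hG => + _ _ _; apply.
move: f Gf; apply: (G_ind hG) => [|X f gX [Gf IH]].
  split; first exact: (G_1 hG).
  by apply: connected_component_refl; exists \1%VF => //; apply/sG/(G_1 hG).
split; first by apply: (G_comp hG) => //; exact: (lie_exp gX).
apply: (connected_component_trans IH).
pose B := (fun t : R => end_mx (end_exp (t *: X) \o f)%VF) @` setT.
have cB : connected B.
  apply: connected_continuous_connected.
    by apply/connected_intervalP => x y _ _ z _.
  by apply: continuous_subspaceT; exact: exp_path_continuous.
apply: (@connected_component_max _ _ B) => //.
- by exists 0 => //; rewrite scale0r end_exp0 comp_lfun1l.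
- move=> _ [t _ <-]; exists (end_exp (t *: X) \o f)%VF => //.
  by apply: sG; apply: (G_comp hG) => //; exact: gX.
- by exists 1; [|rewrite scale1r].
Qed.

Lemma all_wedge_SO0 : G = SO0 eta.
Proof.
apply/seteqP; split=> f.
  exact: G_sub_SO0.
by move=> /SO0_preserves_L[Sf Lf]; exact: SO_L_sub.
Qed.

End Full.
End Rotations.

(** Pairing with a basis of [U] is injective on [U] by anisotropy, hence maps [U] onto the
    coordinate space; so some [u] in [U] has the same pairings as [b]. *)
Lemma form_projection (R : realType) (W : vectType R) (U : {vspace W})
    (phi : W -> W -> R) :
  (forall y, scalar (phi^~ y)) ->
  (forall u, u \in U -> phi u u = 0 -> u = 0) ->
  (forall x, scalar (phi x)) ->
  forall b, exists2 u, u \in U & forall y, y \in U -> phi (b - u) y = 0.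
Proof.
move=> philin pos phirin b.
pose h x : 'rV[R]_(\dim U) := \row_i phi x (vbasis U)`_i.
have hlin : linear h by move=> a y z; apply/rowP => i; rewrite !mxE philin.
pose hL := GRing.isLinear.Build _ _ _ _ _ hlin.
pose h' : {linear W -> 'rV[R]_(\dim U)} := HB.pack h hL.
have h0 x : h x = 0 -> forall y, y \in U -> phi x y = 0.
  move=> /rowP hx y /coord_vbasis ->.
  pose psiL := GRing.isLinear.Build _ _ _ _ _ (phirin x).
  pose psi : {scalar W} := HB.pack (phi x) psiL.
  rewrite -[phi x]/(psi : W -> R) linear_sum big1 // => i _; rewrite linearZ /=.
  by have := hx i; rewrite !mxE => ->; rewrite mulr0.
have hU : (linfun h' @: U = fullv)%VS.
  apply/eqP; rewrite eqEdim subvf /= dimvf dim_matrix mul1r limg_dim_eq//.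
  apply/eqP; rewrite -subv0; apply/subvP => x; rewrite memv_cap memv_ker (lfunE h').
  by move=> /andP[xU /eqP /= hx]; rewrite memv0; apply/eqP/(pos _ xU)/h0.
have /memv_imgP[u uU] : h b \in (linfun h' @: U)%VS by rewrite hU memvf.
rewrite (lfunE h') /= => hbu; exists u => //; apply: h0.
by have := linearB h' b u; rewrite /= hbu subrr.
Qed.

(** * Groups with an invariant isotropic line *)

Section Parabolic.
Context {R : realType} {V : vectType R} {n : nat} (eta : {symmetric V}).
Hypothesis dimV : \dim {:V} = (n + 2)%N.
Variables (F0 : frame V n) (hF0 : adapted eta F0).
Local Notation L := (lobachevskian eta F0).
Implicit Types (F : frame V n) (u v w x y z : V) (f X Y C : 'End(V)).

(** Differentiating [eta (exp(tX) p) w = 0] at 0, for [w] orthogonal to [p], places [X p] in the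
    orthogonal complement of [p^perp], which is [Rp]. *)
Lemma exp_eigen_line F X : adapted eta F ->
  (forall t : R, exists a, end_exp (t *: X) (fr_p F) = a *: fr_p F) ->
  X (fr_p F) = eta (fr_q F) (X (fr_p F)) *: fr_p F.
Proof.
move=> hF Xp; set p := fr_p F in Xp *; set q := fr_q F.
have H w : eta p w = 0 -> eta (X p) w = 0.
  move=> pw; have [_ D] := end_exp_scalar_derive X (eval_form eta p w) 0.
  rewrite scale0r end_exp0 comp_lfun1r in D.
  rewrite -[LHS]/(eval_form eta p w X) -D.
  rewrite (_ : (fun s => _) = cst 0) ?derive_cst//.
  by apply/funext => s; rewrite /= /eval_form; have [a ->] := Xp s; rewrite etaZl pw mulr0.
apply: (frame_ext dimV hF) => [||i]; rewrite etaZr (frE hF) ?mulr0 ?mulr1//.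
  by rewrite etaC H// (frE hF).
by rewrite etaC H// (frE hF).
Qed.

Lemma parabolic_preserves_L F f (a : R) : adapted eta F -> end_isometry eta f ->
  0 < a -> f (fr_p F) = a *: fr_p F -> forall x, L x -> L (f x).
Proof.
move=> hF fi a0 fp x; have [sg [sg0 LE]] := L_sign dimV hF0 hF.
move=> /LE[xx px]; apply/LE; split; first by rewrite fi.
have E : a * eta (fr_p F) (f x) = eta (fr_p F) x by rewrite -etaZl -fp fi.
by rewrite -(pmulr_rlt0 _ a0) mulrCA E.
Qed.

Variables (G : set 'End(V)) (hG : connected_lie_subgroup (SO eta) G).
Hypothesis hT : acts_transitively G L.
Local Notation g := (lie_algebra G).

Lemma parabolic_pos F : adapted eta F -> (forall f, G f -> exists a, f (fr_p F) = a *: fr_p F) ->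
  forall f, G f -> exists2 a, 0 < a & f (fr_p F) = a *: fr_p F.
Proof.
move=> hF Gp f Gf; have [a fp] := Gp f Gf; exists a => //.
have [sg [sg0 LE]] := L_sign dimV hF0 hF.
have [c [_ Lx]] := exists_L dimV hF0 hF0; move: (c *: _) Lx => x Lx.
have /LE[_ h1] := Lx; have /LE[_ h2] := hT.1 _ _ Gf Lx.
have E : a * eta (fr_p F) (f x) = eta (fr_p F) x by rewrite -etaZl -fp (G_iso hG Gf).
by move: h1; rewrite -E mulrCA nmulr_llt0.
Qed.

Lemma lie_eigen F : adapted eta F -> (forall f, G f -> exists a, f (fr_p F) = a *: fr_p F) ->
  forall X, g X -> X (fr_p F) = eta (fr_q F) (X (fr_p F)) *: fr_p F.
Proof.
move=> hF Gp X gX; apply: (exp_eigen_line hF) => t.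
exact: (Gp _ (lie_exp (lie_Z hG t gX))).
Qed.

(* Otherwise [G] fixes [p], so that [eta p] is constant on [L]. *)
Lemma lie_dilation F : adapted eta F -> (forall f, G f -> exists a, f (fr_p F) = a *: fr_p F) ->
  exists2 X, g X & X (fr_p F) = fr_p F.
Proof.
move=> hF Gp; set p := fr_p F.
have [[X [gX X0]]|all0] := pselect (exists X, g X /\ X p <> 0).
  have XE := lie_eigen hF Gp gX; set s := eta _ _ in XE.
  have s0 : s != 0 by apply: contra_notN X0 => /eqP s0; rewrite XE s0 scale0r.
  exists (s^-1 *: X); first exact: (lie_Z hG _ gX).
  by rewrite scale_lfunE XE scalerA mulVf// scale1r.
have Gfix : forall f, G f -> f p = p.
  apply: (G_fix hG) => X gX; apply: contrapT => X0; apply: all0; by exists X.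
have [sg [sg0 LE]] := L_sign dimV hF0 hF.
have [c [_ Lx]] := exists_L dimV hF0 hF0; move: (c *: _) Lx => x Lx.
have two0 : (2 : R) != 0 by rewrite pnatr_eq0.
have Ly : L (A_elt F 2 x).
  have t0 : (0 : R) < 2 by rewrite ltr0n.
  exact: (parabolic_preserves_L hF (A_elt_isometry dimV hF two0) t0 (A_elt_p dimV hF 2)).
have [f [Gf fx]] := hT.2 _ _ Lx Ly.
have : eta p x = 2^-1 * eta p x.
  have [<- _ _] := A_eltE dimV hF 2 x; rewrite -fx.
  by have := G_iso hG Gf p x; rewrite (Gfix f Gf) => ->.
have /LE[_] := Lx; rewrite -/p => H E.
have p0 : eta p x = 0 by lra.
by move: H; rewrite p0 mulr0 ltxx.
Qed.

Lemma lie_diag_frame F : adapted eta F -> (forall f, G f -> exists a, f (fr_p F) = a *: fr_p F) ->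
  exists F' X, [/\ adapted eta F', fr_p F' = fr_p F, g X,
    X (fr_p F') = fr_p F' & X (fr_q F') = - fr_q F'].
Proof.
move=> hF Gp; have [X gX Xp] := lie_dilation hF Gp.
set p := fr_p F in Xp *; have sX := lie_skew dimV hF0 hG gX.
(* [X + 1] is not onto: [eta p] vanishes on its range, since [X p = p]. *)
have k0 : lker (X + \1%VF) != 0%VS.
  apply/negP => k0; have := lker0_lfunVK k0 (fr_q F).
  set v := (_^-1%VF _); rewrite add_lfunE id_lfunE => E.
  have := eta_pq hF; rewrite -E etaDr -/p.
  have -> : eta p (X v) = - eta p v by rewrite -[LHS]opprK -sX Xp.
  by rewrite addNr => /esym/eqP; rewrite oner_eq0.
set v := vpick (lker (X + \1%VF)).
have v0 : v != 0 by rewrite vpick0.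
have Xv : X v = - v.
  have := memv_pick (lker (X + \1%VF)); rewrite memv_ker add_lfunE id_lfunE addr_eq0.
  by move/eqP.
clearbody v.
have vv : eta v v = 0 by have := skew_self v sX; rewrite Xv etaNl; lra.
(* Otherwise the isotropic [v] would be a multiple of [p], on which [X] acts as 1 and not as -1. *)
have pv : eta p v != 0.
  apply: contra v0 => /eqP pv; have E := isotropic_perp_p dimV hF pv vv.
  have : X v = v by rewrite E lfunZ Xp.
  rewrite Xv => /eqP; rewrite eq_sym -subr_eq0 opprK -mulr2n.
  by rewrite -scaler_nat scaler_eq0 pnatr_eq0.
exists (move_q eta F ((eta p v)^-1 *: v)), X; split=> //=.
  by apply: (move_q_adapted dimV hF); rewrite !eta_lin ?vv ?mulr0// mulVf.
by rewrite lfunZ Xv scalerN.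
Qed.

Section Diag.
Variables (F : frame V n) (hF : adapted eta F).
Hypothesis Gp : forall f, G f -> exists a, f (fr_p F) = a *: fr_p F.
Variable X : 'End(V).
Local Notation p := (fr_p F).
Local Notation q := (fr_q F).
Hypotheses (gX : g X) (Xp : X p = p) (Xq : X q = - q).

(** Let [U'] be the space of all components [Z q - eta p (Z q) q], and [U] that of the [x]
    orthogonal to [p] and [q] with [p /\ x] in the algebra. Then [U] lies in [U'], while the limit
    argument gives only that [c0] maps [U'] into [U]. *)
Lemma lie_nil_comp Y : g Y -> g (wedge eta p (Y q - eta p (Y q) *: q)).
Proof.
(* With these times [exp(tX)] scales [p] by [k.+1], matching the dilations used in [limit_nil_part];
   the remaining factor fixes both [p] and [q]. *)
pose t (k : nat) : R := ln k.+1%:R.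
have eX k : G (end_exp (t k *: X)) by exact: (lie_exp (lie_Z hG _ gX)).
have k0 k : (k.+1%:R : R) != 0 by rewrite pnatr_eq0.
have et k : expR (t k) = k.+1%:R by rewrite lnK// posrE.
pose c k := ((A_elt F k.+1%:R)^-1 \o end_exp (t k *: X))%VF.
have Ai k := A_elt_isometry dimV hF (k0 k).
have ci k : end_isometry eta (c k).
  by apply: isometry_comp; [exact: (isometry_inv dimV hF0) | exact: (G_iso hG)].
have cp k : c k p = p.
  rewrite comp_lfunE (@end_exp_eigen _ _ _ _ (t k)) ?scale_lfunE ?Xp// et.
  by rewrite -(A_elt_p dimV hF) (isometry_Vf dimV hF0).
have cq k : c k q = q.
  rewrite comp_lfunE (@end_exp_eigen _ _ _ _ (- t k)) ?scale_lfunE ?Xq ?scalerN ?scaleNr//.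
  by rewrite expRN et -(A_elt_q dimV hF) (isometry_Vf dimV hF0).
have [|||c0 [c0i cfix cnil]] := limit_nil_part dimV hG hF (c := c).
- exact: ci.
- by move=> k; rewrite lfunD lfunN cp cq.
- by move=> k; rewrite /c comp_lfunA (isometry_compfV dimV hF0)// comp_lfun1l.
have c0p : c0 p = p by apply: cfix.
have c0q : c0 q = q by apply: cfix.
have c0Vq : (c0^-1)%VF q = q by rewrite -{1}c0q (isometry_Vf dimV hF0).
have nilE Z : g Z -> g (wedge eta p (c0 (Z q - eta p (Z q) *: q))).
  move=> gZ; have := cnil _ gZ; rewrite /nil_part !comp_lfunE c0Vq.
  by rewrite -{2}c0p c0i lfunD lfunN lfunZ c0q.
have [|||U' UP'] := @lin_closed_vspace R V
    [set x | exists2 Z, g Z & x = Z q - eta p (Z q) *: q].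
- exists 0; first exact: (lie_0 hG).
  by rewrite zero_lfunE eta0r scale0r subrr.
- move=> x y [Z gZ ->] [Z' gZ' ->]; exists (Z + Z'); first exact: (lie_D hG gZ gZ').
  by rewrite add_lfunE etaDr scalerDl opprD addrACA.
- move=> a x [Z gZ ->]; exists (a *: Z); first exact: (lie_Z hG _ gZ).
  by rewrite scale_lfunE etaZr scalerBr scalerA.
have [|||U UP] := @lin_closed_vspace R V
    [set x | [/\ eta p x = 0, eta q x = 0 & g (wedge eta p x)]].
- by split; [exact: eta0r | exact: eta0r | rewrite wedge0r; exact: (lie_0 hG)].
- move=> x y [px qx gx] [py qy gy]; split.
  + by rewrite etaDr px py addr0.
  + by rewrite etaDr qx qy addr0.
  + by rewrite wedgeDr; exact: (lie_D hG gx gy).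
- move=> a x [px qx gx]; split.
  + by rewrite etaZr px mulr0.
  + by rewrite etaZr qx mulr0.
  + by rewrite wedgeZr; exact: (lie_Z hG _ gx).
have UU' : (U <= U')%VS.
  apply/subvP => x /UP[px qx gx]; apply/UP'; exists (wedge eta p x) => //.
  rewrite !wedgeE (frE hF) (etaC eta x q) qx scale1r scale0r subr0 px scale0r.
  by rewrite subr0.
have cU : (c0 @: U' <= U)%VS.
  apply/subvP => _ /memv_imgP[x /UP'[Z gZ ->] ->]; apply/UP; split.
  - by rewrite -{1}c0p c0i etaDr etaNr etaZr (frE hF) mulr1 subrr.
  - rewrite -{1}c0q c0i etaDr etaNr etaZr (frE hF) mulr0 subr0 etaC.
    by apply: skew_self; exact: (lie_skew dimV hF0 hG gZ).
  - exact: nilE.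
have dU : \dim (c0 @: U')%VS = \dim U'.
  by apply: limg_dim_eq; rewrite (eqP (isometry_lker dimV hF0 c0i)) capv0.
(* [c0] maps [U'] injectively into its subspace [U]. *)
have UE : U = U'.
  by apply/eqP; rewrite eqEdim UU' -dU dimvS.
move=> gY; suff /UP[] : Y q - eta p (Y q) *: q \in U by [].
by rewrite UE; apply/UP'; exists Y.
Qed.

(** The invariant subspace argument again. Subtracting [eta p w *: q] in the definition of [W] puts
    [q] into [W] for free, since [p /\ q] need not belong to the algebra here. *)
Lemma lie_unipotent x : eta p x = 0 -> g (wedge eta p x).
Proof.
have [|||W WP] := @lin_closed_vspace R V
    [set w | g (wedge eta p (w - eta p w *: q))].
- by rewrite /= eta0r scale0r subrr wedge0r; exact: (lie_0 hG).
- move=> y z /= gy gz; rewrite etaDr scalerDl opprD addrACA wedgeDr.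
  exact: (lie_D hG gy gz).
- move=> a y /= gy; rewrite etaZr -scalerA -scalerBr wedgeZr.
  exact: (lie_Z hG _ gy).
suff WV w : w \in W.
  by move=> px; have /WP /= := WV x; rewrite px scale0r subr0.
apply: (invariant_full dimV hF0 hG hT hF).
- apply/WP => /=; rewrite (frE hF) scale0r subr0 wedge_id; exact: (lie_0 hG).
- apply/WP => /=; rewrite (frE hF) scale1r subrr wedge0r; exact: (lie_0 hG).
move=> Y {}w gY /WP /=; set u := w - _ => gu; apply/WP => /=.
have sY := lie_skew dimV hF0 hG gY.
have Yp := lie_eigen hF Gp gY.
have pu : eta p u = 0 by rewrite /u !eta_lin (frE hF); ring.
have wE : w = u + eta p w *: q by rewrite subrK.
clearbody u.
have pYu : eta p (Y u) = 0 by rewrite -[LHS]opprK -sY Yp etaZl pu mulr0 oppr0.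
have -> : Y w - eta p (Y w) *: q = Y u + eta p w *: (Y q - eta p (Y q) *: q).
  rewrite {1 2}wE lfunD lfunZ etaDr pYu add0r etaZr -addrA; congr (_ + _).
  by rewrite scalerBr scalerA.
rewrite wedgeDr wedgeZr; apply: (lie_D hG _ (lie_Z hG _ (lie_nil_comp gY))).
have h1 := lie_bracket hG gY gu.
rewrite (wedge_bracket _ _ sY) Yp wedgeZl in h1.
have := lie_B hG h1 (lie_Z hG (eta q (Y p)) gu).
by rewrite addrC addrA addNr add0r.
Qed.

End Diag.
End Parabolic.

(** The functions [t^-k N exp(ln t M)] are stable under differentiation, with [N] replaced by
    [N M - k N]; iterating this gives smoothness of the homomorphisms [exp_hom]. *)
Lemma is_derive_exp_ln (R : realType) m (M N : 'M[R]_m) (i j : 'I_m) k (a : R) : 0 < a ->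
  is_derive a (1 : R) (fun t => (t^-1) ^+ k * (N *m expmx (ln t *: M)) i j)
    ((a^-1) ^+ k.+1 * ((N *m M - k%:R *: N) *m expmx (ln a *: M)) i j).
Proof.
move=> a0; have an0 : a != 0 by rewrite gt_eqF.
have D1 l : is_derive a (1 : R) (fun t => expmx (ln t *: M) l j)
    ((M *m expmx (ln a *: M)) l j * a^-1).
  exact: (is_derive1_comp (expmx_derive M (ln a) l j) (is_derive1_ln a0)).
have D2 : is_derive a (1 : R) (fun t => (N *m expmx (ln t *: M)) i j)
    (a^-1 * (N *m (M *m expmx (ln a *: M))) i j).
  have -> : (fun t => (N *m expmx (ln t *: M)) i j) =
      \sum_l (N i l \*: (fun t => expmx (ln t *: M) l j)).
    by apply/funext => t; rewrite mxE fct_sumE.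
  have -> : a^-1 * (N *m (M *m expmx (ln a *: M))) i j =
      \sum_l N i l *: ((M *m expmx (ln a *: M)) l j * a^-1).
    rewrite mxE mulr_sumr; apply: eq_bigr => l _.
    by rewrite /GRing.scale /= mulrC mulrA.
  by apply: is_derive_sum => l; apply: is_deriveZ.
have D3 : is_derive a (1 : R) (fun t => (t^-1) ^+ k) (- (k%:R * (a^-1) ^+ k.+1)).
  have D4 : is_derive a (1 : R) (fun t : R => t^-1) (- a ^- 2).
    have := @is_deriveV R id a 1 1 an0 (is_derive_id a 1).
    by move/is_derive_eq; apply; rewrite /GRing.scale /= mulr1.
  have D5 := @is_deriveX _ _ _ k _ _ _ D4.
  have -> : (fun t : R => (t^-1) ^+ k) = (fun t : R => t^-1) ^+ k.
    by apply/funext => t; rewrite exprfctE.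
  apply: (is_derive_eq D5); rewrite /GRing.scale /=.
  case: k {D5} => [|k]; first by rewrite mulr0n !mul0r oppr0.
  by rewrite -exprVn /= !exprS expr0 -[_ *+ _]mulr_natl; ring.
have D := is_deriveM D3 D2.
apply: (is_derive_eq D); rewrite /GRing.scale /=.
rewrite mulmxBl -scalemxAl mulmxA [in RHS]mxE [(- _ : 'M[R]_m) i j]mxE
  [(_ *: _ : 'M[R]_m) i j]mxE exprS; ring.
Qed.

Lemma derive1n_exp_ln (R : realType) m (M : 'M[R]_m) (i j : 'I_m) k :
  exists N : 'M[R]_m, forall t : R, 0 < t ->
    derive1n k (fun t => expmx (ln t *: M) i j) t =
    (t^-1) ^+ k * (N *m expmx (ln t *: M)) i j.
Proof.
elim: k => [|k [N HN]]; first by exists 1%:M => t _; rewrite expr0 mul1r mul1mx.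
exists (N *m M - k%:R *: N) => t t0.
rewrite derive1nS derive1E.
have [_ <-] := is_derive_exp_ln M N i j k t0.
(* The formula for the previous derivative is known only for positive arguments, which form a
   neighbourhood of [t]. *)
apply: near_eq_derive; near=> s; apply: HN.
by near: s; exact: lt_nbhsr.
Unshelve. all: by end_near. Qed.

Lemma derivable_exp_ln (R : realType) m (M : 'M[R]_m) (i j : 'I_m) k (a : R) : 0 < a ->
  derivable (derive1n k (fun t => expmx (ln t *: M) i j)) a 1.
Proof.
move=> a0; have [N HN] := derive1n_exp_ln M i j k.
have [D _] := is_derive_exp_ln M N i j k a0.
apply: near_eq_derivable D; near=> s; symmetry; apply: HN.
by near: s; exact: lt_nbhsr.
Unshelve. all: by end_near. Qed.

(** * The groups [A^Phi] and exponentials of elements preserving [Rp] *)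

Section Twisted.
Context {R : realType} {V : vectType R} {n : nat} (eta : {symmetric V}).
Hypothesis dimV : \dim {:V} = (n + 2)%N.
Variables (F : frame V n) (hF : adapted eta F).
Local Notation p := (fr_p F).
Local Notation q := (fr_q F).
Implicit Types (u v w x y z : V) (f h X Y B C : 'End(V)).

Lemma end_exp_dilation (t : R) : end_exp (t *: wedge eta q p) = A_elt F (expR t).
Proof.
have e0 : expR t != 0 by rewrite gt_eqF// expR_gt0.
have wp : (t *: wedge eta q p) p = t *: p.
  by rewrite scale_lfunE wedgeE !(frE hF) scale1r scale0r subr0.
have wq : (t *: wedge eta q p) q = (- t) *: q.
  by rewrite scale_lfunE wedgeE !(frE hF) scale1r scale0r sub0r scalerN scaleNr.
have we (i : 'I_n) : (t *: wedge eta q p) (fr_e F)`_i = 0 *: (fr_e F)`_i.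
  by rewrite scale_lfunE wedgeE !(frE hF) !scale0r subrr scaler0.
apply/lfunP => v; rewrite (frame_decomp dimV hF v) !lfun_lin !lfun_sum.
rewrite (end_exp_eigen wp) (end_exp_eigen wq) expRN (A_elt_p dimV hF) (A_elt_q dimV hF).
congr (_ + _ + _); apply: eq_bigr => i _; rewrite !lfunZ (end_exp_eigen (we i)).
rewrite expR0 scale1r; congr (_ *: _); symmetry.
have [h1 h2 h3] := A_eltE dimV hF (expR t) (fr_e F)`_i.
by apply: (frame_eqP dimV hF); rewrite ?h1 ?h2 ?h3 // (frE hF) mulr0.
Qed.

Section WithB.
Variable B : 'End(V).
Hypotheses (sB : skew_end eta B) (Bp : B p = 0) (Bq : B q = 0).

Lemma end_exp_K t : K_group F (end_exp (t *: B)).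
Proof.
have [i d] := skew_exp_SO dimV hF (skew_scale t sB).
apply: (K_char dimV hF) => //.
  by rewrite (@end_exp_eigen _ _ _ _ 0) ?expR0 ?scale1r// scale_lfunE Bp scaler0 scale0r.
by rewrite (@end_exp_eigen _ _ _ _ 0) ?expR0 ?scale1r// scale_lfunE Bq scaler0 scale0r.
Qed.

Lemma end_exp_twisted (t : R) :
  end_exp (t *: (wedge eta q p + B)) = (end_exp (t *: B) \o A_elt F (expR t))%VF.
Proof.
have BW : (B \o wedge eta q p = wedge eta q p \o B)%VF.
  apply/eqP; rewrite -subr_eq0 wedge_bracket// Bp Bq wedge0r wedgeC wedge0r.
  by rewrite oppr0 addr0.
rewrite -end_exp_dilation addrC scalerDr; apply: end_expD.
by rewrite -!comp_lfunZl -!comp_lfunZr BW scalerA mulrC -scalerA.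
Qed.

(** The parameter [a] of an element of [A] is recovered as [eta q (f p)], because [A_elt F a] sends
    [p] to [a p]. *)
Definition exp_hom f : 'End(V) := end_exp (ln (eta q (f p)) *: B).

Lemma exp_hom_A (a : R) : exp_hom (A_elt F a) = end_exp (ln a *: B).
Proof. by rewrite /exp_hom (A_elt_p dimV hF) etaZr (frE hF) mulr1. Qed.

Lemma exp_hom_lie : lie_group_hom F exp_hom.
Proof.
split.
- by move=> _ [a _ <-]; rewrite exp_hom_A; exact: end_exp_K.
- move=> _ _ [a /= a0 <-] [b /= b0 <-]; rewrite (A_eltM dimV hF) !exp_hom_A.
  rewrite lnM ?posrE// scalerDl; apply: end_expD.
  by rewrite -!comp_lfunZl -!comp_lfunZr scalerA mulrC -scalerA.
- move=> i j k a a0.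
  have -> : (fun t => mx_in (fr_basis F) (exp_hom (A_elt F t)) i j) =
      (fun t => expmx (ln t *: mx_in (fr_basis F) B) i j).
    apply/funext => t.
    by rewrite exp_hom_A (mx_in_exp _ (fr_basisP hF)) linearZ.
  exact: derivable_exp_ln.
Qed.

Lemma twisted_A_exp f : twisted_A F exp_hom f <->
  exists t : R, f = end_exp (t *: (wedge eta q p + B)).
Proof.
split=> [[_ [a /= a0 <-] <-]|[t ->]].
  exists (ln a); rewrite end_exp_twisted exp_hom_A lnK ?posrE//.
exists (A_elt F (expR t)); first by exists (expR t) => //=; exact: expR_gt0.
by rewrite end_exp_twisted exp_hom_A expRK.
Qed.

End WithB.

Definition rank1_fun u w v := eta u v *: w.
Lemma rank1_is_linear u w : linear (rank1_fun u w).
Proof. by move=> a x y; rewrite /rank1_fun !eta_lin scalerDl scalerA. Qed.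
HB.instance Definition _ u w := GRing.isLinear.Build R V V _ (rank1_fun u w)
  (rank1_is_linear u w).
Definition rank1 u w : 'End(V) := linfun (rank1_fun u w).
Lemma rank1E u w v : rank1 u w v = eta u v *: w. Proof. by rewrite lfunE. Qed.

(** Projection onto [p^perp] along [q]; composing further with the removal of the [p]-component
    gives [proj_E], the projection onto [E]. *)
Definition proj_perp : 'End(V) := \1%VF - rank1 p q.
Definition proj_E : 'End(V) := proj_perp - rank1 q p.

Lemma proj_perpE v : proj_perp v = v - eta p v *: q.
Proof. by rewrite add_lfunE opp_lfunE rank1E id_lfunE. Qed.
Lemma proj_EE v : proj_E v = v - eta p v *: q - eta q v *: p.
Proof. by rewrite add_lfunE opp_lfunE rank1E proj_perpE. Qed.

(* [p^perp] is invariant under [Y], and [proj_E] identifies [p^perp / p] with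
   the span of the [e_i]; the action there is that of [proj_E \o Y \o proj_E]. *)
Lemma end_exp_quotient Y : skew_end eta Y -> (exists s, Y p = s *: p) ->
  (proj_E \o (end_exp Y \o proj_perp) =
   end_exp (proj_E \o Y \o proj_E) \o proj_E)%VF.
Proof.
move=> sY [s Yp].
have pperp v : eta p (proj_perp v) = 0.
  by rewrite proj_perpE !eta_lin (frE hF); ring.
have TT v : proj_E (proj_E v) = proj_E v.
  by rewrite proj_EE (_ : eta p _ = 0) 1?(_ : eta q _ = 0) ?scale0r ?subr0//;
    rewrite proj_EE !eta_lin !(frE hF); ring.
have TP v : proj_E (proj_perp v) = proj_E v.
  by rewrite proj_EE pperp scale0r subr0 proj_perpE proj_EE !eta_lin (frE hF) mulr0 subr0.
have Tp : proj_E p = 0.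
  by rewrite proj_EE !(frE hF) scale0r scale1r subr0 subrr.
have h1 : (proj_perp \o (Y \o proj_perp) = Y \o proj_perp)%VF.
  apply/lfunP => v; rewrite !comp_lfunE [LHS]proj_perpE -[eta p _]opprK -sY Yp etaZl.
  by rewrite pperp mulr0 oppr0 scale0r subr0.
have h2 : (proj_E \o (Y \o proj_perp) = (proj_E \o Y \o proj_E) \o proj_E)%VF.
  apply/lfunP => v; rewrite !comp_lfunE TT.
  have -> : proj_perp v = proj_E v + eta q v *: p by rewrite proj_EE proj_perpE subrK.
  by rewrite !lfun_lin Yp lfunZ Tp !scaler0 addr0.
rewrite -(end_exp_intertwine h1) -(end_exp_intertwine h2).
by apply/lfunP => v; rewrite !comp_lfunE TP.
Qed.

(** Adding [p /\ x] changes neither the eigenvalue on [p] nor the action on [p^perp / p], so by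
    [end_exp_quotient] and [N_rel] the two exponentials differ by an element of [N]. *)
Lemma end_exp_unipotent_rel Y0 x : skew_end eta Y0 -> (exists s, Y0 p = s *: p) ->
  eta p x = 0 ->
  exists c : 'cV[R]_n, end_exp (Y0 + wedge eta p x) = (end_exp Y0 \o N_elt F c)%VF.
Proof.
move=> sY0 [s Y0p] px.
have wp : wedge eta p x p = 0.
  by rewrite wedgeE (frE hF) (etaC eta x p) px !scale0r subrr.
have sY : skew_end eta (Y0 + wedge eta p x) by apply: skew_add => //; exact: wedge_skew.
have Yp : (Y0 + wedge eta p x) p = s *: p by rewrite add_lfunE wp addr0.
apply: (@N_rel _ _ _ _ dimV _ hF _ _ (expR s)).
- exact: skew_exp_isometry.
- exact: skew_exp_isometry.
- by rewrite gt_eqF// expR_gt0.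
- exact: end_exp_eigen.
- exact: end_exp_eigen.
move=> v pv.
have Te w : ecol eta F (proj_E w) = ecol eta F w.
  by rewrite proj_EE !ecol_lin (ecol_p hF) (ecol_q hF) !scaler0 !oppr0 !addr0.
have E Y' : skew_end eta Y' -> Y' p = s *: p ->
    ecol eta F (end_exp Y' v) = ecol eta F ((end_exp (proj_E \o Y' \o proj_E) \o proj_E)%VF v).
  move=> sY' Y'p; rewrite -end_exp_quotient//; last by exists s.
  by rewrite !comp_lfunE Te proj_perpE pv scale0r subr0.
have TYT : (proj_E \o (Y0 + wedge eta p x) \o proj_E = proj_E \o Y0 \o proj_E)%VF.
  apply/lfunP => w; rewrite !comp_lfunE add_lfunE lfunD wedgeE lfunD lfunN !lfunZ.
  have -> : eta p (proj_E w) = 0 by rewrite proj_EE !eta_lin !(frE hF); ring.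
  have -> : proj_E p = 0 by rewrite proj_EE !(frE hF) scale0r scale1r subr0 subrr.
  by rewrite scale0r scaler0 subr0 addr0.
by rewrite (E _ sY Yp) TYT -(E _ sY0 Y0p).
Qed.

(** The cube of [p /\ x] vanishes, so the exponential is a quadratic polynomial, which [N_char]
    identifies from its value at [q]. *)
Lemma end_exp_wedge_N (c : 'cV[R]_n) : end_exp (wedge eta p (evec F c)) = N_elt F c.
Proof.
have px := eta_p_evec hF c; have qx := eta_q_evec hF c.
set x := evec F c in px qx *.
have wp : wedge eta p x p = 0.
  by rewrite wedgeE (frE hF) (etaC eta x p) px !scale0r subrr.
have wperp v : eta p v = 0 -> wedge eta p x v = - eta x v *: p.
  by move=> pv; rewrite wedgeE pv scale0r sub0r scaleNr.
have pw v : eta p (wedge eta p x v) = 0.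
  by rewrite wedgeE !eta_lin px (frE hF); ring.
have w3 : (wedge eta p x \o (wedge eta p x \o wedge eta p x) = 0)%VF.
  apply/lfunP => v; rewrite !comp_lfunE zero_lfunE (wperp (wedge eta p x v) (pw v)).
  by rewrite lfunZ wp scaler0.
have E := end_exp_nilp3 w3.
have -> : c = ecol eta F (end_exp (wedge eta p x) q).
  rewrite E !add_lfunE scale_lfunE comp_lfunE id_lfunE !(ecolD, ecolZ).
  have wq : wedge eta p x q = x by rewrite wedgeE (frE hF) (etaC eta x q) qx scale1r scale0r subr0.
  by rewrite wq (wperp _ px) ecolZ (ecol_p hF) (ecol_q hF) !scaler0 addr0 add0r /x (ecol_evec hF).
apply: (N_char dimV hF).
- by apply: skew_exp_isometry; exact: wedge_skew.
- by rewrite (@end_exp_eigen _ _ _ _ 0) ?expR0 ?scale1r// wp scale0r.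
move=> v pv; rewrite E !add_lfunE scale_lfunE comp_lfunE id_lfunE (wperp _ pv).
by rewrite lfunZ wp !scaler0 addr0 !(ecolD, ecolZ) (ecol_p hF) scaler0 addr0.
Qed.

End Twisted.

Lemma comp_lfun_inv (R : realType) (V : vectType R) (f h : 'End(V)) :
  lker f == 0%VS -> lker h == 0%VS -> ((f \o h)^-1 = h^-1 \o f^-1)%VF.
Proof.
move=> f0 h0; apply: compl_inv.
by rewrite -comp_lfunA (comp_lfunA h) (lker0_compfV h0) comp_lfun1l (lker0_compfV f0).
Qed.

Lemma commuting_product_subgroup (R : realType) (V : vectType R) (S T : set 'End(V)) :
  (forall f, S f -> lker f == 0%VS) -> (forall f, T f -> lker f == 0%VS) ->
  is_subgroup S -> is_subgroup T ->
  (forall f h, S f -> T h -> (f \o h = h \o f)%VF) ->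
  is_subgroup [set (f \o h)%VF | f in S & h in T].
Proof.
move=> kS kT [S1 SM SV] [T1 TM TV] ST; split.
- by exists \1%VF => //; exists \1%VF => //; rewrite comp_lfun1l.
- move=> _ _ [f Sf [h Th <-]] [f' Sf' [h' Th' <-]].
  exists (f \o f')%VF; first exact: SM.
  exists (h \o h')%VF; first exact: TM.
  by rewrite -!comp_lfunA; congr (f \o _)%VF; rewrite !comp_lfunA (ST f' h).
- move=> _ [f Sf [h Th <-]]; exists (f^-1)%VF; first exact: SV.
  exists (h^-1)%VF; first exact: TV.
  by rewrite (comp_lfun_inv (kS _ Sf) (kT _ Th)); exact: (ST _ _ (SV _ Sf) (TV _ Th)).
Qed.

(** * Choice of a rotational part commuting with the rotations in the algebra *)

Section ParabolicGroup.
Context {R : realType} {V : vectType R} {n : nat} (eta : {symmetric V}).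
Hypothesis dimV : \dim {:V} = (n + 2)%N.
Variables (F0 : frame V n) (hF0 : adapted eta F0).
Local Notation L := (lobachevskian eta F0).
Implicit Types (u v w x y z : V) (f h X Y C : 'End(V)).
Variables (G : set 'End(V)) (hG : connected_lie_subgroup (SO eta) G).
Hypothesis hT : acts_transitively G L.
Local Notation g := (lie_algebra G).
Variables (F : frame V n) (hF : adapted eta F).
Hypothesis Gp : forall f, G f -> exists a, f (fr_p F) = a *: fr_p F.
Local Notation p := (fr_p F).
Local Notation q := (fr_q F).

Lemma K_isometry f : K_group F f -> end_isometry eta f.
Proof. by case=> k [kk _] <-; exact: (K_elt_isometry dimV hF). Qed.
Lemma K_fix_p f : K_group F f -> f p = p.
Proof. by case=> k _ <-; exact: (K_elt_p dimV hF). Qed.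
Lemma K_fix_q f : K_group F f -> f q = q.
Proof. by case=> k _ <-; exact: (K_elt_q dimV hF). Qed.
Lemma K_det f : K_group F f -> end_det f = 1.
Proof. by case=> k [_ dk] <-; rewrite (end_det_K hF). Qed.
Lemma K_1 : K_group F \1%VF.
Proof. by exists 1%:M; rewrite ?(K_elt1 dimV hF)//= trmx1 mulmx1 det1. Qed.
Lemma K_comp f h : K_group F f -> K_group F h -> K_group F (f \o h)%VF.
Proof.
move=> Kf Kh; apply: (K_char dimV hF).
- by apply: isometry_comp; exact: K_isometry.
- by rewrite end_det_comp !K_det// mulr1.
- by rewrite comp_lfunE !K_fix_p.
- by rewrite comp_lfunE !K_fix_q.
Qed.

Section Centralizing.
Variable X0 : 'End(V).
Hypotheses (gX0 : g X0) (X0p : X0 p = p) (X0q : X0 q = - q).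

(** Since [C] takes values orthogonal to [p - q], it is skew also for the positive definite form
    [dot_fr], for which the frame is orthonormal. *)
Lemma antisym_frame C : skew_end eta C -> C p = 0 -> C q = 0 ->
  (mx_in (fr_basis F) C)^T = - mx_in (fr_basis F) C.
Proof.
move=> sC Cp Cq; have hb := fr_basisP hF.
have pqC v : eta (p - q) (C v) = 0.
  by rewrite -[LHS]opprK -sC lfunD lfunN Cp Cq subrr eta0l oppr0.
have E (i j : 'I_(1 + (n + 1))) :
    mx_in (fr_basis F) C i j = eta (fr_basis F)`_i (C (fr_basis F)`_j).
  rewrite mxE -[RHS]addr0 -[in RHS](mulr0 (eta (p - q) (fr_basis F)`_i)) -(pqC (fr_basis F)`_j).
  rewrite -/(dot_fr eta F _ _) (dot_frE dimV hF) (bigD1 i)//= big1 ?addr0 => [|l li].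
    by rewrite coord_free ?(basis_free hb)// eqxx mul1r.
  by rewrite coord_free ?(basis_free hb)// eq_sym (negbTE li) mul0r.
apply/matrixP => i j; rewrite mxE [RHS]mxE !E.
by rewrite -[LHS]opprK -sC etaC.
Qed.

(* Remove from [X0 - q /\ p] its projection, with respect to the trace form, to
   the subalgebra of [g] killing [p] and [q], on which this form is definite. *)
Lemma lie_centralizing : exists B, [/\ skew_end eta B, B p = 0, B q = 0,
  g (wedge eta q p + B) &
  forall C, g C -> C p = 0 -> C q = 0 -> (B \o C = C \o B)%VF].
Proof.
have hb := fr_basisP hF; set b := fr_basis F in hb.
have sX0 := lie_skew dimV hF0 hG gX0.
pose B0 := X0 - wedge eta q p.
have sB0 : skew_end eta B0.
  by apply: skew_add => //; rewrite -wedgeNr; exact: wedge_skew.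
have B0p : B0 p = 0.
  rewrite add_lfunE opp_lfunE X0p wedgeE !(frE hF) scale1r scale0r subr0 subrr //.
have B0q : B0 q = 0.
  by rewrite add_lfunE opp_lfunE X0q wedgeE !(frE hF) scale1r scale0r sub0r opprK addNr.
have [|||U UP] := @lin_closed_vspace R 'End(V) [set C | [/\ g C, C p = 0 & C q = 0]].
- by split; [exact: (lie_0 hG) | exact: zero_lfunE | exact: zero_lfunE].
- move=> C D [gC Cp Cq] [gD Dp Dq]; split; first exact: (lie_D hG gC gD).
    by rewrite add_lfunE Cp Dp addr0.
  by rewrite add_lfunE Cq Dq addr0.
- move=> a C [gC Cp Cq]; split; first exact: (lie_Z hG _ gC).
    by rewrite scale_lfunE Cp scaler0.
  by rewrite scale_lfunE Cq scaler0.
pose kappa X Y : R := \tr (mx_in b X *m mx_in b Y).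
have kl Y : scalar (kappa^~ Y).
  move=> a X X'; rewrite /kappa linearP mulmxDl mxtraceD -scalemxAl.
  by rewrite mxtraceZ.
have kr X : scalar (kappa X).
  move=> a Y Y'; rewrite /kappa linearP mulmxDr mxtraceD -scalemxAr.
  by rewrite mxtraceZ.
(* For an antisymmetric matrix the trace of the square is minus the sum of the squares of the
   entries. *)
have kpos C : C \in U -> kappa C C = 0 -> C = 0.
  move=> /UP[gC Cp Cq] k0; have sC := lie_skew dimV hF0 hG gC.
  apply: (mx_in_inj hb); rewrite linear0; apply/matrixP => i j; rewrite [RHS]mxE.
  have aC := antisym_frame sC Cp Cq; rewrite -/b in aC.
  have : \sum_k \sum_l mx_in b C k l ^+ 2 = 0.
    move: k0; rewrite /kappa -[X in X *m _]opprK -aC mulNmx linearN /= => /eqP.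
    rewrite oppr_eq0 => /eqP k0; rewrite -[RHS]k0 /mxtrace exchange_big /=.
    apply: eq_bigr => k _; rewrite [RHS]mxE; apply: eq_bigr => l _.
    by rewrite [_^T k l]mxE expr2.
  move=> /psumr_eq0P => /(_ (fun k _ => sumr_ge0 _ (fun l _ => sqr_ge0 _))) /(_ i isT).
  move=> /psumr_eq0P => /(_ (fun l _ => sqr_ge0 _)) /(_ j isT)/eqP.
  by rewrite sqrf_eq0 => /eqP.
have [A AU Aorth] := form_projection kl kpos kr B0.
have /UP[gA Ap Aq] := AU; have sA := lie_skew dimV hF0 hG gA.
exists (B0 - A); split.
- by apply: skew_add => //; rewrite -scaleN1r; exact: skew_scale.
- by rewrite add_lfunE opp_lfunE B0p Ap subrr.
- by rewrite add_lfunE opp_lfunE B0q Aq subrr.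
- by rewrite /B0 addrA addrC [X in g (_ + X)]addrC subrK addrC; exact: (lie_B hG gX0 gA).
move=> C gC Cp Cq; have sC := lie_skew dimV hF0 hG gC.
pose Z := ((B0 - A) \o C)%VF - (C \o (B0 - A))%VF.
suff : Z = 0 by move=> /eqP; rewrite subr_eq0 => /eqP.
(* [B0] differs from [X0] by [q /\ p], which commutes with [C]; hence [Z] is also the bracket of
   [X0 - A] with [C], two elements of the algebra. *)
have ZU : Z \in U.
  have h1 := lie_bracket hG (lie_B hG gX0 gA) gC.
  have WC : (wedge eta q p \o C = C \o wedge eta q p)%VF.
    apply/eqP; rewrite eq_sym -subr_eq0 (wedge_bracket _ _ sC) Cp Cq.
    by rewrite wedge0r wedgeC wedge0r oppr0 addr0.
  have ZE : Z = ((X0 - A) \o C)%VF - (C \o (X0 - A))%VF.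
    rewrite /Z (_ : B0 - A = (X0 - A) - wedge eta q p); last by rewrite /B0 addrAC.
    move: (X0 - A) => D.
    rewrite comp_lfunDl comp_lfunDr comp_lfunNl comp_lfunNr WC.
    by rewrite opprD opprK addrACA addNr addr0.
  apply/UP; split; first by rewrite ZE.
    by rewrite /Z add_lfunE opp_lfunE !comp_lfunE Cp lfun0 add_lfunE opp_lfunE
      B0p Ap subrr lfun0 subrr.
  by rewrite /Z add_lfunE opp_lfunE !comp_lfunE Cq lfun0 add_lfunE opp_lfunE
      B0q Aq subrr lfun0 subrr.
apply: (kpos _ ZU).
(* By invariance of the trace form, [kappa ([B0 - A, C], Z) = kappa (B0 - A, [C, Z])], and the
   right-hand side is 0 because [B0 - A] is orthogonal to [U]. *)
have CZU : (C \o Z)%VF - (Z \o C)%VF \in U.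
  have /UP[gZ Zp Zq] := ZU; apply/UP; split.
  - exact: (lie_bracket hG gC gZ).
  - by rewrite add_lfunE opp_lfunE !comp_lfunE Cp Zp !lfun0 subrr.
  - by rewrite add_lfunE opp_lfunE !comp_lfunE Cq Zq !lfun0 subrr.
rewrite -(Aorth _ CZU) /kappa.
have -> : mx_in b ((C \o Z)%VF - (Z \o C)%VF) =
    mx_in b C *m mx_in b Z - mx_in b Z *m mx_in b C.
  by rewrite linearB /= !mx_in_comp.
have {1}-> : mx_in b Z = mx_in b (B0 - A) *m mx_in b C - mx_in b C *m mx_in b (B0 - A).
  by rewrite /Z linearB /= !mx_in_comp.
move: (mx_in b (B0 - A)) (mx_in b C) (mx_in b Z) => mB mC mZ.
rewrite mulmxBl mulmxBr !raddfB /= !mulmxA; congr (_ - _).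
rewrite -[in LHS]mulmxA; exact: mxtrace_mulC.
Qed.

End Centralizing.
End ParabolicGroup.

(** * The semidirect decomposition *)

Section Assemble.
Context {R : realType} {V : vectType R} {n : nat} (eta : {symmetric V}).
Hypothesis dimV : \dim {:V} = (n + 2)%N.
Implicit Types (u v w x y z : V) (f h X Y C : 'End(V)).
Variables (F : frame V n) (hF : adapted eta F).
Variables (G : set 'End(V)) (hG : connected_lie_subgroup (SO eta) G).
Local Notation g := (lie_algebra G).
Local Notation p := (fr_p F).
Local Notation q := (fr_q F).
Hypothesis Gpos : forall f, G f -> exists2 a, 0 < a & f p = a *: p.
Variable B : 'End(V).
Hypotheses (sB : skew_end eta B) (Bp : B p = 0) (Bq : B q = 0).
Let X1 := wedge eta q p + B.
Hypothesis gX1 : g X1.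
Hypothesis commB : forall C, g C -> C p = 0 -> C q = 0 -> (B \o C = C \o B)%VF.
Hypothesis gunip : forall x, eta p x = 0 -> g (wedge eta p x).
Let Phi := exp_hom eta F B.

Let stab C := [/\ g C, C p = 0 & C q = 0].

(** Generated by exponentials instead of being defined as the stabilizer of [p] and [q] in [G]:
    lying in [K] and commuting with [A^Phi] are then checked on generators. *)
Definition rotation_part : set 'End(V) := [set f | exists s : seq 'End(V),
  (forall C, C \in s -> stab C) /\
  f = foldr (fun X h => (end_exp X \o h)%VF) \1%VF s].
Local Notation H := rotation_part.

Let sX1 : skew_end eta X1. Proof. by apply: skew_add => //; exact: wedge_skew. Qed.
Let X1p : X1 p = p.
Proof. by rewrite add_lfunE wedgeE !(frE hF) scale1r scale0r subr0 Bp addr0. Qed.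
Let X1q : X1 q = - q.
Proof. by rewrite add_lfunE wedgeE !(frE hF) scale1r scale0r sub0r Bq addr0. Qed.

Lemma rotation_part_ind (P : 'End(V) -> Prop) : P \1%VF ->
  (forall C f, stab C -> H f -> P f -> P (end_exp C \o f)%VF) -> forall f, H f -> P f.
Proof.
move=> P1 PS f [s [sC ->]].
elim: s sC => [|C s IH] sC //=.
have sC' D : D \in s -> stab D by move=> Ds; apply: sC; rewrite in_cons Ds orbT.
apply: PS; first by apply: sC; rewrite mem_head.
  by exists s.
exact: IH.
Qed.

Lemma rotation_part_exp C : stab C -> H (end_exp C).
Proof.
move=> sC; exists [:: C]; split; last by rewrite /= comp_lfun1r.
by move=> D; rewrite mem_seq1 => /eqP->.
Qed.

Lemma rotation_part_K : H `<=` K_group F.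
Proof.
move=> f; apply: rotation_part_ind f => [|C f [gC Cp Cq] _ Kf].
  exact: (K_1 dimV hF).
apply: (K_comp dimV hF) => //.
have := end_exp_K dimV hF (lie_skew dimV hF hG gC) Cp Cq 1.
by rewrite scale1r.
Qed.

Lemma rotation_part_G : H `<=` G.
Proof.
move=> f; apply: rotation_part_ind f => [|C f [gC Cp Cq] _ Gf].
  exact: (G_1 hG).
exact: (G_comp hG (lie_exp gC) Gf).
Qed.

Lemma rotation_part_subgroup : is_subgroup H.
Proof.
have HM f h : H f -> H h -> H (f \o h)%VF.
  move=> [s [sC ->]] [s' [sC' ->]]; exists (s ++ s'); split.
    by move=> D; rewrite mem_cat => /orP[/sC|/sC'].
  rewrite foldr_cat; elim: s {sC} => [|C s IH] /=; first by rewrite comp_lfun1l.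
  by rewrite -IH comp_lfunA.
split=> //; first by exists [::].
apply: rotation_part_ind => [|C f sC Hf HVf].
  by rewrite (compl_inv (comp_lfun1l _)); exists [::].
have [gC Cp Cq] := sC.
rewrite (comp_lfun_inv (end_exp_lker C)
  (isometry_lker dimV hF (G_iso hG (rotation_part_G Hf)))).
apply: HM => //; rewrite end_exp_inv; apply: rotation_part_exp; split.
- exact: (lie_N hG gC).
- by rewrite opp_lfunE Cp oppr0.
- by rewrite opp_lfunE Cq oppr0.
Qed.

Let tw_exp f : twisted_A F Phi f <-> exists t : R, f = end_exp (t *: X1).
Proof. exact: (twisted_A_exp dimV hF sB Bp Bq). Qed.

Lemma twisted_A_subgroup : is_subgroup (twisted_A F Phi).
Proof.
have HM f h : twisted_A F Phi f -> twisted_A F Phi h -> twisted_A F Phi (f \o h)%VF.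
  move=> /tw_exp[s ->] /tw_exp[t ->]; apply/tw_exp; exists (s + t).
  rewrite scalerDl end_expD//.
  by rewrite -!comp_lfunZl -!comp_lfunZr scalerA mulrC -scalerA.
split=> //; first by apply/tw_exp; exists 0; rewrite scale0r end_exp0.
by move=> f /tw_exp[t ->]; apply/tw_exp; exists (- t); rewrite end_exp_inv scaleNr.
Qed.

Let comm1 C : stab C -> (X1 \o C = C \o X1)%VF.
Proof.
move=> [gC Cp Cq]; have sC := lie_skew dimV hF hG gC.
have WC : (wedge eta q p \o C = C \o wedge eta q p)%VF.
  apply/eqP; rewrite eq_sym -subr_eq0 (wedge_bracket _ _ sC) Cp Cq.
  by rewrite wedge0r wedgeC wedge0r oppr0 addr0.
by rewrite comp_lfunDl comp_lfunDr WC commB.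
Qed.

Lemma twisted_A_rotation_comm f h : twisted_A F Phi f -> H h ->
  (f \o h = h \o f)%VF.
Proof.
move=> /tw_exp[t ->] Hh; move: h Hh; apply: rotation_part_ind => [|C h sC _ IH].
  by rewrite comp_lfun1l comp_lfun1r.
have E : (end_exp (t *: X1) \o end_exp C = end_exp C \o end_exp (t *: X1))%VF.
  apply: end_exp_intertwine; apply/esym/end_exp_intertwine.
  by rewrite -comp_lfunZl -comp_lfunZr comm1.
by rewrite comp_lfunA E -comp_lfunA IH; exact: comp_lfunA.
Qed.

Let tw_p f : twisted_A F Phi f -> exists t : R, f = end_exp (t *: X1) /\ f p = expR t *: p.
Proof.
move=> /tw_exp[t ->]; exists t; split=> //.
by apply: end_exp_eigen; rewrite scale_lfunE X1p.
Qed.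

Lemma twisted_A_G : twisted_A F Phi `<=` G.
Proof. by move=> _ /tw_exp[t ->]; exact: (lie_exp (lie_Z hG t gX1)). Qed.

Definition levi_part : set 'End(V) := [set (f \o h)%VF | f in twisted_A F Phi & h in H].
Local Notation M := levi_part.

Lemma levi_direct : direct_product M (twisted_A F Phi) H.
Proof.
split=> //.
- exact: twisted_A_subgroup.
- exact: rotation_part_subgroup.
- by move=> f h Tf Hh; exact: twisted_A_rotation_comm.
apply/seteqP; split=> [f [/tw_p[t [-> fp]] Hf]|f ->]; last first.
  by split; [case: twisted_A_subgroup | case: rotation_part_subgroup].
move: fp; rewrite (K_fix_p dimV hF (rotation_part_K Hf)) -{1}[p]scale1r => /eqP.
rewrite -subr_eq0 -scalerBl scaler_eq0 (negbTE (p_neq0 hF)) orbF subr_eq0 => /eqP e1.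
have -> : t = 0 by apply: expR_inj; rewrite expR0.
by rewrite scale0r end_exp0.
Qed.

Lemma levi_G : M `<=` G.
Proof.
by move=> _ [f Tf [h Hh <-]]; exact: (G_comp hG (twisted_A_G Tf) (rotation_part_G Hh)).
Qed.

Lemma unipotent_G : N_group F `<=` G.
Proof.
move=> _ [c _ <-]; rewrite -(end_exp_wedge_N dimV hF).
exact: (lie_exp (gunip (eta_p_evec hF c))).
Qed.

Lemma levi_subgroup : is_subgroup M.
Proof.
apply: commuting_product_subgroup.
- by move=> f Tf; apply: (isometry_lker dimV hF); exact: (G_iso hG (twisted_A_G Tf)).
- by move=> f Hf; apply: (isometry_lker dimV hF); exact: (G_iso hG (rotation_part_G Hf)).
- exact: twisted_A_subgroup.
- exact: rotation_part_subgroup.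
- exact: twisted_A_rotation_comm.
Qed.

Let normalN f h : G f -> N_group F h -> N_group F (f \o h \o f^-1)%VF.
Proof.
move=> Gf [c _ <-]; have [a a0 fp] := Gpos Gf.
by apply: (N_normal dimV hF c (G_iso hG Gf) _ fp); rewrite gt_eqF.
Qed.

(** With [s] and [x] read off from [Y p] and [Y q], the difference [C = Y - s X1 - p /\ x] kills [p]
    and [q]. As [X1] and [C] commute, [exp(s X1 + C)] splits, and the summand [p /\ x] costs a
    factor in [N]. *)
Lemma lie_exp_decomp Y : g Y -> exists m k, [/\ M m, N_group F k & end_exp Y = (m \o k)%VF].
Proof.
move=> gY; have sY := lie_skew dimV hF hG gY.
set s := eta q (Y p).
have Yp : Y p = s *: p.
  have Gp f : G f -> exists a, f p = a *: p by move=> /Gpos[a _ fp]; exists a.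
  exact: (lie_eigen dimV hG hF Gp gY).
pose x := Y q - eta p (Y q) *: q.
have px : eta p x = 0 by rewrite /x !eta_lin (frE hF); ring.
have qx : eta q x = 0.
  rewrite /x !eta_lin (frE hF) mulr0 subr0 etaC; exact: skew_self.
have pYq : eta p (Y q) = - s.
  by rewrite -[LHS]opprK -sY Yp etaZl (frE hF) mulr1.
have Yq : Y q = x - s *: q by rewrite -scaleNr -pYq subrK.
clearbody x.
pose C := Y - s *: X1 - wedge eta p x.
have sC : stab C.
  split.
  - exact: (lie_B hG (lie_B hG gY (lie_Z hG s gX1)) (gunip px)).
  - rewrite !add_lfunE !opp_lfunE scale_lfunE X1p Yp wedgeE (frE hF) (etaC eta x) px.
    by rewrite !scale0r !subr0 subrr.
  - rewrite !add_lfunE !opp_lfunE scale_lfunE X1q Yq wedgeE (frE hF) (etaC eta x) qx.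
    by rewrite scale0r scale1r subr0 scalerN opprK subrK subrr.
have [gC Cp Cq] := sC; have skC := lie_skew dimV hF hG gC.
have YE : Y = (s *: X1 + C) + wedge eta p x by rewrite /C addrA subrK addrC subrK.
have [|||c Ec] := @end_exp_unipotent_rel _ _ _ eta dimV F hF (s *: X1 + C) x.
- by apply: skew_add => //; exact: skew_scale.
- by exists s; rewrite add_lfunE scale_lfunE X1p Cp addr0.
- exact: px.
exists (end_exp (s *: X1) \o end_exp C)%VF, (N_elt F c); split.
- exists (end_exp (s *: X1)); first by apply/tw_exp; exists s.
  by exists (end_exp C) => //; exact: rotation_part_exp.
- by exists c.
rewrite {1}YE Ec; congr (_ \o _)%VF; apply: end_expD.
by rewrite -comp_lfunZl -comp_lfunZr comm1.
Qed.

Lemma parabolic_semidirect : semidirect_product G M (N_group F).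
Proof.
split.
- exact: levi_subgroup.
- exact: (N_group_subgroup dimV hF).
- exact: normalN.
(* A common element fixes [p], so its dilation part is trivial and it lies in [K]; then it fixes
   [q], which forces the parameter in [N] to vanish. *)
- apply/seteqP; split=> [f [Mf [c _ Nc]]|f ->]; last first.
    by split; [case: levi_subgroup | case: (N_group_subgroup dimV hF)].
  have [k /tw_p[t [kE kp]] [h Hh fE]] := Mf; have Kh := rotation_part_K Hh.
  have fp : f p = p by rewrite -Nc (N_elt_p dimV hF).
  have t0 : t = 0.
    apply: expR_inj; rewrite expR0; apply/eqP; rewrite -subr_eq0.
    have := scaler_eq0 (expR t - 1) p; rewrite (negbTE (p_neq0 hF)) orbF => <-.
    rewrite scalerBl scale1r subr_eq0 -kp -{2}fp -fE comp_lfunE.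
    by rewrite (K_fix_p dimV hF Kh).
  have fK : f = h by rewrite -fE kE t0 scale0r end_exp0 comp_lfun1l.
  have fq : f q = q by rewrite fK (K_fix_q dimV hF Kh).
  have [_ _] := N_eltE dimV hF c q.
  rewrite Nc fq (ecol_q hF) (frE hF) scale1r add0r => /esym c0.
  rewrite -Nc c0; have := end_exp_wedge_N dimV hF 0.
  rewrite (_ : evec F 0 = 0) ?wedge0r ?end_exp0; first by move=> <-.
  by rewrite /evec big1// => i _; rewrite mxE scale0r.
apply/seteqP; split=> [|_ [m Mm [k Nk <-]]]; last first.
  exact: (G_comp hG (levi_G Mm) (unipotent_G Nk)).
have [M1 MM MV] := levi_subgroup; have [N1 NM NV] := N_group_subgroup dimV hF.
apply: (G_ind hG) => [|Y f gY [m Mm [k Nk <-]]].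
  by exists \1%VF => //; exists \1%VF => //; rewrite comp_lfun1l.
have [m' [k' [Mm' Nk' ->]]] := lie_exp_decomp gY.
have im := G_iso hG (levi_G Mm).
exists (m' \o m)%VF; first exact: MM.
(* Normality moves [k'] to the right past [m]: [m' k' m k = (m' m) (m^-1 k' m) k]. *)
exists ((m^-1 \o k' \o m) \o k)%VF.
  apply: NM => //; have := normalN (levi_G (MV _ Mm)) Nk'.
  by rewrite (isometry_invE dimV hF im).
by rewrite -!comp_lfunA (comp_lfunA m) (isometry_compfV dimV hF im) comp_lfun1l.
Qed.

End Assemble.

(** * Simply transitive groups *)

Section SimplyTransitive.
Context {R : realType} {V : vectType R} {n : nat} (eta : {symmetric V}).
Hypothesis dimV : \dim {:V} = (n + 2)%N.
Implicit Types (u v w x y z : V) (f h X Y C : 'End(V)).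
Variables (F : frame V n) (hF : adapted eta F).
Local Notation p := (fr_p F).
Local Notation q := (fr_q F).

Lemma end_exp_fix X v : (forall t : R, end_exp (t *: X) v = v) -> X v = 0.
Proof.
move=> Xv; apply: (eta_nondeg dimV hF) => w.
have [_ D] := end_exp_scalar_derive X (eval_form eta v w) 0.
rewrite scale0r end_exp0 comp_lfun1r in D.
rewrite -[LHS]/(eval_form eta v w X) -D.
rewrite (_ : (fun s => _) = cst (eta v w)) ?derive_cst//.
by apply/funext => s; rewrite /= /eval_form Xv.
Qed.

(** In the parameter [t = ln a] the homomorphism is a one-parameter group; differentiability at 0
    spreads by translation and yields the differential equation of an exponential. *)
Lemma hom_generator Phi : lie_group_hom F Phi -> exists B, [/\ skew_end eta B,
  B p = 0, B q = 0 & forall a, 0 < a -> Phi (A_elt F a) = end_exp (ln a *: B)].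
Proof.
move=> [PhiK PhiM PhiD]; have hb := fr_basisP hF; set b := fr_basis F in hb PhiD.
have Ag a : 0 < a -> A_group F (A_elt F a) by move=> a0; exists a.
pose f (t : R) := Phi (A_elt F (expR t)).
have fK t : K_group F (f t) by apply: PhiK; apply: Ag; exact: expR_gt0.
have fM s t : f (s + t) = (f s \o f t)%VF.
  by rewrite /f expRD -(A_eltM dimV hF) PhiM//; apply: Ag; exact: expR_gt0.
have f0 : f 0 = \1%VF.
  have := fM 0 0; rewrite addr0 => E.
  have k0 := isometry_lker dimV hF (K_isometry dimV hF (fK 0)).
  by rewrite -[LHS]comp_lfun1l -(lker0_compVf k0) -comp_lfunA -E (lker0_compVf k0).
have [Bm D0] : exists Bm, mx_derive (fun t => mx_in b (f t)) 0 Bm.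
  exists (\matrix_(i, j) ('D_1 (fun t => mx_in b (Phi (A_elt F t)) i j) 1)) => i j.
  rewrite mxE.
  have D1 : is_derive (expR 0) (1 : R) (fun t => mx_in b (Phi (A_elt F t)) i j)
      ('D_1 (fun t => mx_in b (Phi (A_elt F t)) i j) 1).
    by rewrite expR0; apply: derivableP; exact: (PhiD i j 0%N 1 ltr01).
  have := is_derive1_comp D1 (is_derive_expR 0).
  by rewrite expR0 mulr1.
have Dt t : mx_derive (fun t => mx_in b (f t)) t (Bm *m mx_in b (f t)).
  (* Used through [f s = f (s - t) f t], which reduces the derivative at [t] to that at 0. *)
  have Ds : mx_derive (fun s => mx_in b (f (s - t))) t Bm.
    move=> i j.
    have D1 : is_derive (t - t) (1 : R) (fun t => mx_in b (f t) i j) (Bm i j).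
      by rewrite subrr; exact: D0.
    have D2 : is_derive t (1 : R) (fun s : R => s - t) 1.
      by apply: is_derive_eq; rewrite subr0.
    have := @is_derive1_comp R (fun t => mx_in b (f t) i j) (fun s : R => s - t) t _ _ D1 D2.
    by rewrite mulr1.
  have := mx_derive_mul Ds (mx_derive_cst (mx_in b (f t)) t).
  have -> : Bm *m mx_in b (f t) + mx_in b (f (t - t)) *m 0 = Bm *m mx_in b (f t).
    by rewrite [X in _ + X]mulmx0 addr0.
  rewrite (_ : (fun s => _) = (fun s => mx_in b (f s))) //.
  by apply/funext => s; rewrite -mx_in_comp// -fM subrK.
pose B := end_in b Bm.
have fB t : f t = end_exp (t *: B).
  apply: (mx_in_inj hb); rewrite mx_in_exp// linearZ /= end_inK//.
  apply: (@expmx_unique _ _ Bm (fun t => mx_in b (f t))) => //.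
  by rewrite f0 mx_in1.
exists B; split.
- by apply: (exp_isometry_skew dimV hF) => t; rewrite -fB; exact: (K_isometry dimV hF).
- by apply: end_exp_fix => t; rewrite -fB (K_fix_p dimV hF (fK t)).
- by apply: end_exp_fix => t; rewrite -fB (K_fix_q dimV hF (fK t)).
by move=> a a0; rewrite -fB /f lnK.
Qed.

(** * Groups [exp(R X1) |x N], covering [A |x N] (with [B = 0]) and [A^Phi |x N] *)

Section Group.
Variables (B : 'End(V)) (sB : skew_end eta B) (Bp : B p = 0) (Bq : B q = 0).
Let X1 := wedge eta q p + B.
Variables (G T : set 'End(V)).
Hypothesis TE : forall f, T f <-> exists t : R, f = end_exp (t *: X1).
Hypothesis GT : semidirect_product G T (N_group F).

Let sX1 : skew_end eta X1. Proof. by apply: skew_add => //; exact: wedge_skew. Qed.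
Let X1p : X1 p = p.
Proof. by rewrite add_lfunE wedgeE !(frE hF) scale1r scale0r subr0 Bp addr0. Qed.
Let X1q : X1 q = - q.
Proof. by rewrite add_lfunE wedgeE !(frE hF) scale1r scale0r sub0r Bq addr0. Qed.

Let G_E f : G f <-> exists (t : R) (c : 'cV[R]_n), f = (end_exp (t *: X1) \o N_elt F c)%VF.
Proof.
have [_ _ _ _ ->] := GT; split=> [[m /TE[t ->] [_ [c _ <-] <-]]|[t [c ->]]].
  by exists t, c.
by exists (end_exp (t *: X1)); [apply/TE; exists t | exists (N_elt F c) => //; exists c].
Qed.

Let exp_p (t : R) : end_exp (t *: X1) p = expR t *: p.
Proof. by apply: end_exp_eigen; rewrite scale_lfunE X1p. Qed.

Lemma twisted_SO : G `<=` SO eta.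
Proof.
move=> f /G_E[t [c ->]]; have [i d] := skew_exp_SO dimV hF (skew_scale t sX1).
split; first by apply: isometry_comp => //; exact: (N_elt_isometry dimV hF).
by rewrite end_det_comp d (end_det_N hF) mulr1.
Qed.

Lemma twisted_subgroup : is_subgroup G.
Proof.
have [[T1 TM TV] [N1 NM NV] nN _ GE] := GT.
have ilk f : G f -> lker f == 0%VS.
  by move=> /twisted_SO[fi _]; exact: (isometry_lker dimV hF).
have TG f : T f -> G f.
  by move=> Tf; rewrite GE; exists f => //; exists \1%VF => //; rewrite comp_lfun1r.
have NG f : N_group F f -> G f.
  by move=> Nf; rewrite GE; exists \1%VF => //; exists f => //; rewrite comp_lfun1l.
split; first by apply: TG.
- rewrite {1 2}GE => _ _ [m Tm [k Nk <-]] [m' Tm' [k' Nk' <-]].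
  have k0 := ilk _ (TG _ Tm').
  rewrite GE; exists (m \o m')%VF; first exact: TM.
  exists ((m'^-1 \o k \o m') \o k')%VF.
    apply: NM => //; have := nN _ _ (TG _ (TV _ Tm')) Nk.
    by rewrite (compl_inv (lker0_compVf k0)).
  by rewrite -!comp_lfunA (comp_lfunA m') (lker0_compfV k0) comp_lfun1l.
rewrite {1}GE => _ [m Tm [k Nk <-]].
have m0 := ilk _ (TG _ Tm); have k0 := ilk _ (NG _ Nk).
rewrite (comp_lfun_inv m0 k0) GE; exists (m^-1)%VF; first exact: TV.
exists (m \o k^-1 \o m^-1)%VF; first exact: (nN _ _ (TG _ Tm) (NV _ Nk)).
by rewrite -!comp_lfunA (comp_lfunA _ m) (lker0_compVf m0) comp_lfun1l.
Qed.

Lemma N_elt_perp c v : eta p v = 0 -> exists a, N_elt F c v = v + a *: p.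
Proof.
move=> pv; have [h1 _ h3] := N_eltE dimV hF c v.
exists (eta q (N_elt F c v) - eta q v).
apply: (frame_eqP dimV hF); rewrite ?ecol_lin ?etaDr ?etaZr ?(frE hF) ?(ecol_p hF)
  ?h1 ?h3 ?pv ?scaler0 ?scale0r ?addr0//; ring.
Qed.

(** The Lie algebra is defined by one-parameter subgroups, so an arbitrary [Y] with all [exp(tY)] in
    [G] must be analysed: [Y p] and [Y q] determine [s] and [x], and the remaining part vanishes on
    the whole frame. *)
Lemma lie_twisted Y : lie_algebra G Y <->
  exists (s : R) x, eta p x = 0 /\ Y = s *: X1 + wedge eta p x.
Proof.
split; last first.
  move=> [s [x [px ->]]] t; apply/G_E.
  have [|||c Ec] := @end_exp_unipotent_rel _ _ _ eta dimV F hF ((t * s) *: X1) (t *: x).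
  - exact: skew_scale.
  - by exists (t * s); rewrite scale_lfunE X1p.
  - by rewrite etaZr px mulr0.
  have -> : t *: (s *: X1 + wedge eta p x) = (t * s) *: X1 + wedge eta p (t *: x).
    by rewrite scalerDr scalerA wedgeZr.
  by rewrite Ec; exists (t * s), c.
move=> gY; have GY t : G (end_exp (t *: Y)) by exact: gY.
have sY : skew_end eta Y.
  by apply: (exp_isometry_skew dimV hF) => t; have [] := twisted_SO (GY t).
have Yp : Y p = eta q (Y p) *: p.
  apply: (exp_eigen_line dimV hF) => t; have /G_E[s [c ->]] := GY t.
  by exists (expR s); rewrite comp_lfunE (N_elt_p dimV hF).
set s := eta q (Y p) in Yp; exists s.
pose x := Y q - eta p (Y q) *: q.
have px : eta p x = 0 by rewrite /x !eta_lin (frE hF); ring.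
have qx : eta q x = 0.
  by rewrite /x !eta_lin (frE hF) mulr0 subr0 etaC; exact: skew_self.
have pYq : eta p (Y q) = - s by rewrite -[LHS]opprK -sY Yp etaZl (frE hF) mulr1.
have Yq : Y q = x - s *: q by rewrite -scaleNr -pYq subrK.
clearbody x; exists x; split=> //.
(* The eigenvalue on [p] identifies the dilation parameter of [exp(tY)] as [t s], and [N] acts
   trivially on [p^perp / p]; differentiating at 0 compares [Y] with [s X1] there. *)
have perp v w : eta p v = 0 -> eta p w = 0 -> eta (Y v) w = eta ((s *: X1) v) w.
  move=> pv pw.
  have E t : eta (end_exp (t *: Y) v) w = eta (end_exp (t *: (s *: X1)) v) w.
    have /G_E[t' [c Ec]] := GY t.
    have : end_exp (t *: Y) p = expR (t * s) *: p.
      by apply: end_exp_eigen; rewrite scale_lfunE Yp scalerA.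
    rewrite {1}Ec comp_lfunE (N_elt_p dimV hF) exp_p => /eqP.
    rewrite -subr_eq0 -scalerBl scaler_eq0 (negbTE (p_neq0 hF)) orbF subr_eq0.
    move=> /eqP/expR_inj tt'; rewrite Ec tt' scalerA comp_lfunE.
    have [a ->] := N_elt_perp c pv.
    by rewrite lfunD lfunZ exp_p !eta_lin pw !mulr0 addr0.
  have [_ D1] := end_exp_scalar_derive Y (eval_form eta v w) 0.
  have [_ D2] := end_exp_scalar_derive (s *: X1) (eval_form eta v w) 0.
  rewrite scale0r end_exp0 comp_lfun1r in D1.
  rewrite scale0r end_exp0 comp_lfun1r in D2.
  have EE : (fun t : R => eval_form eta v w (end_exp (t *: Y)))
      = (fun t => eval_form eta v w (end_exp (t *: (s *: X1)))).
    by apply/funext => t; exact: E.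
  by rewrite EE D2 in D1; exact: (esym D1).
pose C := Y - s *: X1 - wedge eta p x.
have sC : skew_end eta C.
  apply: skew_add; last by rewrite -wedgeNr; exact: wedge_skew.
  by apply: skew_add => //; rewrite -scaleNr; exact: skew_scale.
have Cp : C p = 0.
  rewrite !add_lfunE !opp_lfunE scale_lfunE X1p Yp wedgeE (frE hF) (etaC eta x) px.
  by rewrite !scale0r !subr0 subrr.
have Cq : C q = 0.
  rewrite !add_lfunE !opp_lfunE scale_lfunE X1q Yq wedgeE (frE hF) (etaC eta x) qx.
  by rewrite scale0r scale1r subr0 scalerN opprK subrK subrr.
have Ce (i : 'I_n) : C (fr_e F)`_i = 0.
  apply: (frame_ext dimV hF) => [||j]; rewrite eta0r.
  - by rewrite -[LHS]opprK -sC Cp eta0l oppr0.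
  - by rewrite -[LHS]opprK -sC Cq eta0l oppr0.
  have pe (k : 'I_n) : eta p (fr_e F)`_k = 0 := eta_pe hF k.
  rewrite etaC !add_lfunE !opp_lfunE wedgeE !etaDl !etaNl (perp _ _ (pe i) (pe j)).
  by rewrite subrr sub0r pe scale0r sub0r etaNl etaZl pe mulr0 oppr0 oppr0.
have C0 : C = 0.
  apply/lfunP => v; rewrite zero_lfunE (frame_decomp dimV hF v) !lfun_lin lfun_sum.
  rewrite Cp Cq !scaler0 add0r addr0 big1// => i _.
  by rewrite lfunZ Ce scaler0.
by apply/eqP; rewrite -subr_eq0 opprD addrA -/C C0.
Qed.

Lemma twisted_connected : connected_lie_subgroup (SO eta) G.
Proof.
split.
- exact: twisted_SO.
- exact: twisted_subgroup.
- split.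
  + apply/lie_twisted; exists 0, 0; rewrite eta0r; split=> //.
    by rewrite scale0r wedge0r addr0.
  + move=> X Y /lie_twisted[s [x [px ->]]] /lie_twisted[t [y [py ->]]].
    apply/lie_twisted; exists (s + t), (x + y); split; first by rewrite etaDr px py addr0.
    by rewrite scalerDl wedgeDr addrACA.
  + move=> t X /lie_twisted[s [x [px ->]]]; apply/lie_twisted.
    exists (t * s), (t *: x); split; first by rewrite etaZr px mulr0.
    by rewrite scalerDr scalerA wedgeZr.
  + move=> X Y /lie_twisted[s [x [px XE]]] /lie_twisted[t [y [py YE]]].
    have sX : skew_end eta X.
      by rewrite XE; apply: skew_add; [exact: skew_scale | exact: wedge_skew].
    have wp z : eta p z = 0 -> wedge eta p z p = 0.
      by move=> pz; rewrite wedgeE (frE hF) (etaC eta z) pz !scale0r subrr.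
    have Xp : X p = s *: p by rewrite XE add_lfunE scale_lfunE X1p wp// addr0.
    have pX1 z : eta p z = 0 -> eta p (X1 z) = 0.
      by move=> pz; rewrite -[LHS]opprK -sX1 X1p pz oppr0.
    (* With [Y = t X1 + p /\ y], the first bracket term is [- t [X1, p /\ x]] and the second is
       [[X, p /\ y]]; both are wedges with [p]. *)
    apply/lie_twisted; exists 0, (- t *: (x + X1 x) + (s *: y + X y)); split.
      rewrite !eta_lin px pX1// py -[eta p (X y)]opprK -sX Xp etaZl py; ring.
    have h1 : (X \o wedge eta p y)%VF - (wedge eta p y \o X)%VF = wedge eta p (s *: y + X y).
      by rewrite (wedge_bracket _ _ sX) Xp wedgeZl wedgeDr wedgeZr.
    have h2 : (X1 \o wedge eta p x)%VF - (wedge eta p x \o X1)%VF = wedge eta p (x + X1 x).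
      by rewrite (wedge_bracket _ _ sX1) X1p wedgeDr.
    have h3 : (X \o X1)%VF - (X1 \o X)%VF = - wedge eta p (x + X1 x).
      rewrite -h2 XE (comp_lfunDl (s *: X1) _ X1) (comp_lfunDr X1 (s *: X1))
        -comp_lfunZl -comp_lfunZr.
      by rewrite opprD addrACA subrr add0r opprB.
    rewrite scale0r add0r wedgeDr wedgeZr -h1 scaleNr -scalerN -h3.
    rewrite YE (comp_lfunDl (t *: X1) _ X) (comp_lfunDr X (t *: X1))
      -comp_lfunZl -comp_lfunZr scalerBr.
    by rewrite opprD addrACA.
move=> f /G_E[t [c ->]].
exists [:: t *: X1; wedge eta p (evec F c)]; split.
  move=> X; rewrite !inE => /orP[/eqP->|/eqP->]; apply/lie_twisted.
    by exists t, 0; rewrite eta0r wedge0r addr0.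
  exists 0, (evec F c); rewrite scale0r add0r; split=> //.
  exact: (eta_p_evec hF).
by rewrite /= comp_lfun1r (end_exp_wedge_N dimV hF).
Qed.

Section Action.
Variables (F0 : frame V n) (hF0 : adapted eta F0).
Local Notation L := (lobachevskian eta F0).

(** Horospherical coordinates: the norm equation is linear in the remaining coordinate [eta q x],
    with nonzero coefficient [2 * eta p x]. *)
Lemma hyperboloid_ext x y : eta x x = eta y y -> eta p x = eta p y -> eta p x != 0 ->
  ecol eta F x = ecol eta F y -> x = y.
Proof.
move=> xx px p0 ex; apply: (frame_eqP dimV hF) => //.
move: xx; rewrite !(eta_ecol dimV hF x x) !(eta_ecol dimV hF y y) ex -px.
move=> /addIr; rewrite [eta q x * _]mulrC [eta q y * _]mulrC -!mulr2n => /eqP.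
by rewrite eqr_pMn2r// => /eqP/(mulfI p0).
Qed.

(** [exp(t X1)] multiplies [eta p] by [e^-t], whereas [N_elt F c] preserves it and translates the
    [E]-coordinate by [eta p x *: c]. Thus [eta p] determines [t], and then the [E]-coordinate
    determines [c]. *)
Lemma twisted_simply_transitive : acts_simply_transitively G L.
Proof.
have [sg [sg0 LE]] := L_sign dimV hF0 hF.
have Gi f : G f -> end_isometry eta f by move=> /twisted_SO[].
have acts : acts_on G L.
  move=> f x Gf Lx; have /G_E[t [c fE]] := Gf.
  apply: (parabolic_preserves_L dimV hF0 hF (Gi f Gf) (expR_gt0 t)) Lx.
  by rewrite fE comp_lfunE (N_elt_p dimV hF) exp_p.
split=> // x y Lx Ly.
have /LE[xx px] := Lx; have /LE[yy py] := Ly.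
have x0 : eta p x != 0 by apply: contraTneq px => ->; rewrite mulr0 ltxx.
have y0 : eta p y != 0 by apply: contraTneq py => ->; rewrite mulr0 ltxx.
have r0 : 0 < eta p x / eta p y.
  rewrite -(@pmulr_rgt0 _ (sg ^+ 2 * eta p y ^+ 2)); last first.
    by rewrite mulr_gt0// exprn_even_gt0.
  rewrite (_ : _ * (_ / _) = (sg * eta p x) * (sg * eta p y)); last by field.
  by rewrite nmulr_rgt0.
have exp_i t := skew_exp_isometry (skew_scale t sX1).
have expV (t : R) z : end_exp (t *: X1) (end_exp (- t *: X1) z) = z.
  by rewrite scaleNr -comp_lfunE end_expN id_lfunE.
have Vexp (t : R) z : end_exp (- t *: X1) (end_exp (t *: X1) z) = z.
  by have := expV (- t) z; rewrite opprK.
have pexp (t : R) z : eta p (end_exp (t *: X1) z) = expR (- t) * eta p z.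
  by rewrite -(exp_i t p z) exp_p etaZl mulrA -expRD addNr expR0 mul1r.
pose t := ln (eta p x / eta p y).
have et : expR t = eta p x / eta p y by rewrite lnK.
pose y' := end_exp (- t *: X1) y.
have py' : eta p y' = eta p x by rewrite pexp opprK et divfK.
pose c := (eta p x)^-1 *: (ecol eta F y' - ecol eta F x).
have Ncx : N_elt F c x = y'.
  have [h1 _ h3] := N_eltE dimV hF c x.
  apply: hyperboloid_ext; rewrite ?h1 ?h3//.
    by rewrite (N_elt_isometry dimV hF) exp_i xx yy.
  by rewrite /c scalerA mulfV// scale1r addrC subrK.
exists (end_exp (t *: X1) \o N_elt F c)%VF; split.
  split; first by apply/G_E; exists t, c.
  by rewrite comp_lfunE Ncx /y' expV.
move=> f' [/G_E[t' [c' ->]] f'x].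
have tt : t' = t.
  apply: expR_inj; rewrite et; apply: (mulIf y0); rewrite divfK//.
  rewrite -f'x comp_lfunE pexp mulrA -expRD subrr expR0 mul1r.
  by have [-> _ _] := N_eltE dimV hF c' x.
rewrite tt; congr (_ \o N_elt F _)%VF.
have : N_elt F c' x = y' by rewrite /y' -f'x comp_lfunE tt Vexp.
have [_ _ h3] := N_eltE dimV hF c' x.
move=> /(congr1 (ecol eta F)); rewrite h3 /c => <-.
by rewrite addrC addKr scalerA mulVf// scale1r.
Qed.

End Action.
End Group.
End SimplyTransitive.

(** * Consequences for transitive and simply transitive groups *)

Section Classification.
Context {R : realType} {V : vectType R} {n : nat} (eta : {symmetric V}).
Hypothesis dimV : \dim {:V} = (n + 2)%N.
Variables (F0 : frame V n) (hF0 : adapted eta F0).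
Variable G : set 'End(V).
Hypothesis hG : connected_lie_subgroup (SO eta) G.
Local Notation L := (lobachevskian eta F0).

Lemma parabolic_structure v : acts_transitively G L -> v != 0 -> eta v v = 0 ->
  (forall f, G f -> exists a : R, f v = a *: v) ->
  exists (F : frame V n) (M : set 'End(V)) (Phi : 'End(V) -> 'End(V)),
    let H := rotation_part F G in
    [/\ adapted eta F, fr_p F = v,
        forall f, G f -> exists2 a : R, 0 < a & f v = a *: v,
        [/\ H `<=` K_group F, is_subgroup H & lie_group_hom F Phi]
      & direct_product M (twisted_A F Phi) H /\
        semidirect_product G M (N_group F)].
Proof.
move=> hT v0 vv Gv.
have [F1 [hF1 F1p]] := adapted_frame_through dimV hF0 vv v0.
rewrite -F1p in Gv.
have [F [X [hF Fp gX Xp Xq]]] := lie_diag_frame dimV hF0 hG hT hF1 Gv.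
rewrite -Fp in Gv.
have Gpos := parabolic_pos dimV hF0 hG hT hF Gv.
have gunip := lie_unipotent dimV hF0 hG hT hF Gv gX Xp Xq.
have [B [sB Bp Bq gX1 commB]] := lie_centralizing dimV hF0 hG hF gX Xp Xq.
exists F, (levi_part eta F G B), (exp_hom eta F B); split.
- exact: hF.
- by rewrite Fp.
- by rewrite -F1p -Fp.
- split.
  + exact: (rotation_part_K dimV hF hG).
  + exact: (rotation_part_subgroup dimV hF hG).
  + exact: (exp_hom_lie dimV hF sB Bp Bq).
- split; first exact: (levi_direct dimV hF hG sB Bp Bq commB).
  exact: (parabolic_semidirect dimV hF hG Gpos sB Bp Bq gX1 commB gunip).
Qed.

Lemma simply_transitive_lie X x : acts_simply_transitively G L -> L x ->
  lie_algebra G X -> X x = 0 -> X = 0.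
Proof.
move=> [_ st] Lx gX Xx; have [g [_ gU]] := st x x Lx Lx.
have [G1 _ _] : is_subgroup G by case: hG.
have X1 t : end_exp (t *: X) = \1%VF.
  rewrite -(gU \1%VF); last by rewrite id_lfunE.
  apply/esym/gU; split; first exact: gX.
  rewrite (_ : end_exp _ x = expR 0 *: x); first by rewrite expR0 scale1r.
  by apply: end_exp_eigen; rewrite scale_lfunE Xx scale0r scaler0.
apply/lfunP => v; rewrite zero_lfunE; apply: (end_exp_fix dimV hF0) => t.
by rewrite X1 id_lfunE.
Qed.

(** Since [n >= 1] there is a vector [e_1]; the rotation generator [(p + q) /\ e_1] is nonzero but
    kills the point of [L] on the line of [p - q]. *)
Lemma all_wedges_not_simple : (1 <= n)%N -> acts_simply_transitively G L ->
  ~ (forall u v, lie_algebra G (wedge eta u v)).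
Proof.
move=> n0 st all_wedge; have [c [c0 Lo]] := exists_L dimV hF0 hF0.
set u := fr_p F0 + fr_q F0; set e := (fr_e F0)`_(Ordinal n0).
have ue : eta u e = 0 by rewrite etaDl (eta_pe hF0) (eta_qe hF0) addr0.
have ee : eta e e = 1 by rewrite (eta_ee hF0) eqxx.
have pu : eta (fr_p F0) u = 1 by rewrite etaDr (eta_pp hF0) (eta_pq hF0) add0r.
have W0 : wedge eta u e = 0.
  apply: (simply_transitive_lie st Lo); first exact: all_wedge.
  have uo : eta u (c *: (fr_p F0 - fr_q F0)) = 0.
    by rewrite /u !eta_lin !(frE hF0); ring.
  have eo : eta e (c *: (fr_p F0 - fr_q F0)) = 0.
    by rewrite /e !eta_lin !(frE hF0); ring.
  by rewrite wedgeE uo eo !scale0r subrr.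
have := congr1 (fun f : 'End(V) => eta (fr_p F0) (f e)) W0.
rewrite /= wedgeE zero_lfunE eta0r ue ee scale0r scale1r sub0r etaNr pu => /eqP.
by rewrite oppr_eq0 oner_eq0.
Qed.
End Classification.

Lemma twisted_trivial (R : realType) (V : vectType R) (n : nat) (F : frame V n)
    (Phi : 'End(V) -> 'End(V)) :
  ~ nontrivial_hom F Phi -> twisted_A F Phi = A_group F.
Proof.
move=> hPhi; have P1 f : A_group F f -> Phi f = \1%VF.
  by move=> Af; apply: contrapT => Pf; apply: hPhi; exists f.
apply/seteqP; split=> f.
  by move=> [g Ag <-]; rewrite P1// comp_lfun1l.
by move=> Af; exists f => //; rewrite P1// comp_lfun1l.
Qed.

Section Converse.
Context {R : realType} {V : vectType R} {n : nat} (eta : {symmetric V}).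
Hypothesis dimV : \dim {:V} = (n + 2)%N.
Variables (F : frame V n) (hF : adapted eta F).

Lemma A_group_exp f : A_group F f <->
  exists t : R, f = end_exp (t *: (wedge eta (fr_q F) (fr_p F) + 0)).
Proof.
rewrite addr0; split=> [[a /= a0 <-]|[t ->]].
  by exists (ln a); rewrite (end_exp_dilation dimV hF) lnK.
by rewrite (end_exp_dilation dimV hF); exists (expR t) => //=; exact: expR_gt0.
Qed.

Lemma twisted_A_hom_exp Phi : lie_group_hom F Phi -> exists B,
  [/\ skew_end eta B, B (fr_p F) = 0, B (fr_q F) = 0
    & forall f, twisted_A F Phi f <->
        exists t : R, f = end_exp (t *: (wedge eta (fr_q F) (fr_p F) + B))].
Proof.
move=> hPhi; have [B [sB Bp Bq PhiE]] := hom_generator dimV hF hPhi.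
exists B; split=> // f; split=> [[_ [a /= a0 <-] <-]|[t ->]].
  by exists (ln a); rewrite (end_exp_twisted dimV hF sB Bp Bq) lnK// PhiE.
rewrite (end_exp_twisted dimV hF sB Bp Bq); exists (A_elt F (expR t)).
  by exists (expR t) => //=; exact: expR_gt0.
by rewrite PhiE ?expRK//; exact: expR_gt0.
Qed.

End Converse.

Theorem theorem6 (R : realType) (n : nat) (V : vectType R)
    (eta : {symmetric V}) (F0 : frame V n)
    (hn : (1 <= n)%N) (heta : is_minkowski eta n) (hF0 : adapted eta F0) :
  (forall G : set 'End(V),
     connected_lie_subgroup (SO eta) G ->
     acts_transitively G (lobachevskian eta F0) ->
     G = SO0 eta \/
     exists l : {vspace V},
       [/\ isotropic_line eta l,
           preserves G l
         & exists F : frame V n,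
             [/\ adapted eta F,
                 l = <[fr_p F]>%VS
               & (exists H M : set 'End(V),
                    [/\ H `<=` K_group F,
                        is_subgroup H,
                        direct_product M (A_group F) H
                      & semidirect_product G M (N_group F)])
                 \/
                 (exists (H M : set 'End(V)) (Phi : 'End(V) -> 'End(V)),
                    [/\ H `<=` K_group F,
                        is_subgroup H,
                        lie_group_hom F Phi /\ nontrivial_hom F Phi,
                        direct_product M (twisted_A F Phi) H
                      & semidirect_product G M (N_group F)])]])
  /\
  (forall G : set 'End(V),
     (connected_lie_subgroup (SO eta) G /\
      acts_simply_transitively G (lobachevskian eta F0))
     <->
     (exists F : frame V n,
        adapted eta F /\
        (semidirect_product G (A_group F) (N_group F) \/
         exists Phi : 'End(V) -> 'End(V),
           [/\ lie_group_hom F Phi,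
               nontrivial_hom F Phi
             & semidirect_product G (twisted_A F Phi) (N_group F)]))).
Proof.
have dimV : \dim {:V} = (n + 2)%N by case: heta.
split=> [G hG hT|G].
  have [[v [v0 vv Gv]]|all_wedge] := line_or_all_wedges dimV hF0 hG hT; last first.
    by left; exact: (all_wedge_SO0 dimV hF0 hG hT all_wedge).
  right; exists <[v]>%VS.
  have [F [M [Phi [hF Fp Gpos [HK Hs hPhi] [MH GM]]]]] :=
    parabolic_structure dimV hF0 hG hT v0 vv Gv.
  split.
  - split=> [|x /vlineP[a ->]]; first by rewrite dim_vline v0.
    by rewrite etaZl etaZr vv !mulr0.
  - move=> f /Gpos[a a0 fv]; rewrite limg_line fv.
    apply/eqP; rewrite eqEsubv -!memvE memvZ ?memv_line//=.
    by apply/vlineP; exists a^-1; rewrite scalerA mulVf ?scale1r// gt_eqF.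
  exists F; split; [exact: hF | by rewrite Fp |].
  (* The construction always produces some [A^Phi]; a trivial [Phi] gives [A] itself, hence the
     first type. *)
  have [Phi1|Phi1] := pselect (nontrivial_hom F Phi).
    by right; exists (rotation_part F G), M, Phi.
  left; exists (rotation_part F G), M; split=> //.
  by rewrite -(twisted_trivial Phi1).
split=> [[hG st]|[F [hF hS]]].
  have hT : acts_transitively G (lobachevskian eta F0).
    split=> [|x y Lx Ly]; first by case: st.
    by have [g [gxy _]] := st.2 x y Lx Ly; exists g.
  have [[v [v0 vv Gv]]|all_wedge] := line_or_all_wedges dimV hF0 hG hT; last first.
    by have := all_wedges_not_simple dimV hF0 hG hn st all_wedge.
  have [F [M [Phi [hF Fp Gpos [HK Hs hPhi] [MH GM]]]]] :=
    parabolic_structure dimV hF0 hG hT v0 vv Gv.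
  have H1 h : rotation_part F G h -> h = \1%VF.
    move=> Hh; have [c [_ Lo]] := exists_L dimV hF0 hF.
    have [g [_ gU]] := st.2 _ _ Lo Lo.
    have [G1 _ _] : is_subgroup G by case: hG.
    rewrite -(gU \1%VF); last by rewrite id_lfunE.
    apply/esym/gU; split; first exact: (rotation_part_G hG Hh).
    rewrite lfunZ lfunD lfunN (K_fix_p dimV hF (HK _ Hh)).
    by rewrite (K_fix_q dimV hF (HK _ Hh)).
  have MT : M = twisted_A F Phi.
    have [_ [Hid _ _] _ _ ->] := MH; apply/seteqP; split=> f.
      by move=> [a Ta [h /H1-> <-]]; rewrite comp_lfun1r.
    by move=> Tf; exists f => //; exists \1%VF; rewrite ?comp_lfun1r.
  rewrite MT in GM; exists F; split; first exact: hF.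
  have [Phi1|Phi1] := pselect (nontrivial_hom F Phi).
    by right; exists Phi.
  by left; rewrite -(twisted_trivial Phi1).
have [GT|[Phi [hPhi _ GT]]] := hS.
  have s0 : skew_end eta 0 by move=> x y; rewrite !zero_lfunE eta0l eta0r oppr0.
  have z w : (0 : 'End(V)) w = 0 by rewrite zero_lfunE.
  split; first exact: (twisted_connected dimV hF s0 (z _) (z _) (A_group_exp dimV hF) GT).
  exact: (twisted_simply_transitive dimV hF s0 (z _) (A_group_exp dimV hF) GT hF0).
have [B [sB Bp Bq TE]] := twisted_A_hom_exp dimV hF hPhi.
split; first exact: (twisted_connected dimV hF sB Bp Bq TE GT).
exact: (twisted_simply_transitive dimV hF sB Bp TE GT hF0).
Qed.
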